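(* There exist constants $d_0,\nu_0>0$ and $C>1$, depending only on the shear profile $b$, such that for every $\nu\in(0,\nu_0)$ and every $f_{\rm in}\in C^\infty(\bar\Omega)$ satisfying the boundary conditions (periodic, Dirichlet, or Neumann) and $\int_{\mathbb T} f_{\rm in}(x,y)\,dx=0$ for all $y$, the solution $f$ of $$\partial_t f+b(y)\,\partial_x f-\nu\,\partial_{yy}f=0\quad\text{on }\Omega\times(0,\infty),\qquad f(\cdot,0)=f_{\rm in},$$ with periodic, homogeneous Dirichlet, or homogeneous Neumann conditions in $y$, satisfies $$\|f(\cdot,t)\|_{L^2(\Omega)}\le C\,\|f_{\rm in}\|_{L^2(\Omega)}\exp\!\left(-d_0\,\nu^{\frac{N+1}{N+3}}\,t\right)\qquad\text{for all }t>0 .$$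
   Context: $\mathbb T=\mathbb R/\mathbb Z$. $\Omega=\mathbb T\times D$, where either $D=\mathbb T$ (periodic setting) or $D=(0,1)$; when $D=(0,1)$ one imposes either homogeneous Dirichlet conditions ($f=0$ on $\{y=0,1\}$) or homogeneous Neumann conditions ($\partial_y f=0$ on $\{y=0,1\}$). The shear profile $b\in C^\infty(\bar D)$ is real-valued and has precisely $M\ge 0$ critical points $y_1,\dots,y_M$ in $\bar D$ (finitely many). At each critical point $y_i$ there is an integer $N_i\ge1$ with $b^{(k)}(y_i)=0$ for all $1\le k\le N_i$ and $b^{(N_i+1)}(y_i)\ne0$. Set $N=\max_{1\le i\le M}N_i$ if $M\ge1$, and $N=0$ if $M=0$. Solutions: for each $f_{\rm in}\in C^\infty(\bar\Omega)$ satisfying the chosen boundary conditions, ''the solution'' is the unique $f\in C([0,\infty);L^2(\Omega))\cap C^\infty(\bar\Omega\times(0,\infty))$ solving the equation with $f(\cdot,0)=f_{\rm in}$ and the chosen boundary conditions. *)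

(* Defs.v *)
From HB Require Import structures.
From mathcomp Require Import all_boot all_order all_algebra.
From mathcomp Require Import all_classical all_reals all_analysis.

Set Implicit Arguments.
Unset Strict Implicit.
Unset Printing Implicit Defensive.

Import Order.TTheory GRing.Theory Num.Theory.
Import numFieldNormedType.Exports.

Local Open Scope classical_set_scope.
Local Open Scope ring_scope.

(* [Circle] is D = T and [UnitInterval] is D = (0,1). Functions on the circle T are
   represented by 1-periodic functions on the real line. *)
Inductive ydomain := Circle | UnitInterval.

Inductive bcond := Periodic | Dirichlet | Neumann.

Definition bcond_domain (c : bcond) : ydomain :=
  if c is Periodic then Circle else UnitInterval.

Section definitions.
Context {R : realType}.
Implicit Types (D : ydomain) (c : bcond) (nu : R).

Definition openD D : set R := if D is Circle then setT else `]0, 1[.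

Definition closedD D : set R := if D is Circle then setT else `[0, 1].

(* One representative for each point of the closure of D. *)
Definition fundD D : set R := if D is Circle then `[0, 1[ else `[0, 1].

Definition y_periodic D (g : R -> R) : Prop :=
  if D is Circle then forall y, g (y + 1) = g y else True.

(* Smoothness up to the boundary: all the derivatives exist in the open set and
   extend continuously to its closure. The extended derivatives are collected
   in a family, which is determined by the function on that closure. Values
   outside the closure are irrelevant. *)

(* b is in C^oo(closure of D), and B k is its k-th derivative. *)
Definition smooth_y D (b : R -> R) (B : nat -> R -> R) : Prop :=
  [/\ y_periodic D b,
      forall y, closedD D y -> B 0%N y = b y,
      forall k, {within closedD D, continuous (B k)} &
      forall k (y : R), openD D y -> is_derive y (1 : R) (B k) (B k.+1 y)].

(* g x y is in C^oo(T x closure of D), and G j k = d_x^j d_y^k g. *)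
Definition smooth_xy D (g : R -> R -> R) (G : nat -> nat -> R -> R -> R) : Prop :=
  [/\ forall x y, closedD D y -> g (x + 1) y = g x y,
      forall x, y_periodic D (g x),
      forall x y, closedD D y -> G 0%N 0%N x y = g x y,
      forall j k, {within [set p : R * R | closedD D p.2],
        continuous (fun p : R * R => G j k p.1 p.2)} &
      forall j k (x y : R), openD D y ->
        is_derive x (1 : R) (fun x' => G j k x' y) (G j.+1 k x y) /\
        is_derive y (1 : R) (G j k x) (G j k.+1 x y)].

(* f t x y is in C^oo((0,oo) x T x closure of D), and
   F i j k = d_t^i d_x^j d_y^k f. *)
Definition smooth_txy D (f : R -> R -> R -> R)
    (F : nat -> nat -> nat -> R -> R -> R -> R) : Prop :=
  [/\ forall (t x y : R), 0 < t -> closedD D y -> f t (x + 1) y = f t x y,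
      forall (t x : R), 0 < t -> y_periodic D (f t x),
      forall (t x y : R), 0 < t -> closedD D y -> F 0%N 0%N 0%N t x y = f t x y,
      forall i j k,
        {within [set p : R * R * R | 0 < p.1.1 /\ closedD D p.2],
          continuous (fun p : R * R * R => F i j k p.1.1 p.1.2 p.2)} &
      forall i j k (t x y : R), 0 < t -> openD D y ->
        [/\ is_derive t (1 : R) (fun t' => F i j k t' x y) (F i.+1 j k t x y),
            is_derive x (1 : R) (fun x' => F i j k t x' y) (F i j.+1 k t x y) &
            is_derive y (1 : R) (F i j k t x) (F i j k.+1 t x y)]].

(* b has precisely M critical points y_i in the closure of D, and at y_i exactly
   the derivatives of orders 1, ..., N_i vanish before the first nonzero one. *)
Definition critical_points D (B : nat -> R -> R) (M : nat)
    (yc : 'I_M -> R) (Nc : 'I_M -> nat) : Prop :=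
  [/\ injective yc,
      forall y, fundD D y /\ B 1%N y = 0 <-> exists i, y = yc i,
      forall i, (1 <= Nc i)%N,
      forall i k, (1 <= k <= Nc i)%N -> B k (yc i) = 0 &
      forall i, B (Nc i).+1 (yc i) != 0].

(* gy is the y-derivative of g. In the periodic setting the condition is
   already part of smoothness on T x T. *)
Definition boundary_condition c (g gy : R -> R -> R) : Prop :=
  match c with
  | Periodic => True
  | Dirichlet => forall x, g x 0 = 0 /\ g x 1 = 0
  | Neumann => forall x, gy x 0 = 0 /\ gy x 1 = 0
  end.

Definition Omega_cell : set (R * R) := `[0, 1] `*` `[0, 1].

(* The norm of L^2(Omega), for either choice of D: Omega and the unit square
   differ by a null set. *)
Definition L2norm (g : R -> R -> R) : \bar R :=
  Lnorm (lebesgue_measure \x lebesgue_measure)%E 2%:E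
    (EFin \o ((fun p : R * R => g p.1 p.2) \_ Omega_cell)).

Definition initial_datum c (fin : R -> R -> R) : Prop :=
  exists2 G, smooth_xy (bcond_domain c) fin G &
    boundary_condition c fin (G 0%N 1%N).

Definition x_mean_zero c (fin : R -> R -> R) : Prop :=
  forall y, closedD (bcond_domain c) y ->
    (\int[lebesgue_measure]_(x in `[0%R, 1%R]) (fin x y)%:E = 0)%E.

Definition solution c (b : R -> R) nu (fin : R -> R -> R)
    (f : R -> R -> R -> R) : Prop :=
  [/\ forall x y, closedD (bcond_domain c) y -> f 0 x y = fin x y,
      forall s : R, 0 <= s ->
        L2norm (fun x y => f t x y - f s x y)
          @[t --> within [set t : R | 0 <= t] (nbhs s)] --> 0%E &
      exists F, [/\ smooth_txy (bcond_domain c) f F,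
        forall t : R, 0 < t ->
          boundary_condition c (f t) (F 0%N 0%N 1%N t) &
        forall (t x y : R), 0 < t -> openD (bcond_domain c) y ->
          F 1%N 0%N 0%N t x y + b y * F 0%N 1%N 0%N t x y
            - nu * F 0%N 0%N 2%N t x y = 0]].

End definitions.

(* Main.v *)
Require Import Defs.
From HB Require Import structures.
From mathcomp Require Import all_boot all_order all_algebra.
From mathcomp Require Import all_classical all_reals all_analysis.
From mathcomp Require Import ring lra.

Set Implicit Arguments.
Unset Strict Implicit.
Unset Printing Implicit Defensive.

Import Order.TTheory GRing.Theory Num.Theory.
Import numFieldNormedType.Exports.

Local Open Scope classical_set_scope.
Local Open Scope ring_scope.

(** Put n = N+1, r = nu^(1/(n+2)) and rho = r^n, so that nu = rho r^2 and rho is the claimed rate.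
    On 0 < y < 1 - n r consider the twisted correlations
      J = sum_(1 <= s <= n) int_w (w - 1/2) int_x int_y ka_s(y) f(x,y) f(x+w, y+s r).
    Integrating in w turns the transport part of J' into ka_s(y) (b(y) - b(y+s r)) f(x,y) f(x,y+s r),
    because int_w (w - 1/2) (d_x f)(x+w) = f(x) when f has zero mean in x. The finite order of the
    critical points gives sum_(1 <= j <= n) (r^j b^(j))^2 >= c rho^2, so Taylor's formula and the inverse
    of a Vandermonde matrix yield weights with |ka_s| <= C/rho, |ka_s'| <= C/(rho r) and
    sum_s ka_s(y) (b(y) - b(y+s r)) of one sign, bounded below away from the boundary, where ka_s
    vanishes. (In the code the ka_s carry an extra factor rho.) With f(x,y+s r) replaced by f(x,y)
    at the price of r |d_y f|, this makes J' dominate |f|^2 up to C nu/rho |d_y f|^2 and up to a boundary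
    layer of width comparable to r, which an affine contraction of [0,1] reduces to the interior.
    Together with the energy identity, the integral of rho |f|^2 over any later time interval is at
    most C |f(t_0)|^2, and monotonicity of the energy turns this into exponential decay.
    The boundary terms of the energy identity cancel for each of the three boundary conditions. *)

(** The length r balances two effects: over distances comparable to r some increment of b has size
    at least about r^n, even near the most degenerate critical point, and diffusion acts at that
    scale at the rate nu / r^2, the same number. Which derivative of b produces the increment, and
    with which sign, varies with y, so one fixed shift cannot suffice. The interpolation matrix
    recovers each r^j b^(j) from the n increments, and weighting these terms by themselves gives the
    positive quantity sum_j (r^j b^(j))^2.

    J contains no derivative of f and its weights vanish at both ends, so J' has no boundary terms
    under any of the three conditions; the price is the boundary layer. The kernel w - 1/2 inverts
    d_x on functions of zero x-mean, so all Fourier modes in x are treated at once.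

    The solution is smooth only for t > 0 and merely L^2-continuous at 0. The estimates therefore
    start at a small positive time, and even the vanishing of the x-means at positive times has to
    be derived from the datum by a limit. *)

Definition itg {R : realType} (a b : R) (u : R -> R) : R :=
  \int[lebesgue_measure]_(x in `[a, b]) u x.

(** * Continuity of expressions built from continuous functions *)

Lemma cts_cst (T U : topologicalType) (k : U) : continuous (fun _ : T => k).
Proof. by move=> p; exact: cvg_cst. Qed.

Section continuity.
Context {R : realType} {T : topologicalType}.
Implicit Types u v : T -> R.

Lemma ctsD u v : continuous u -> continuous v -> continuous (fun p => u p + v p).
Proof. by move=> cu cv p; apply: cvgD; [exact: cu | exact: cv]. Qed.

Lemma ctsN u : continuous u -> continuous (fun p => - u p).
Proof. by move=> cu p; apply: cvgN; exact: cu. Qed.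

Lemma ctsM u v : continuous u -> continuous v -> continuous (fun p => u p * v p).
Proof. by move=> cu cv p; apply: cvgM; [exact: cu | exact: cv]. Qed.

Lemma ctsX u n : continuous u -> continuous (fun p => u p ^+ n).
Proof.
move=> cu; elim: n => [|n IH]; first by move=> p; exact: cvg_cst.
under eq_fun do rewrite exprS.
exact: ctsM.
Qed.

Lemma ctsV u : (forall p, u p != 0) -> continuous u ->
  continuous (fun p => (u p)^-1).
Proof. by move=> u0 cu p; apply: cvgV => //; exact: cu. Qed.

Lemma cts_sum (I : Type) (s : seq I) (P : pred I) (u : I -> T -> R) :
  (forall i, continuous (u i)) -> continuous (fun p => \sum_(i <- s | P i) u i p).
Proof.
move=> cu; elim: s => [|i s IH].
  by under eq_fun do rewrite big_nil; exact: cts_cst.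
under eq_fun do rewrite big_cons.
by case: (P i) => //; apply: ctsD.
Qed.

Lemma cts_max u v : continuous u -> continuous v ->
  continuous (fun p => Num.max (u p) (v p)).
Proof. by move=> cu cv p; apply: continuous_max; [exact: cu|exact: cv]. Qed.

Lemma cts_min u v : continuous u -> continuous v ->
  continuous (fun p => Num.min (u p) (v p)).
Proof. by move=> cu cv p; apply: continuous_min; [exact: cu|exact: cv]. Qed.

End continuity.

Section continuity_comp.
Context {R : realType}.

Lemma cts_comp1 (T : topologicalType) (u : R -> R) (e : T -> R) :
  continuous u -> continuous e -> continuous (fun p => u (e p)).
Proof. by move=> cu ce p; apply: (cvg_comp e u); [exact: ce | exact: cu]. Qed.

Lemma cts_pair (T U V : topologicalType) (e1 : T -> U) (e2 : T -> V) :
  continuous e1 -> continuous e2 -> continuous (fun p => (e1 p, e2 p)).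
Proof. by move=> c1 c2 p; apply: cvg_pair; [exact: c1|exact: c2]. Qed.

Lemma cts_comp2 (T U V : topologicalType) (u : U -> V -> R) (e1 : T -> U) (e2 : T -> V) :
  continuous (fun p : U * V => u p.1 p.2) -> continuous e1 -> continuous e2 ->
  continuous (fun p => u (e1 p) (e2 p)).
Proof.
move=> cu c1 c2 p.
apply: (cvg_comp (fun p => (e1 p, e2 p)) (fun p : U * V => u p.1 p.2)).
  exact: (cts_pair c1 c2).
exact: (cu (e1 p, e2 p)).
Qed.

Lemma cts_comp3 (T : topologicalType) (u : R -> R -> R -> R) (e1 e2 e3 : T -> R) :
  continuous (fun p : R * R * R => u p.1.1 p.1.2 p.2) ->
  continuous e1 -> continuous e2 -> continuous e3 ->
  continuous (fun p => u (e1 p) (e2 p) (e3 p)).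
Proof.
move=> cu c1 c2 c3 p.
apply: (cvg_comp (fun p => ((e1 p, e2 p), e3 p)) (fun p : R * R * R => u p.1.1 p.1.2 p.2)).
  exact: (cts_pair (cts_pair c1 c2) c3).
exact: (cu (e1 p, e2 p, e3 p)).
Qed.

Lemma cts_id (T : topologicalType) : continuous (fun p : T => p).
Proof. by move=> p; exact: cvg_id. Qed.

Lemma cts_fst (T U V : topologicalType) (e : T -> U * V) :
  continuous e -> continuous (fun p => (e p).1).
Proof. by move=> ce p; apply: (cvg_comp e fst); [exact: ce | exact: cvg_fst]. Qed.

Lemma cts_snd (T U V : topologicalType) (e : T -> U * V) :
  continuous e -> continuous (fun p => (e p).2).
Proof. by move=> ce p; apply: (cvg_comp e snd); [exact: ce | exact: cvg_snd]. Qed.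

End continuity_comp.

(** * Integrals of continuous functions over intervals and rectangles *)

Section integral.
Context {R : realType}.
Implicit Types (a b c d k : R) (u v : R -> R).

Lemma cts_integrable a b u : continuous u ->
  lebesgue_measure.-integrable `[a, b] (EFin \o u).
Proof.
move=> cu; apply: continuous_compact_integrable; first exact: segment_compact.
exact: continuous_subspaceT.
Qed.

Lemma itgD a b u v : continuous u -> continuous v ->
  itg a b (fun x => u x + v x) = itg a b u + itg a b v.
Proof. by move=> cu cv; apply: RintegralD => //; apply: cts_integrable. Qed.

Lemma itgB a b u v : continuous u -> continuous v ->
  itg a b (fun x => u x - v x) = itg a b u - itg a b v.
Proof. by move=> cu cv; apply: RintegralB => //; apply: cts_integrable. Qed.

Lemma itgZ a b k u : continuous u -> itg a b (fun x => k * u x) = k * itg a b u.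
Proof. by move=> cu; apply: RintegralZl => //; apply: cts_integrable. Qed.

Lemma itgZr a b k u : continuous u -> itg a b (fun x => u x * k) = itg a b u * k.
Proof. by move=> cu; apply: RintegralZr => //; apply: cts_integrable. Qed.

Lemma itgN a b u : continuous u -> itg a b (fun x => - u x) = - itg a b u.
Proof.
move=> cu; rewrite -mulN1r -itgZ//; congr (itg a b _).
by apply/funext => x; rewrite mulN1r.
Qed.

Lemma itg_cst a b k : a <= b -> itg a b (fun _ => k) = k * (b - a).
Proof.
move=> ab; rewrite /itg Rintegral_cst//= lebesgue_measure_itv/= lte_fin.
case: ltP => // ba; have -> : a = b by apply/eqP; rewrite eq_le ab.
by rewrite subrr.
Qed.

Lemma itg_sum (I : Type) (s : seq I) a b (u : I -> R -> R) :
  (forall i, continuous (u i)) ->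
  itg a b (fun x => \sum_(i <- s) u i x) = \sum_(i <- s) itg a b (u i).
Proof.
move=> cu; elim: s => [|i s IH].
  rewrite big_nil -[RHS](mul0r (itg a b (fun=> 0))) -itgZ; last exact: cts_cst.
  by congr itg; apply/funext => x; rewrite big_nil mul0r.
rewrite big_cons -IH -itgD//; last exact: cts_sum.
by congr itg; apply/funext => x; rewrite big_cons.
Qed.

Lemma itg_oo a b u : continuous u ->
  itg a b u = \int[lebesgue_measure]_(x in `]a, b[) u x.
Proof.
move=> cu; rewrite /itg -Rintegral_itv_bndo_bndc; last first.
  by apply: integrableS (cts_integrable a b cu) => //; exact: subset_itv_co_cc.
rewrite -Rintegral_itv_obnd_cbnd//.
by apply: integrableS (cts_integrable a b cu) => //; exact: subset_itv_oo_cc.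
Qed.

Lemma itg_le a b u v : continuous u -> continuous v ->
  (forall x, a < x < b -> u x <= v x) -> itg a b u <= itg a b v.
Proof.
move=> cu cv uv; rewrite !itg_oo//; apply: le_Rintegral => //.
- by apply: integrableS (cts_integrable a b cu) => //; exact: subset_itv_oo_cc.
- by apply: integrableS (cts_integrable a b cv) => //; exact: subset_itv_oo_cc.
Qed.

Lemma itg_eq a b u v : continuous u -> continuous v ->
  (forall x, a < x < b -> u x = v x) -> itg a b u = itg a b v.
Proof.
move=> cu cv uv; apply/eqP; rewrite eq_le !itg_le// => x xab;
  by rewrite uv.
Qed.

Lemma itg_ge0 a b u : continuous u -> (forall x, a < x < b -> 0 <= u x) ->
  0 <= itg a b u.
Proof.
move=> cu u0; rewrite itg_oo//; apply: Rintegral_ge0 => x /=.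
by rewrite in_itv/=; exact: u0.
Qed.

Lemma itg_FTC a b (F u : R -> R) : a <= b -> continuous F -> continuous u ->
  (forall x, a < x < b -> is_derive x (1 : R) F (u x)) -> itg a b u = F b - F a.
Proof.
rewrite le_eqVlt => /predU1P[<- _ _ _|ab cF cu dF].
  by rewrite subrr /itg set_itv1 Rintegral_set1.
rewrite /itg /Rintegral (@continuous_FTC2 R u F)//.
- exact: continuous_subspaceT.
- split.
  + by move=> x; rewrite in_itv/= => /dF; case.
  + exact/cvg_at_right_filter/cF.
  + exact/cvg_at_left_filter/cF.
- by move=> x; rewrite in_itv/= => /dF xF; rewrite derive1E derive_val.
Qed.

Lemma itg_norm a b u : a <= b -> continuous u ->
  forall k, (forall x, a < x < b -> `|u x| <= k) -> `|itg a b u| <= k * (b - a).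
Proof.
move=> ab cu k uk; rewrite ler_norml -mulNr -!(itg_cst _ ab).
by rewrite !itg_le//; try exact: cts_cst; move=> x /uk; rewrite ler_norml => /andP[].
Qed.

(** By compactness of [a, b], [u q] is uniformly close to [u p] on the interval for q near p; the
    covering form of compactness works for an arbitrary parameter space. *)
Lemma itg_cts (T : topologicalType) a b (u : T -> R -> R) : a <= b ->
  continuous (fun p : T * R => u p.1 p.2) -> continuous (fun p => itg a b (u p)).
Proof.
move=> ab cu p; have cup q : continuous (u q).
  apply: (cts_comp2 cu); last exact: cts_id.
  by move=> x; exact: cvg_cst.
apply/cvgrPdist_le => e e0.
(* The summand 1 keeps the denominator positive when a = b. *)
pose d := e / (b - a + 1).
have d0 : 0 < d by rewrite divr_gt0// ltr_wpDl// subr_ge0.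
have /compact_near_coveringP : compact `[a, b] := @segment_compact R a b.
move=> /(_ T (nbhs p) (fun q x => `|u p x - u q x| <= d) _).
have H x : `[a, b]%classic x ->
    \forall x' \near x & i \near p, `|u p x' - u i x'| <= d.
  move=> _.
  have : continuous (fun z : R * T => u p z.1 - u z.2 z.1).
    apply: ctsD; first exact: (cts_comp1 (cup p) (cts_fst (@cts_id _))).
    apply: ctsN; exact: (cts_comp2 cu (cts_snd (@cts_id _)) (cts_fst (@cts_id _))).
  move=> /(_ (x, p)) cx.
  move: cx; rewrite /continuous_at/= subrr => /cvgr0Pnorm_le/(_ d d0); exact.
move=> /(_ H); apply: filterS => q Hq.
rewrite -itgB//; apply: (@le_trans _ _ (d * (b - a))).
  apply: itg_norm => //; first exact: (ctsD (cup p) (ctsN (cup q))).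
  by move=> x /andP[ax xb]; apply: Hq; rewrite /= in_itv/= (ltW ax) (ltW xb).
rewrite /d mulrAC ler_pdivrMr ?ltr_wpDl ?subr_ge0//.
by rewrite ler_pM2l// lerDl.
Qed.

(** The plane carries the product sigma-algebra, so an open preimage has to be written as a
    countable union of rectangles: squares with rational centre and radius 1 / (n + 1). *)
Lemma continuous2_measurable (u : R * R -> R) : continuous u ->
  measurable_fun setT u.
Proof.
move=> cu; apply: (measurability _ (measurable_realfun.RGenOpens.measurableE R)).
move=> _ [_ [a [b ->] <-]]; rewrite setTI.
have oU : open (u @^-1` `]a, b[).
  by apply: open_comp; [move=> ? _; exact: cu|exact: interval_open].
set U := _ @^-1` _ in oU *.
pose box (q : rat * rat * nat) : set (R * R) :=
  ball (ratr q.1.1 : R) q.2.+1%:R^-1 `*` ball (ratr q.1.2 : R) q.2.+1%:R^-1.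
(* Squares not contained in U become empty, so that the union runs over a whole countable type. *)
pose F q := if `[< box q `<=` U >] then box q else set0.
rewrite (_ : U = \bigcup_q F q); last first.
  apply/seteqP; split => [p Up|p [q _]]; last first.
    by rewrite /F; case: ifPn => [/asboolP + |//]; exact.
  have /nbhs_ballP[e /= e0 eU] : nbhs p U by exact: open_nbhs_nbhs.
  (* A square of radius below e / 2 that contains p lies in the e-ball around p. *)
  have [n ne] : exists n, n.+1%:R^-1 < e / 2.
    have [n _ Hn] := near_infty_natSinv_lt (PosNum (divr_gt0 e0 (ltr0Sn R 1))).
    by exists n; exact: (Hn n (leqnn n)).
  have n0 : 0 < n.+1%:R^-1 :> R by rewrite invr_gt0.
  have rb (x : R) : exists r : rat, `|ratr r - x| < n.+1%:R^-1.
    have /rat_in_itvoo[r] : x - n.+1%:R^-1 < x + n.+1%:R^-1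
      by rewrite ltrBlDr -addrA ltrDl addr_gt0.
    by rewrite in_itv/= => xr; exists r; rewrite ltr_distl.
  have [r1 r1p] := rb p.1; have [r2 r2p] := rb p.2.
  exists (r1, r2, n) => //; rewrite /F; case: ifPn => [_|/asboolP H].
    by split; rewrite /ball/=.
  exfalso; apply: H => -[x y] [/= bx bY]; apply: eU; split => /=.
    rewrite /ball/= in bx *.
    rewrite (_ : p.1 - x = - (ratr r1 - p.1) + (ratr r1 - x)); last by ring.
    by rewrite (le_lt_trans (ler_normD _ _))// normrN (splitr e) ltrD// (lt_trans _ ne).
  rewrite /ball/= in bY *.
  rewrite (_ : p.2 - y = - (ratr r2 - p.2) + (ratr r2 - y)); last by ring.
  by rewrite (le_lt_trans (ler_normD _ _))// normrN (splitr e) ltrD// (lt_trans _ ne).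
apply: countable_bigcupT_measurable; first exact: countableP.
move=> q; rewrite /F; case: ifP => _; last exact: measurable0.
by apply: measurableX; rewrite ball_itv; exact: measurable_itv.
Qed.

Lemma rectangle_integrable a b c d (u : R * R -> R) : continuous u ->
  (lebesgue_measure \x lebesgue_measure)%E.-integrable (`[a, b] `*` `[c, d])
    (EFin \o u).
Proof.
move=> cu; apply: measurable_bounded_integrable.
- by apply: measurableX.
- rewrite [X in (X < _)%E](_ : _ =
    (lebesgue_measure (`[a, b]%classic : set R) * lebesgue_measure (`[c, d]%classic : set R))%E);
    last exact: product_measure1E.
  rewrite !lebesgue_measure_itv/=.
  by do 2 case: ifP => _; rewrite -?EFinD -?EFinM ?mul0e ?mule0 ?ltry.
- by apply: measurable_funTS; apply: continuous2_measurable.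
have K : compact (`[a, b] `*` `[c, d] : set (R * R)).
  by apply: compact_setX; exact: segment_compact.
have := @compact_bounded R R (u @` (`[a, b] `*` `[c, d])) _.
case.
  apply: continuous_compact => //; exact: continuous_subspaceT.
move=> M [Mr HM]; exists M; split => // x /HM H y /= Hy; apply: H => /=.
by exists y.
Qed.

(** Fubini is applied to u extended by zero outside the rectangle; [E1] and [E2] identify its
    partial integrals with the extensions of the inner integrals. *)
Lemma itg_swap a b c d (u : R -> R -> R) : a <= b -> c <= d ->
  continuous (fun p : R * R => u p.1 p.2) ->
  itg a b (fun x => itg c d (u x)) = itg c d (fun y => itg a b (u^~ y)).
Proof.
move=> ab cd cu.
have := rectangle_integrable a b c d cu.
rewrite integrable_mkcond; last by apply: measurableX.
move=> /Fubini/=.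
have E1 x : (\int[lebesgue_measure]_y
   ((EFin \o (fun p : R * R => u p.1 p.2)) \_ (`[a, b] `*` `[c, d])) (x, y))%E =
   ((EFin \o (fun x => itg c d (u x))) \_ `[a, b]) x.
  rewrite patchE; case: ifPn => xab; last first.
    rewrite integral0_eq// => y _; rewrite patchE ifF//.
    by apply/negbTE; apply: contra xab; rewrite !inE/= => -[].
  rewrite /= /itg /Rintegral fineK; last first.
    by apply: integrable_fin_num => //; apply: cts_integrable; exact: (cts_comp2 cu (@cts_cst R R x) (@cts_id _)).
  rewrite [RHS]integral_mkcond; apply: eq_integral => y _.
  rewrite !patchE; congr (if _ then _ else _).
  by apply/idP/idP; rewrite !inE/=; [case|move=> ?; split => //; move: xab; rewrite inE].
have E2 y : (\int[lebesgue_measure]_x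
   ((EFin \o (fun p : R * R => u p.1 p.2)) \_ (`[a, b] `*` `[c, d])) (x, y))%E =
   ((EFin \o (fun y => itg a b (u^~ y))) \_ `[c, d]) y.
  rewrite patchE; case: ifPn => yab; last first.
    rewrite integral0_eq// => x _; rewrite patchE ifF//.
    by apply/negbTE; apply: contra yab; rewrite !inE/= => -[].
  rewrite /= /itg /Rintegral fineK; last first.
    by apply: integrable_fin_num => //; apply: cts_integrable; exact: (cts_comp2 cu (@cts_id _) (@cts_cst R R y)).
  rewrite [RHS]integral_mkcond; apply: eq_integral => x _.
  rewrite !patchE; congr (if _ then _ else _).
  by apply/idP/idP; rewrite !inE/=; [case|move=> ?; split => //; move: yab; rewrite inE].
move=> H; congr fine.
transitivity (\int[lebesgue_measure]_x ((EFin \o (fun x => itg c d (u x))) \_ `[a, b]) x)%E.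
  by rewrite -integral_mkcond.
transitivity (\int[lebesgue_measure]_y ((EFin \o (fun y => itg a b (u^~ y))) \_ `[c, d]) y)%E;
  last by rewrite -integral_mkcond.
transitivity (\int[lebesgue_measure]_x \int[lebesgue_measure]_y
   ((EFin \o (fun p : R * R => u p.1 p.2)) \_ (`[a, b] `*` `[c, d])) (x, y))%E.
  by apply: eq_integral => x _; rewrite E1.
by rewrite H; apply: eq_integral => y _; rewrite E2.
Qed.

End integral.

(** The branches follow the syntax of the function; the last one uses a continuity hypothesis, in
    one to three variables, composed with the arguments found in the goal. *)
Ltac cts_step :=
  cbv beta;
  lazymatch goal with
  | |- continuous (fun p => p) => exact: cts_id
  | |- continuous fst => exact: (cts_fst (@cts_id _))
  | |- continuous snd => exact: (cts_snd (@cts_id _))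
  | |- continuous id => exact: cts_id
  | |- continuous (fun _ => ?k) => exact: cts_cst
  | |- continuous (+%R ?k) => refine (@ctsD _ _ (fun _ => k) (fun p => p) _ _)
  | |- continuous ( *%R ?k) => refine (@ctsM _ _ (fun _ => k) (fun p => p) _ _)
  | |- continuous (fun p => @?u p + @?v p) => apply: (@ctsD _ _ u v)
  | |- continuous (fun p => - @?u p) => apply: (@ctsN _ _ u)
  | |- continuous (fun p => @?u p * @?v p) => apply: (@ctsM _ _ u v)
  | |- continuous (fun p => @?u p ^+ ?n) => apply: (@ctsX _ _ u n)
  | |- continuous (fun p => Num.max (@?u p) (@?v p)) => apply: (@cts_max _ _ u v)
  | |- continuous (fun p => Num.min (@?u p) (@?v p)) => apply: (@cts_min _ _ u v)
  | |- continuous (fun p => fst (@?e p)) => apply: cts_fst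
  | |- continuous (fun p => snd (@?e p)) => apply: cts_snd
  | |- continuous (fun p => itg ?a ?b (@?u p)) =>
      apply: (@itg_cts _ _ a b u); [first [assumption | exact: ler01 | by lra] | ]
  | |- continuous (fun p => bigop _ _ _) => apply: cts_sum => ?
  | |- continuous ?f =>
    match goal with
    | H : continuous f |- _ => exact: H
    | H : continuous (fun p => ?h p.1.1 p.1.2 p.2) |- continuous (fun p => ?h _ _ _) =>
       apply: (@cts_comp3 _ _ h _ _ _ H)
    | H : continuous (fun p => ?h p.1 p.2) |- continuous (fun p => ?h _ _) =>
       apply: (@cts_comp2 _ _ _ _ h _ _ H)
    | H : continuous (fun p => ?h p.1.1 p.1.2 p.2) |- continuous (?h ?t ?x) =>
       refine (@cts_comp3 _ _ h (fun _ => t) (fun _ => x) (fun p => p) H _ _ _)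
    | H : continuous (fun p => ?h p.1 p.2) |- continuous (?h ?x) =>
       refine (@cts_comp2 _ _ _ _ h (fun _ => x) (fun p => p) H _ _)
    | H : continuous ?h |- continuous (fun p => ?h _) => apply: (@cts_comp1 _ _ h _ H)
    | H : forall i, continuous (@?h i) |- _ => apply: (@cts_comp1 _ _ (h _) _ (H _))
    end
  end.
Ltac cts := repeat cts_step.

(** * Rules for derivatives in one variable *)

Section derivatives.
Context {R : realType}.
Implicit Types (u v e : R -> R) (x a b k : R).

Lemma isd_eq x u a b : is_derive x (1 : R) u a -> a = b -> is_derive x (1 : R) u b.
Proof. by move=> ? <-. Qed.

Lemma isdD x u v a b : is_derive x (1 : R) u a -> is_derive x (1 : R) v b ->
  is_derive x (1 : R) (fun z => u z + v z) (a + b).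
Proof. by move=> du dv; exact: is_deriveD. Qed.

Lemma isdM x u v a b : is_derive x (1 : R) u a -> is_derive x (1 : R) v b ->
  is_derive x (1 : R) (fun z => u z * v z) (a * v x + u x * b).
Proof.
by move=> du dv; apply: isd_eq; rewrite -/(u * v) addrC mulrC.
Qed.

Lemma isdN x u a : is_derive x (1 : R) u a -> is_derive x (1 : R) (fun z => - u z) (- a).
Proof. by move=> du; exact: is_deriveN. Qed.

Lemma isd_cst x k : is_derive x (1 : R) (fun _ => k) 0.
Proof. exact: is_derive_cst. Qed.

Lemma isd_id x : is_derive x (1 : R) (fun z => z) 1.
Proof. exact: is_derive_id. Qed.

Lemma isdZ x k u a : is_derive x (1 : R) u a ->
  is_derive x (1 : R) (fun z => k * u z) (k * a).
Proof. by move=> du; apply: isd_eq (isdM (isd_cst x k) du) _; rewrite mul0r add0r. Qed.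

Lemma isd_comp x u e a k : is_derive (e x) (1 : R) u a -> is_derive x (1 : R) e k ->
  is_derive x (1 : R) (fun z => u (e z)) (a * k).
Proof. by move=> du de; exact: (is_derive1_comp du de). Qed.

Lemma isdX x u a n : is_derive x (1 : R) u a ->
  is_derive x (1 : R) (fun z => u z ^+ n.+1) (n.+1%:R * u x ^+ n * a).
Proof.
move=> du; elim: n => [|n IH].
  by under eq_fun do rewrite expr1; apply: isd_eq du _; rewrite expr0 !mul1r.
under eq_fun do rewrite exprS.
by apply: isd_eq (isdM du IH) _; rewrite -[n.+2]addn1 natrD exprS; ring.
Qed.

Lemma isdV x u a : u x != 0 -> is_derive x (1 : R) u a ->
  is_derive x (1 : R) (fun z => (u z)^-1) (- (u x) ^- 2 * a).
Proof. by move=> u0 du; apply: isd_eq (is_deriveV u0 du) _. Qed.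

Lemma isd_sum (I : Type) (s : seq I) x (u : I -> R -> R) (a : I -> R) :
  (forall i, is_derive x (1 : R) (u i) (a i)) ->
  is_derive x (1 : R) (fun z => \sum_(i <- s) u i z) (\sum_(i <- s) a i).
Proof.
move=> du; elim: s => [|i s IH].
  by under eq_fun do rewrite big_nil; rewrite big_nil; exact: isd_cst.
by under eq_fun do rewrite big_cons; rewrite big_cons; exact: isdD.
Qed.

Lemma isd_shift x w u a : is_derive (x + w) (1 : R) u a ->
  is_derive x (1 : R) (fun z => u (z + w)) a.
Proof.
move=> du; apply: isd_eq (@isd_comp x u (fun z => z + w) a _ du (isdD (isd_id x) (isd_cst x w))) _.
by rewrite addr0 mulr1.
Qed.

Lemma isd_near x u v a : (\forall z \near x, u z = v z) ->
  is_derive x (1 : R) u a -> is_derive x (1 : R) v a.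
Proof. by move=> uv; apply: near_eq_is_derive; apply: filterS uv => z ->. Qed.

Lemma isd_oo_near x u v a c d : c < x < d -> (forall z, c < z < d -> u z = v z) ->
  is_derive x (1 : R) u a -> is_derive x (1 : R) v a.
Proof.
move=> cxd uv; apply: isd_near.
have : \forall z \near x, z \in `]c, d[ by exact: near_in_itvoo.
by apply: filterS => z; rewrite in_itv/=; exact: uv.
Qed.

Lemma isd_unique x u a b : is_derive x (1 : R) u a -> is_derive x (1 : R) u b -> a = b.
Proof. by move=> [_ <-] [_ <-]. Qed.

End derivatives.

(** * Substitution, periodicity and positivity of integrals *)

Section integral_theory.
Context {R : realType}.
Implicit Types (a b c d k : R) (u v : R -> R).

(** In contrast to [itg_FTC], differentiability at the end points replaces global continuity of F.
    This suits primitives, which are controlled only on a bounded interval. *)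
Lemma itg_FTC_at a b (F u : R -> R) : a <= b -> continuous u ->
  (forall x, a <= x <= b -> is_derive x (1 : R) F (u x)) -> itg a b u = F b - F a.
Proof.
rewrite le_eqVlt => /predU1P[<- _ _|ab cu dF].
  by rewrite subrr /itg set_itv1 Rintegral_set1.
have cF x : a <= x <= b -> {for x, continuous F}.
  by move=> /dF[dFx _]; exact/differentiable_continuous/derivable1_diffP.
rewrite /itg /Rintegral (@continuous_FTC2 R u F)//.
- exact: continuous_subspaceT.
- split.
  + by move=> x; rewrite in_itv/= => /andP[ax xb]; case: (dF x _) => //; rewrite !ltW.
  + by apply/cvg_at_right_filter/cF; rewrite lexx ltW.
  + by apply/cvg_at_left_filter/cF; rewrite lexx ltW.
- move=> x; rewrite in_itv/= => /andP[ax xb].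
  have [|_ <-] := dF x _; first by rewrite !ltW.
  by rewrite derive1E.
Qed.

Lemma primitive c d u : continuous u ->
  exists F : R -> R, forall x, c < x < d -> is_derive x (1 : R) F (u x).
Proof.
move=> cu; exists (fun x => itg c x u) => x /andP[cx xd].
have := @continuous_FTC1_closed R u c x d xd (cts_integrable c d cu).
by move=> /(_ cx (cu x))[dF <-]; rewrite derive1E; exact: derivableP.
Qed.

Lemma itg_affine a b c k v : a <= b -> 0 < k -> continuous v ->
  itg a b (fun y => v (c + k * y)) * k = itg (c + k * a) (c + k * b) v.
Proof.
move=> ab k0 cv.
(* The margin of 1 on either side makes F differentiable at the end points as well. *)
have [F dF] := primitive (c + k * a - 1) (c + k * b + 1) cv.
have mono x y : x <= y -> c + k * x <= c + k * y by rewrite lerD2l ler_pM2l.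
have -> : itg (c + k * a) (c + k * b) v = F (c + k * b) - F (c + k * a).
  apply: itg_FTC_at => //; first exact: mono.
  by move=> x /andP[ax xb]; apply: dF; rewrite (lt_le_trans _ ax) ?(le_lt_trans xb) ?ltrDl//; lra.
rewrite -itgZr; last by cts.
apply: (@itg_FTC_at _ _ (fun y => F (c + k * y))) => //; first by cts.
move=> x /andP[/mono ax /mono xb]; apply: isd_comp.
  by apply: dF; rewrite (lt_le_trans _ ax) ?(le_lt_trans xb) ?ltrDl//; lra.
by apply: isd_eq (isdD (isd_cst _ c) (isdZ k (isd_id x))) _; rewrite add0r mulr1.
Qed.

Lemma itg_split a b c u : a <= b -> b <= c -> continuous u ->
  itg a c u = itg a b u + itg b c u.
Proof.
move=> ab bc cu; have [F dF] := primitive (a - 1) (c + 1) cu.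
have H s t : a <= s -> s <= t -> t <= c -> itg s t u = F t - F s.
  by move=> as_ st tc; apply: itg_FTC_at => // x /andP[? ?]; apply: dF; lra.
by rewrite (H a b (lexx a) ab bc) (H b c ab bc (lexx c)) (H a c (lexx a) (le_trans ab bc) (lexx c)); ring.
Qed.

Lemma itg_sub a b c d u : a <= c -> c <= d -> d <= b -> continuous u ->
  (forall x, a < x < b -> 0 <= u x) -> itg c d u <= itg a b u.
Proof.
move=> ac cd db cu u0.
rewrite (@itg_split a c b)// ?(le_trans cd)// (@itg_split c d b)// addrCA lerDl.
by rewrite addr_ge0// itg_ge0// => x /andP[? ?]; apply: u0; lra.
Qed.

Lemma itg_shift_periodic u w : continuous u -> (forall x, u (x + 1) = u x) ->
  itg 0 1 (fun x => u (x + w)) = itg 0 1 u.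
Proof.
move=> cu pu.
pose F w := itg 0 1 (fun x => u (x + w)).
have HF (s : R) : F s = itg s (s + 1) u.
  have := @itg_affine 0 1 s 1 u ler01 ltr01 cu.
  rewrite mulr1 mulr0 addr0 mulr1 => <-.
  by congr itg; apply/funext => x; rewrite mul1r addrC.
(* The windows [s, s+1] and [t, t+1] share [t, s+1]; the remaining pieces [s, t] and [s+1, t+1]
   differ by a period. *)
have per1 s t : s <= t -> t <= s + 1 -> F s = F t.
  move=> st ts; rewrite !HF (@itg_split s t)// (@itg_split t (s + 1) (t + 1))// ?lerD2r//.
  rewrite addrC; congr (_ + _).
  have := @itg_affine s t 1 1 u st ltr01 cu.
  rewrite !mul1r mulr1 addrC (addrC 1 t) => <-.
  by congr itg; apply/funext => x; rewrite mul1r addrC pu.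
have perZ s : F (s + 1) = F s by rewrite -(per1 s (s + 1)) ?lerDl.
have pern s n : F (s + n%:R) = F s.
  elim: n => [|n IH]; first by rewrite addr0.
  by rewrite -natr1 addrA perZ.
have F0 : F 0 = itg 0 1 u.
  by rewrite /F; congr itg; apply/funext => x; rewrite addr0.
rewrite -/(F w) -F0.
have pos s : 0 <= s -> F s = F 0.
  move=> s0; have /andP[l1 l2] := truncn_itv s0.
  have -> : F s = F (s - (Num.truncn s)%:R + (Num.truncn s)%:R) by rewrite subrK.
  rewrite pern; symmetry; apply: per1; first by rewrite subr_ge0.
  by move: l2; rewrite -natr1 add0r; lra.
have [w0|w0] := leP 0 w; first exact: pos.
have [n wn] : exists n : nat, - w <= n%:R.
  exists (Num.truncn (- w)).+1; have w0' : 0 <= - w by rewrite oppr_ge0 ltW.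
  by have /andP[_ /ltW] := truncn_itv w0'.
by rewrite -(pern w n) pos// -lerBlDl sub0r.
Qed.

(** Jensen's inequality, from the nonnegativity of the variance. *)
Lemma itg_sqr_le u : continuous u -> itg 0 1 u ^+ 2 <= itg 0 1 (fun x => u x ^+ 2).
Proof.
move=> cu; set m := itg 0 1 u.
have : 0 <= itg 0 1 (fun x => (u x - m) ^+ 2).
  by apply: itg_ge0; [cts|move=> x _; exact: sqr_ge0].
have -> : (fun x => (u x - m) ^+ 2) = (fun x => (u x ^+ 2 + (- (2 * m)) * u x) + m ^+ 2).
  by apply/funext => x; ring.
rewrite !itgD//; try by cts.
rewrite itgZ// itg_cst ?ler01// -/m; lra.
Qed.

Lemma itg_eq0 u a b : a <= b -> continuous u -> (forall x, a < x < b -> 0 <= u x) ->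
  itg a b u = 0 -> forall x, a < x < b -> u x = 0.
Proof.
move=> ab cu u0 I0 x xab; apply/eqP; rewrite eq_le u0// andbT leNgt; apply/negP => ux.
have := cu x; move=> /cvgrPdist_lt/(_ (u x / 2)); rewrite divr_gt0// => /(_ isT).
move=> /nbhs_ballP[e /= e0 He].
move: xab => /andP[ax xb].
(* On [x - h, x + h], which stays inside [a, b], u is at least u(x) / 2 by continuity, so its
   integral is positive. *)
pose h := Num.min (e / 2) (Num.min (x - a) (b - x)).
have h0 : 0 < h by rewrite !lt_min divr_gt0// !subr_gt0 ax.
have he : h < e by rewrite gt_min; apply/orP; left; rewrite ltr_pdivrMr// mulr_natr mulr2n ltrDl.
have ha : h <= x - a by rewrite !ge_min lexx orbT.
have hb : h <= b - x by rewrite !ge_min lexx !orbT.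
have : itg (x - h) (x + h) u <= itg a b u.
  by apply: itg_sub => //; lra.
rewrite I0 leNgt => /negP; apply.
apply: (@lt_le_trans _ _ (itg (x - h) (x + h) (fun _ => u x / 2))).
  by rewrite itg_cst; [rewrite mulr_gt0 ?divr_gt0//|]; lra.
apply: itg_le => //; first exact: cts_cst.
move=> y /andP[y1 y2].
have /He : ball x e y by rewrite /ball/= ltr_norml; lra.
by rewrite /= ltr_norml => /andP[]; lra.
Qed.

End integral_theory.

(** The representative h is continuous on the whole plane, so the product integral reduces to
    iterated integrals; g is controlled only on the closed unit square. *)
Lemma L2norm_cts {R : realType} (g : R -> R -> R) (h : R -> R -> R) :
  continuous (fun p : R * R => h p.1 p.2) ->
  (forall x y, 0 <= x <= 1 -> 0 <= y <= 1 -> g x y = h x y) ->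
  L2norm g = (Num.sqrt (itg 0 1 (fun x => itg 0 1 (fun y => h x y ^+ 2))))%:E.
Proof.
move=> ch gh; rewrite /L2norm unlock /Lnorm.
have -> : (\int[(lebesgue_measure \x lebesgue_measure)%E]_z
     (`|(EFin \o ((fun p : R * R => g p.1 p.2) \_ Omega_cell)) z| `^ 2) =
   (itg 0 1 (fun x => itg 0 1 (fun y => h x y ^+ 2)))%:E)%E.
  transitivity (\int[(lebesgue_measure \x lebesgue_measure)%E]_z
    ((EFin \o (fun p : R * R => (h p.1 p.2 ^+ 2)%R)) \_ (`[0%R, 1%R] `*` `[0%R, 1%R])) z)%E.
    apply: eq_integral => -[x y] _; rewrite /= !patchE /Omega_cell.
    case: ifPn => H; rewrite ?normr0 ?poweR_EFin ?powR0//.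
    move: H; rewrite inE/= !in_itv/= => -[hx hy]; rewrite gh//.
    by rewrite powR_mulrn ?normr_ge0// real_normK// num_real.
  have ch2 : continuous (fun p : R * R => h p.1 p.2 ^+ 2) by cts.
  have ch3 : continuous (fun x => itg 0 1 (fun y => h x y ^+ 2)) by cts.
  have chx (x : R) : continuous (fun y => h x y ^+ 2) by cts.
  have := rectangle_integrable 0 1 0 1 ch2.
  rewrite integrable_mkcond; last by apply: measurableX.
  move=> /integral12_prod_meas1 <-.
  rewrite [in RHS]/itg /Rintegral fineK; last first.
    apply: integrable_fin_num => //; apply: cts_integrable.
    exact: ch3.
  rewrite [RHS]integral_mkcond; apply: eq_integral => x _.
  rewrite patchE; case: ifPn => xab; last first.
    rewrite /fubini_F integral0_eq// => y _; rewrite patchE ifF//.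
    by apply/negbTE; apply: contra xab; rewrite !inE/= => -[].
  rewrite /fubini_F /= fineK; last first.
    by apply: integrable_fin_num => //; apply: cts_integrable; exact: chx.
  rewrite [RHS]integral_mkcond; apply: eq_integral => y _.
  rewrite !patchE; congr (if _ then _ else _).
  by apply/idP/idP; rewrite !inE/=; [case|move=> ?; split => //; move: xab; rewrite inE].
rewrite poweR_EFin -powR12_sqrt//.
apply: itg_ge0; first by cts.
by move=> x _; apply: itg_ge0; [cts | move=> y _; exact: sqr_ge0].
Qed.

(** Recorded before [itg] becomes opaque; it serves to read the zero-mean condition on the datum,
    which is an extended-real integral. *)
Lemma itg_fine {R : realType} (a b : R) (u : R -> R) :
  itg a b u = fine (\int[lebesgue_measure]_(x in `[a, b]) (u x)%:E).
Proof. by []. Qed.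

Global Opaque itg.

(** * Time evolution of shifted correlations *)

Lemma leibniz_rectangle {R : realType} (a c a1 c1 a2 c2 : R) (u v : R -> R -> R -> R) :
  a <= c -> a1 <= c1 -> a2 <= c2 ->
  continuous (fun p : R * R * R => u p.1.1 p.1.2 p.2) ->
  continuous (fun p : R * R * R => v p.1.1 p.1.2 p.2) ->
  (forall t x y : R, a < t < c -> a1 < x < c1 -> a2 < y < c2 ->
    is_derive t (1 : R) (fun t => u t x y) (v t x y)) ->
  itg a1 c1 (fun x => itg a2 c2 (fun y => u c x y)) -
  itg a1 c1 (fun x => itg a2 c2 (fun y => u a x y)) =
  itg a c (fun t => itg a1 c1 (fun x => itg a2 c2 (fun y => v t x y))).
Proof.
move=> ac ac1 ac2 cu cv duv.
(* The time integral is moved innermost, where the fundamental theorem applies for fixed x and y. *)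
rewrite (@itg_swap R a c a1 c1 (fun t x => itg a2 c2 (fun y => v t x y)))//; last by cts.
rewrite -itgB; [|by cts|by cts].
apply: itg_eq; [by cts|by cts|move=> x xac].
rewrite (@itg_swap R a c a2 c2 (fun t y => v t x y))//; last by cts.
rewrite -itgB; [|by cts|by cts].
apply: itg_eq; [by cts|by cts|move=> y yac].
symmetry; apply: (@itg_FTC _ _ _ (fun t => u t x y)); [by []|by cts|by cts|].
by move=> t tac; exact: duv.
Qed.

Section static_identity.
Context {R : realType}.
Variables (nu al be s w : R) (b ka dka : R -> R) (u ut ux uy uyy : R -> R -> R).
Hypotheses (albe : al <= be) (al0 : 0 <= al) (be1 : be <= 1).
Hypotheses (als0 : 0 <= al + s) (bes1 : be + s <= 1).
Hypotheses (cb : continuous b) (cka : continuous ka) (cdka : continuous dka).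
Hypothesis dka_ka : forall y : R, al < y < be -> is_derive y (1 : R) ka (dka y).
Hypotheses (cu : continuous (fun p : R * R => u p.1 p.2))
  (cut : continuous (fun p : R * R => ut p.1 p.2))
  (cux : continuous (fun p : R * R => ux p.1 p.2))
  (cuy : continuous (fun p : R * R => uy p.1 p.2))
  (cuyy : continuous (fun p : R * R => uyy p.1 p.2)).
Hypotheses
  (dux : forall x y : R, 0 < y < 1 -> is_derive x (1 : R) (fun x => u x y) (ux x y))
  (duy : forall x y : R, 0 < y < 1 -> is_derive y (1 : R) (u x) (uy x y))
  (duyy : forall x y : R, 0 < y < 1 -> is_derive y (1 : R) (uy x) (uyy x y))
  (perx : forall x y : R, 0 < y < 1 -> u (x + 1) y = u x y)
  (pde : forall x y : R, 0 < y < 1 -> ut x y + b y * ux x y - nu * uyy x y = 0).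

(** The equation eliminates [ut]. Let a prime mark the shifted point. The transport terms equal ka
    (b - b') u ux' minus Y, the x-derivative of ka b u u'; the diffusion terms are completed to Z,
    the y-derivative of ka (uy u' + u uy'). Y integrates to 0 by periodicity in x, Z by the boundary
    hypothesis. *)
Lemma transport_diffusion_pairing :
  (forall x, ka be * (uy x be * u (x + w) (be + s) + u x be * uy (x + w) (be + s)) =
    ka al * (uy x al * u (x + w) (al + s) + u x al * uy (x + w) (al + s))) ->
  itg 0 1 (fun x => itg al be (fun y => ka y *
    (ut x y * u (x + w) (y + s) + u x y * ut (x + w) (y + s)))) =
  itg 0 1 (fun x => itg al be (fun y =>
    ka y * (b y - b (y + s)) * (u x y * ux (x + w) (y + s)) -
    nu * (dka y * (uy x y * u (x + w) (y + s) + u x y * uy (x + w) (y + s)) +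
          2 * ka y * (uy x y * uy (x + w) (y + s))))).
Proof.
move=> bnd.
pose Z x y := dka y * (uy x y * u (x + w) (y + s) + u x y * uy (x + w) (y + s)) +
  ka y * (uyy x y * u (x + w) (y + s) + 2 * (uy x y * uy (x + w) (y + s)) +
          u x y * uyy (x + w) (y + s)).
pose Y x y := ka y * b y * (ux x y * u (x + w) (y + s) + u x y * ux (x + w) (y + s)).
pose V x y := ka y * (b y - b (y + s)) * (u x y * ux (x + w) (y + s)) -
    nu * (dka y * (uy x y * u (x + w) (y + s) + u x y * uy (x + w) (y + s)) +
          2 * ka y * (uy x y * uy (x + w) (y + s))).
have cZ : continuous (fun p : R * R => Z p.1 p.2) by rewrite /Z; cts.
have cY : continuous (fun p : R * R => Y p.1 p.2) by rewrite /Y; cts.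
have cV : continuous (fun p : R * R => V p.1 p.2) by rewrite /V; cts.
have in01 (y : R) : al < y < be -> (0 < y < 1) /\ (0 < y + s < 1).
  by clear - al0 be1 als0 bes1 => /andP[aly ybe]; rewrite (le_lt_trans al0 aly) (lt_le_trans ybe be1) (le_lt_trans als0) ?(lt_le_trans _ bes1) ?ltrD2r.
transitivity (itg 0 1 (fun x => itg al be (fun y => V x y + nu * Z x y - Y x y))).
  apply: itg_eq; [by cts|by cts|move=> x _].
  apply: itg_eq; [by cts|by cts|move=> y /in01[y01 ys01]].
  have E1 := pde x y01; have E2 := pde (x + w) ys01.
  have -> : ut x y = nu * uyy x y - b y * ux x y by lra.
  have -> : ut (x + w) (y + s) = nu * uyy (x + w) (y + s) - b (y + s) * ux (x + w) (y + s) by lra.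
  rewrite /V /Z /Y; ring.
have -> : itg 0 1 (fun x => itg al be (fun y => V x y + nu * Z x y - Y x y)) =
    itg 0 1 (fun x => itg al be (V x)) + nu * itg 0 1 (fun x => itg al be (Z x)) -
    itg 0 1 (fun x => itg al be (Y x)).
  rewrite -itgZ; last by cts.
  rewrite -itgD; [|by cts|by cts].
  rewrite -itgB; [|by cts|by cts].
  apply: itg_eq; [by cts|by cts|move=> x _].
  rewrite -itgZ; last by cts.
  rewrite -itgD; [|by cts|by cts].
  by rewrite -itgB; [|by cts|by cts].
have -> : itg 0 1 (fun x => itg al be (Z x)) = 0.
  rewrite -[RHS](mul0r (1 - 0)) -(itg_cst 0 (@ler01 R)).
  apply: itg_eq; [by cts|by cts|move=> x _].
  pose W y := ka y * (uy x y * u (x + w) (y + s) + u x y * uy (x + w) (y + s)).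
  have <- : W be - W al = 0 by rewrite /W bnd subrr.
  apply: itg_FTC; [by []|by rewrite /W; cts|by cts|].
  move=> y yab; have [y01 ys01] := in01 _ yab.
  apply: isd_eq (isdM (dka_ka yab) (isdD
    (isdM (duyy x y01) (isd_shift (duy (x + w) ys01)))
    (isdM (duy x y01) (isd_shift (duyy (x + w) ys01))))) _.
  by rewrite /Z; ring.
have -> : itg 0 1 (fun x => itg al be (Y x)) = 0.
  rewrite (@itg_swap R 0 1 al be Y ler01 albe cY).
  rewrite -[RHS](mul0r (be - al)) -(itg_cst 0 albe).
  apply: itg_eq; [by cts|by cts|move=> y yab].
  have [y01 ys01] := in01 _ yab.
  rewrite /Y itgZ; [|by cts].
  pose W x := u x y * u (x + w) (y + s).
  have W0 : W 1 - W 0 = 0.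
    rewrite /W -{1}[1]add0r perx// (_ : 1 + w = 0 + w + 1); last by ring.
    by rewrite perx// subrr.
  suff -> : itg 0 1 (fun x => ux x y * u (x + w) (y + s) + u x y * ux (x + w) (y + s)) =
    W 1 - W 0 by rewrite W0 mulr0.
  apply: itg_FTC; [exact: ler01|by rewrite /W; cts|by cts|move=> x _].
  exact: (isdM (dux x y01) (isd_shift (u := fun x => u x (y + s)) (dux (x + w) ys01))).
by rewrite mulr0 addr0 subr0.
Qed.

End static_identity.

(** Continuity is global, while the equation and the derivatives are confined to t > t0 and 0 < y <
    1. The field [sf_bc] is a bilinear identity shared by the three boundary conditions; x and x'
    are independent because correlations compare different abscissas. *)
Record shear_flow {R : realType} (t0 nu : R) (b : R -> R)
    (f ft fx fy fyy : R -> R -> R -> R) : Prop := ShearFlow {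
  sf_cb : continuous b;
  sf_cf : continuous (fun p : R * R * R => f p.1.1 p.1.2 p.2);
  sf_cft : continuous (fun p : R * R * R => ft p.1.1 p.1.2 p.2);
  sf_cfx : continuous (fun p : R * R * R => fx p.1.1 p.1.2 p.2);
  sf_cfy : continuous (fun p : R * R * R => fy p.1.1 p.1.2 p.2);
  sf_cfyy : continuous (fun p : R * R * R => fyy p.1.1 p.1.2 p.2);
  sf_dt : forall t x y : R, t0 < t -> 0 < y < 1 ->
    is_derive t (1 : R) (fun t => f t x y) (ft t x y);
  sf_dx : forall t x y : R, t0 < t -> 0 < y < 1 ->
    is_derive x (1 : R) (fun x => f t x y) (fx t x y);
  sf_dy : forall t x y : R, t0 < t -> 0 < y < 1 ->
    is_derive y (1 : R) (f t x) (fy t x y);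
  sf_dyy : forall t x y : R, t0 < t -> 0 < y < 1 ->
    is_derive y (1 : R) (fy t x) (fyy t x y);
  sf_per : forall t x y : R, t0 < t -> 0 < y < 1 -> f t (x + 1) y = f t x y;
  sf_pery : forall t x y : R, t0 < t -> 0 < y < 1 -> fy t (x + 1) y = fy t x y;
  sf_bc : forall t x x' : R, t0 < t ->
    fy t x 1 * f t x' 1 + f t x 1 * fy t x' 1 =
    fy t x 0 * f t x' 0 + f t x 0 * fy t x' 0;
  sf_pde : forall t x y : R, t0 < t -> 0 < y < 1 ->
    ft t x y + b y * fx t x y - nu * fyy t x y = 0
}.

Definition pairing {R : realType} (al be s w : R) (ka : R -> R) (u : R -> R -> R) : R :=
  itg 0 1 (fun x => itg al be (fun y => ka y * (u x y * u (x + w) (y + s)))).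

(** The time derivative of [pairing], after integration by parts has removed all second
    derivatives. *)
Definition pairing_rate {R : realType} (nu al be s w : R) (b ka dka : R -> R)
    (u ux uy : R -> R -> R) : R :=
  itg 0 1 (fun x => itg al be (fun y =>
    ka y * (b y - b (y + s)) * (u x y * ux (x + w) (y + s)) -
    nu * (dka y * (uy x y * u (x + w) (y + s) + u x y * uy (x + w) (y + s)) +
          2 * ka y * (uy x y * uy (x + w) (y + s))))).

(** By periodicity, averaging over all shifts w makes the second factor independent of x. The x-mean
    thus obeys the same evolution formula as the energy. *)
Lemma mean_square_pairing {R : realType} (u : R -> R -> R) :
  continuous (fun p : R * R => u p.1 p.2) ->
  (forall x y : R, 0 < y < 1 -> u (x + 1) y = u x y) ->
  itg 0 1 (fun w => pairing 0 1 0 w (fun=> 1) u) =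
  itg 0 1 (fun y => itg 0 1 (u^~ y) ^+ 2).
Proof.
move=> cu pu; rewrite /pairing.
have swx w : itg 0 1 (fun x => itg 0 1 (fun y => 1 * (u x y * u (x + w) (y + 0)))) =
    itg 0 1 (fun y => itg 0 1 (fun x => 1 * (u x y * u (x + w) (y + 0)))).
  by rewrite (@itg_swap R 0 1 0 1 (fun x y => 1 * (u x y * u (x + w) (y + 0))))//; cts.
under eq_fun do rewrite swx.
rewrite (@itg_swap R 0 1 0 1 (fun w y => itg 0 1 (fun x => 1 * (u x y * u (x + w) (y + 0)))))//;
  last by cts.
apply: itg_eq; [by cts|by cts|move=> y y01].
rewrite (@itg_swap R 0 1 0 1 (fun w x => 1 * (u x y * u (x + w) (y + 0))))//; last by cts.
rewrite expr2 -itgZr; last by cts.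
apply: itg_eq; [by cts|by cts|move=> x _].
rewrite addr0 -itgZ; last by cts.
rewrite -(itg_shift_periodic (u := fun w => u x y * u w y) x); [|by cts|].
  by congr itg; apply/funext => w; rewrite mul1r addrC.
by move=> w; rewrite pu.
Qed.

Section evolution.
Context {R : realType}.
Variables (t0 nu : R) (b : R -> R) (f ft fx fy fyy : R -> R -> R -> R).
Hypothesis F : shear_flow t0 nu b f ft fx fy fyy.
Let cb := sf_cb F.
Let cf := sf_cf F.
Let cft := sf_cft F.
Let cfx := sf_cfx F.
Let cfy := sf_cfy F.
Let cfyy := sf_cfyy F.

Lemma pairing_evolution (a c al be s w : R) (ka dka : R -> R) :
  t0 <= a -> a <= c -> al <= be -> 0 <= al -> be <= 1 -> 0 <= al + s -> be + s <= 1 ->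
  continuous ka -> continuous dka ->
  (forall y : R, al < y < be -> is_derive y (1 : R) ka (dka y)) ->
  (forall t x : R, t0 < t ->
    ka be * (fy t x be * f t (x + w) (be + s) + f t x be * fy t (x + w) (be + s)) =
    ka al * (fy t x al * f t (x + w) (al + s) + f t x al * fy t (x + w) (al + s))) ->
  pairing al be s w ka (f c) - pairing al be s w ka (f a) =
  itg a c (fun t => pairing_rate nu al be s w b ka dka (f t) (fx t) (fy t)).
Proof.
move=> t0a ac albe al0 be1 als0 bes1 cka cdka dk bnd.
rewrite /pairing; pose v t x y :=
  ka y * (ft t x y * f t (x + w) (y + s) + f t x y * ft t (x + w) (y + s)).
transitivity (itg a c (fun t => itg 0 1 (fun x => itg al be (fun y => v t x y)))).
  apply: (@leibniz_rectangle R a c 0 1 al be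
    (fun t x y => ka y * (f t x y * f t (x + w) (y + s))));
    [by []|exact: ler01|by []|by cts|by rewrite /v; cts|].
  move=> t x y /andP[at_ _] _ /andP[aly ybe].
  have t0t : t0 < t by exact: le_lt_trans at_.
  apply: isdZ; apply: isdM; apply: (sf_dt F) => //.
    by rewrite (le_lt_trans al0 aly) (lt_le_trans ybe be1).
  by rewrite (le_lt_trans als0) ?(lt_le_trans _ bes1) ?ltrD2r.
rewrite /v; apply: itg_eq; [by cts|by rewrite /pairing_rate; cts|move=> t /andP[at_ _]].
have t0t : t0 < t by exact: le_lt_trans at_.
apply: (@transport_diffusion_pairing R nu al be s w b ka dka (f t) (ft t) (fx t) (fy t) (fyy t)) => //;
  try by cts.
- by move=> x y; exact: (sf_dx F).
- by move=> x y; exact: (sf_dy F).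
- by move=> x y; exact: (sf_dyy F).
- by move=> x y; exact: (sf_per F).
- by move=> x y; exact: (sf_pde F).
- by move=> x; exact: bnd.
Qed.

Lemma weighted_pairing_evolution (th : R -> R) (a c al be s : R) (ka dka : R -> R) :
  t0 <= a -> a <= c -> al <= be -> 0 <= al -> be <= 1 -> 0 <= al + s -> be + s <= 1 ->
  continuous th -> continuous ka -> continuous dka ->
  (forall y : R, al < y < be -> is_derive y (1 : R) ka (dka y)) ->
  (forall t x w : R, t0 < t ->
    ka be * (fy t x be * f t (x + w) (be + s) + f t x be * fy t (x + w) (be + s)) =
    ka al * (fy t x al * f t (x + w) (al + s) + f t x al * fy t (x + w) (al + s))) ->
  itg 0 1 (fun w => th w * pairing al be s w ka (f c)) -
  itg 0 1 (fun w => th w * pairing al be s w ka (f a)) =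
  itg a c (fun t => itg 0 1 (fun w => th w *
    pairing_rate nu al be s w b ka dka (f t) (fx t) (fy t))).
Proof.
move=> t0a ac albe al0 be1 als0 bes1 cth cka cdka dk bnd.
rewrite (@itg_swap R a c 0 1 (fun t w => th w *
    pairing_rate nu al be s w b ka dka (f t) (fx t) (fy t)))//; last by rewrite /pairing_rate; cts.
rewrite -itgB; [|by rewrite /pairing; cts|by rewrite /pairing; cts].
apply: itg_eq; [by rewrite /pairing; cts|by rewrite /pairing_rate; cts|move=> w _].
rewrite -mulrBr itgZ; last by rewrite /pairing_rate; cts.
congr (_ * _); apply: pairing_evolution => // t x; exact: bnd.
Qed.

(** For s = w = 0 and weight 1 the increment of b vanishes, and [sf_bc] with x = x' cancels the
    boundary terms. *)
Lemma energy_identity (a c : R) : t0 <= a -> a <= c ->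
  pairing 0 1 0 0 (fun=> 1) (f c) +
    2 * nu * itg a c (fun t => pairing 0 1 0 0 (fun=> 1) (fy t)) =
  pairing 0 1 0 0 (fun=> 1) (f a).
Proof.
move=> t0a ac.
have := @pairing_evolution a c 0 1 0 0 (fun=> 1) (fun=> 0) t0a ac ler01 (lexx _) (lexx _).
rewrite !addr0 => /(_ (lexx _) (lexx _) (@cts_cst _ _ (1 : R)) (@cts_cst _ _ (0 : R))
   (fun y _ => isd_cst y 1)) H.
have {}H := H (fun t x tt => congr1 (fun z => 1 * z) (sf_bc F x _ tt)).
apply/eqP; rewrite addrC -subr_eq0 -addrA addrC -subr_eq0; apply/eqP.
rewrite subr0 H -itgZ; last by rewrite /pairing; cts.
rewrite -itgD; [|by rewrite /pairing_rate; cts|by rewrite /pairing; cts].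
rewrite -[RHS](mul0r (c - a)) -(itg_cst 0 ac); congr itg; apply/funext => t.
rewrite /pairing /pairing_rate -itgZ; last by cts.
rewrite -itgD; [|by cts|by cts].
rewrite -[RHS](mul0r (1 - 0)) -(itg_cst 0 (@ler01 R)); congr itg; apply/funext => x.
rewrite -itgZ; last by cts.
rewrite -itgD; [|by cts|by cts].
rewrite -[RHS](mul0r (1 - 0)) -(itg_cst 0 (@ler01 R)); congr itg; apply/funext => y.
by rewrite !addr0; ring.
Qed.

(** With s = 0 the transport term drops out, and the rate becomes -2 nu times the integral of the
    squared x-mean of [fy]. *)
Lemma mean_decay (a c : R) : 0 <= nu -> t0 <= a -> a <= c ->
  itg 0 1 (fun w => pairing 0 1 0 w (fun=> 1) (f c)) <=
  itg 0 1 (fun w => pairing 0 1 0 w (fun=> 1) (f a)).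
Proof.
move=> nu0 t0a ac.
have := @weighted_pairing_evolution (fun=> 1) a c 0 1 0 (fun=> 1) (fun=> 0) t0a ac ler01
  (lexx _) (lexx _).
rewrite !addr0 => /(_ (lexx _) (lexx _) (@cts_cst _ _ (1 : R)) (@cts_cst _ _ (1 : R)) (@cts_cst _ _ (0 : R))
   (fun y _ => isd_cst y 1)) H.
have {}H := H (fun t x w tt => congr1 (fun z => 1 * z) (sf_bc F x _ tt)).
have E1 t : itg 0 1 (fun w => pairing 0 1 0 w (fun=> 1) (f t)) =
    itg 0 1 (fun w => 1 * pairing 0 1 0 w (fun=> 1) (f t)).
  by congr itg; apply/funext => w; exact/esym/mul1r.
rewrite -subr_le0 (E1 c) (E1 a) H -[leRHS](mul0r (c - a)) -(itg_cst 0 ac).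
apply: itg_le; [by rewrite /pairing_rate; cts|by cts|move=> t /andP[at_ _]].
have t0t : t0 < t by exact: le_lt_trans at_.
have -> : itg 0 1 (fun w => 1 * pairing_rate nu 0 1 0 w b (fun=> 1) (fun=> 0) (f t) (fx t) (fy t)) =
   (- (2 * nu)) * itg 0 1 (fun w => pairing 0 1 0 w (fun=> 1) (fy t)).
  rewrite -itgZ; last by rewrite /pairing; cts.
  congr itg; apply/funext => w; apply: etrans (mul1r _) _.
  rewrite /pairing /pairing_rate -itgZ; last by cts.
  congr itg; apply/funext => x.
  rewrite -itgZ; last by cts.
  congr itg; apply/funext => y.
  by rewrite !addr0; ring.
rewrite mean_square_pairing; [|by cts|by move=> x y; exact: (sf_pery F)].
rewrite mulNr oppr_le0 !mulr_ge0//; apply: itg_ge0; first by cts.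
by move=> y _; exact: sqr_ge0.
Qed.

End evolution.

(** * Cost of translations in y, and the boundary layer *)

Section translation_estimates.
Context {R : realType}.

Lemma itg_le_cst (u : R -> R) (k : R) : continuous u ->
  (forall x, 0 < x < 1 -> u x <= k) -> itg 0 1 u <= k.
Proof.
move=> cu uk; apply: (@le_trans _ _ (itg 0 1 (fun=> k))); last first.
  by rewrite itg_cst ?ler01// subr0 mulr1.
by apply: itg_le => //; exact: cts_cst.
Qed.

Lemma itg_affine_le (v : R -> R) (a b c k : R) : a <= b -> 1 / 2 <= k ->
  0 <= c + k * a -> c + k * b <= 1 -> continuous v -> (forall y, 0 <= v y) ->
  itg a b (fun y => v (c + k * y)) <= 2 * itg 0 1 v.
Proof.
move=> ab k2 ca cb1 cv v0; have k0 : 0 < k by lra.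
have cab : c + k * a <= c + k * b by rewrite lerD2l ler_pM2l.
have J0 : 0 <= itg a b (fun y => v (c + k * y)) by apply: itg_ge0 => //; cts.
have : itg a b (fun y => v (c + k * y)) * k <= itg 0 1 v.
  by rewrite itg_affine//; apply: itg_sub.
have : itg a b (fun y => v (c + k * y)) * (1 / 2) <= itg a b (fun y => v (c + k * y)) * k.
  by rewrite ler_wpM2l.
lra.
Qed.

(** An affine displacement covers both the constant shifts and the contraction of [0, 1]. The
    increment is the integral over t in [0, 1] of h v(y + t h); since h1 >= -1/2, the substitution
    has slope 1 + t h1 >= 1/2, whence the factor 2. *)
Lemma translation_bound (u v : R -> R) (a b h0 h1 H : R) : a <= b -> 0 <= a -> b <= 1 ->
  - (1 / 2) <= h1 -> 0 <= a + (h0 + h1 * a) -> b + (h0 + h1 * b) <= 1 ->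
  continuous u -> continuous v ->
  (forall y : R, 0 < y < 1 -> is_derive y (1 : R) u (v y)) ->
  (forall y, a < y < b -> `|h0 + h1 * y| <= H) ->
  itg a b (fun y => (u (y + (h0 + h1 * y)) - u y) ^+ 2) <=
  2 * H ^+ 2 * itg 0 1 (fun y => v y ^+ 2).
Proof.
move=> ab a0 b1 h12 ha hb cu cv du hH.
have step (y : R) : a < y < b -> (u (y + (h0 + h1 * y)) - u y) ^+ 2 <=
    H ^+ 2 * itg 0 1 (fun t => v (t * h0 + (1 + t * h1) * y) ^+ 2).
  move=> yab; have /andP[ay yb] := yab; set h := h0 + h1 * y.
  have E : u (y + h) - u y = itg 0 1 (fun t => h * v (t * h0 + (1 + t * h1) * y)).
    symmetry; pose W t := u (y + t * h).
    have -> : u (y + h) - u y = W 1 - W 0 by rewrite /W mul1r mul0r addr0.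
    apply: itg_FTC; [exact: ler01|by rewrite /W; cts|by cts|move=> t /andP[t0 t1]].
    rewrite mulrC (_ : t * h0 + (1 + t * h1) * y = y + t * h); last by rewrite /h; ring.
    apply: (@isd_comp _ t u (fun t => y + t * h)).
      apply: du.
      have h1y : 0 < 1 + h1 by lra.
      have e1 : 0 <= y + h.
        have : (1 + h1) * a <= (1 + h1) * y by rewrite ler_pM2l// ltW.
        by rewrite /h; lra.
      have e2 : y + h <= 1.
        have : (1 + h1) * y <= (1 + h1) * b by rewrite ler_pM2l// ltW.
        by rewrite /h; lra.
      (* A convex combination of the interior point y, with weight 1 - t > 0, and of y + h in [0, 1]
         is again interior. *)
      have e3 : (1 - t) * y + t * (y + h) = y + t * h by ring.
      rewrite -e3; apply/andP; split.
        by rewrite ltr_pwDl ?mulr_gt0 ?mulr_ge0//; lra.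
      have : (1 - t) * y < 1 - t by rewrite -[ltRHS]mulr1 ltr_pM2l; lra.
      have : t * (y + h) <= t by rewrite -[leRHS]mulr1 ler_pM2l.
      lra.
    apply: isd_eq (isdD (isd_cst t y) (isdM (isd_id t) (isd_cst t h))) _.
    by ring.
  rewrite E; apply: (le_trans (itg_sqr_le _)); first by cts.
  rewrite -itgZ; last by cts.
  apply: itg_le; [by cts|by cts|move=> t _].
  rewrite exprMn ler_wpM2r ?sqr_ge0//.
  by rewrite -[leLHS]real_normK ?num_real// lerXn2r ?nnegrE// ?hH// (le_trans _ (hH _ yab)).
apply: (@le_trans _ _ (itg a b (fun y => H ^+ 2 *
    itg 0 1 (fun t => v (t * h0 + (1 + t * h1) * y) ^+ 2)))).
  by apply: itg_le; [by cts|by cts|exact: step].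
rewrite itgZ; last by cts.
rewrite (_ : 2 * H ^+ 2 * _ = H ^+ 2 * (2 * itg 0 1 (fun y => v y ^+ 2))); last by ring.
apply: ler_wpM2l; first exact: sqr_ge0.
rewrite (@itg_swap R a b 0 1 (fun y t => v (t * h0 + (1 + t * h1) * y) ^+ 2))//; last by cts.
apply: itg_le_cst; [by cts|move=> t /andP[t0 t1]].
apply: (@itg_affine_le (fun y => v y ^+ 2)) => //.
- have : t * (1 / 2) <= 1 / 2 by lra.
  have : t * - (1 / 2) <= t * h1 by rewrite ler_pM2l.
  lra.
- have -> : t * h0 + (1 + t * h1) * a = (1 - t) * a + t * (a + (h0 + h1 * a)) by ring.
  by rewrite addr_ge0// mulr_ge0//; lra.
- have -> : t * h0 + (1 + t * h1) * b = (1 - t) * b + t * (b + (h0 + h1 * b)) by ring.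
  have : (1 - t) * b <= 1 - t by rewrite -[leRHS]mulr1 ler_pM2l; lra.
  have : t * (b + (h0 + h1 * b)) <= t by rewrite -[leRHS]mulr1 ler_pM2l.
  lra.
- by cts.
- by move=> y; exact: sqr_ge0.
Qed.

Variables (u uy : R -> R -> R).
Hypotheses (cu : continuous (fun p : R * R => u p.1 p.2))
  (cuy : continuous (fun p : R * R => uy p.1 p.2))
  (duy : forall x y : R, 0 < y < 1 -> is_derive y (1 : R) (u x) (uy x y)).

Let E := itg 0 1 (fun x => itg 0 1 (fun y => u x y ^+ 2)).
Let D := itg 0 1 (fun x => itg 0 1 (fun y => uy x y ^+ 2)).

Lemma shift_bound (be s : R) : 0 <= be -> 0 <= s -> be + s <= 1 ->
  itg 0 1 (fun x => itg 0 be (fun y => (u x (y + s) - u x y) ^+ 2)) <= 2 * s ^+ 2 * D.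
Proof.
move=> be0 s0 bes; rewrite /D -itgZ; last by cts.
apply: itg_le; [by cts|by cts|move=> x _].
have := @translation_bound (u x) (uy x) 0 be s 0 s be0 (lexx _).
rewrite !mul0r !addr0 add0r => H; apply: (le_trans _ (H _ _ _ _ _ _ _ _)) => //.
- apply: itg_le; [by cts|by cts|move=> y _].
  by rewrite mul0r addr0.
- by lra.
- by cts.
- by cts.
- by move=> y _; rewrite mul0r addr0 ger0_norm.
Qed.

(* Compares [u x] with its composition with the contraction [y |-> d + (1 - 2 d) y] of [0, 1]
   onto [d, 1 - d]. *)
Lemma boundary_layer_bound (d : R) : 0 <= d -> d <= 1 / 4 ->
  E <= 4 * itg 0 1 (fun x => itg d (1 - d) (fun y => u x y ^+ 2)) + 4 * d ^+ 2 * D.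
Proof.
move=> d0 d4; rewrite /E /D.
have dd : d <= 1 - d by lra.
rewrite -!itgZ; [|by cts|by cts].
rewrite -itgD; [|by cts|by cts].
apply: itg_le; [by cts|by cts|move=> x _].
have H : itg 0 1 (fun y => (u x (y + (d + (- (2 * d)) * y)) - u x y) ^+ 2) <=
  2 * d ^+ 2 * itg 0 1 (fun y => uy x y ^+ 2).
  apply: translation_bound; [exact: ler01|by []|by []|by lra|by lra|by lra|by cts|by cts|].
  move=> y /andP[y0 y1]; rewrite ler_norml.
  have : d * y <= d by rewrite -[leRHS]mulr1 ler_wpM2l// ltW.
  have : 0 <= d * y by rewrite mulr_ge0// ltW.
  lra.
have K : itg 0 1 (fun y => u x (d + (1 - 2 * d) * y) ^+ 2) <=
    2 * itg d (1 - d) (fun y => u x y ^+ 2).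
  have k0 : 0 < 1 - 2 * d by lra.
  have := @itg_affine R 0 1 d (1 - 2 * d) (fun y => u x y ^+ 2) ler01 k0.
  rewrite mulr0 addr0 mulr1 (_ : d + (1 - 2 * d) = 1 - d); last by ring.
  have c1 : continuous (fun y => u x y ^+ 2) by cts.
  move=> /(_ c1) <-.
  have J0 : 0 <= itg 0 1 (fun y => u x (d + (1 - 2 * d) * y) ^+ 2).
    by apply: itg_ge0; [cts|move=> y _; exact: sqr_ge0].
  have : itg 0 1 (fun y => u x (d + (1 - 2 * d) * y) ^+ 2) * (1 / 2) <=
    itg 0 1 (fun y => u x (d + (1 - 2 * d) * y) ^+ 2) * (1 - 2 * d).
    by rewrite ler_wpM2l//; lra.
  lra.
apply: (@le_trans _ _ (itg 0 1 (fun y => 2 * u x (d + (1 - 2 * d) * y) ^+ 2 +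
   2 * (u x (y + (d + (- (2 * d)) * y)) - u x y) ^+ 2))).
  apply: itg_le; [by cts|by cts|move=> y _].
  rewrite (_ : y + (d + - (2 * d) * y) = d + (1 - 2 * d) * y); last by ring.
  set z := u x (d + _).
  (* The difference of the two sides of u^2 <= 2 z^2 + 2 (z - u)^2 is (2 z - u)^2. *)
  have := sqr_ge0 (2 * z - u x y); lra.
rewrite itgD; [|by cts|by cts].
rewrite !itgZ; [|by cts|by cts]; lra.
Qed.

Lemma sheared_shift_bound (g : R -> R -> R) (be s : R) : 0 <= be -> 0 <= s -> be + s <= 1 ->
  continuous (fun p : R * R => g p.1 p.2) -> (forall x y, 0 <= g x y) ->
  (forall x y : R, 0 < y < 1 -> g (x + 1) y = g x y) ->
  itg 0 1 (fun w => itg 0 1 (fun x => itg 0 be (fun y => g (x + w) (y + s)))) <=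
  itg 0 1 (fun x => itg 0 1 (g x)).
Proof.
move=> be0 s0 bes cg g0 pg.
have [h1 h2 h3] : [/\ 0 <= s + 1 * 0, s + 1 * 0 <= s + 1 * be & s + 1 * be <= 1].
  by split; lra.
apply: itg_le_cst; [by cts|move=> w _].
have c1 : continuous (fun p : R * R => g (p.1 + w) (p.2 + s)) by cts.
rewrite (@itg_swap R 0 1 0 be (fun x y => g (x + w) (y + s)) ler01 be0 c1).
rewrite (@itg_swap R 0 1 0 1 g ler01 ler01 cg).
apply: (@le_trans _ _ (itg 0 be (fun y => itg 0 1 (fun x => g x (y + s))))).
  apply: itg_le; [by cts|by cts|move=> y /andP[y0 yb]].
  by rewrite (@itg_shift_periodic _ (fun x => g x (y + s)))//; [cts|move=> x; apply: pg; lra].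
have cG : continuous (fun y => itg 0 1 (g^~ y)) by cts.
have := @itg_affine R 0 be s 1 (fun y => itg 0 1 (g^~ y)) be0 ltr01 cG.
rewrite mulr1 => E1.
rewrite (_ : itg 0 be (fun y => itg 0 1 (fun x => g x (y + s))) =
  itg (s + 1 * 0) (s + 1 * be) (fun y => itg 0 1 (g^~ y))); last first.
  by rewrite -E1; congr itg; apply/funext => y; rewrite mul1r addrC.
apply: itg_sub; [exact: h1|exact: h2|exact: h3|exact: cG|move=> y _].
by apply: itg_ge0; [cts|move=> x _; exact: g0].
Qed.

End translation_estimates.

(** * Lower bound for the rate of the correlation at one shift *)

Lemma shift_in_unit {R : realType} (be s y : R) : 0 <= s -> be + s <= 1 -> 0 < y < be ->
  (0 < y < 1) /\ (0 < y + s < 1).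
Proof. by move=> s0 bes /andP[? ?]; split; lra. Qed.

Lemma half_shift_le1 {R : realType} (w : R) : 0 < w < 1 -> `|w - 1 / 2| <= 1.
Proof. by move=> /andP[? ?]; rewrite ler_norml; lra. Qed.

(** K p q = K p^2 + K p (q - p), and Young's inequality splits the last product. *)
Lemma young_increment {R : realType} (C e K p q : R) : 0 <= C -> 0 < e -> `|K| <= C ->
  K * p ^+ 2 + (- (C * e) * p ^+ 2 + - (C / (4 * e)) * (q - p) ^+ 2) <= K * (p * q).
Proof.
move=> C0 e0 KC; set d := q - p.
have -> : q = p + d by rewrite /d; ring.
have key : - (K * (p * d)) <= C * `|p * d|.
  by apply: (le_trans (ler_norm _)); rewrite normrN normrM ler_wpM2r.
have e4 : C * `|p * d| = C * e * p ^+ 2 + C / (4 * e) * d ^+ 2 -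
   C * ((2 * e * `|p| - `|d|) ^+ 2 / (4 * e)).
  rewrite -(real_normK (num_real p)) -(real_normK (num_real d)) normrM.
  by field; rewrite gt_eqF.
have e5 : 0 <= C * ((2 * e * `|p| - `|d|) ^+ 2 / (4 * e)).
  by rewrite mulr_ge0// divr_ge0 ?sqr_ge0// mulr_ge0// ltW.
rewrite (_ : K * (p * (p + d)) = K * p ^+ 2 + K * (p * d)); last by ring.
by lra.
Qed.

Lemma young_weighted {R : realType} (c r e z z' : R) : 0 <= c -> 0 < r -> 0 < e ->
  c * r * `|z * z'| <= c * e * z' ^+ 2 + c * r ^+ 2 / (4 * e) * z ^+ 2.
Proof.
move=> c0 r0 e0.
have -> : c * e * z' ^+ 2 + c * r ^+ 2 / (4 * e) * z ^+ 2 =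
  c * ((2 * e * `|z'| - r * `|z|) ^+ 2 / (4 * e)) + c * r * `|z * z'|.
  rewrite normrM -(real_normK (num_real z)) -(real_normK (num_real z')).
  by field; rewrite gt_eqF.
by rewrite lerDr mulr_ge0// divr_ge0 ?sqr_ge0// mulr_ge0// ltW.
Qed.

(** A derivative of the weight costs 1/r, so nu = rho r^2 leaves rho r. Young's inequality divides
    this into rho e for the undifferentiated factor and nu / (4 e) for the differentiated one. *)
Lemma dissipation_error {R : realType} (nu rho r C e w k dk p q p' q' : R) :
  nu = rho * r ^+ 2 -> 0 < rho -> 0 < r -> 0 < C -> 0 < e -> `|w| <= 1 ->
  `|dk| * r <= C -> `|k| <= C ->
  w * (nu * (dk * (q * p' + p * q') + 2 * k * (q * q'))) <=
  (C * rho * e * p ^+ 2 + C * nu * (1 / (4 * e) + 1) * q ^+ 2) +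
  (C * rho * e * p' ^+ 2 + C * nu * (1 / (4 * e) + 1) * q' ^+ 2).
Proof.
move=> nuE rho0 r0 C0 e0 w1 dkC kC.
have nu0 : 0 <= nu by rewrite nuE mulr_ge0 ?sqr_ge0// ltW.
have Crho : 0 <= C * rho by rewrite mulr_ge0// ltW.
apply: (le_trans (ler_norm _)); rewrite normrM.
apply: (le_trans (ler_wpM2r (normr_ge0 _) w1)); rewrite [leLHS]mul1r normrM (ger0_norm nu0).
have S (z z' : R) : nu * `|dk * (z * z')| <= C * rho * e * z' ^+ 2 + C * nu * (1 / (4 * e)) * z ^+ 2.
  have -> : C * nu * (1 / (4 * e)) = C * rho * r ^+ 2 / (4 * e).
    by rewrite nuE; field; rewrite gt_eqF.
  apply: le_trans (young_weighted z z' Crho r0 e0).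
  have -> : C * rho * r * `|z * z'| = C * (rho * r * `|z * z'|) by ring.
  rewrite (normrM dk) (_ : nu * _ = `|dk| * r * (rho * r * `|z * z'|)); last by rewrite nuE; ring.
  by rewrite ler_wpM2r// !mulr_ge0// ltW.
have S3 : nu * `|2 * k * (q * q')| <= C * nu * (q ^+ 2 + q' ^+ 2).
  rewrite !normrM (ger0_norm (ler0n _ 2)).
  rewrite (_ : nu * (2 * `|k| * (`|q| * `|q'|)) = `|k| * (nu * (2 * `|q| * `|q'|))); last by ring.
  apply: (@le_trans _ _ (C * (nu * (q ^+ 2 + q' ^+ 2)))); last by rewrite mulrA.
  apply: ler_pM => //; first by rewrite !mulr_ge0.
  apply: ler_wpM2l => //.
  rewrite -(real_normK (num_real q)) -(real_normK (num_real q')).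
  have := sqr_ge0 (`|q| - `|q'|); lra.
have S1 := S q p'; have S2 := S q' p.
apply: (@le_trans _ _ (nu * `|dk * (q * p')| + nu * `|dk * (q' * p)| + nu * `|2 * k * (q * q')|)).
  rewrite [leRHS](_ : _ = nu * (`|dk * (q * p')| + `|dk * (q' * p)| + `|2 * k * (q * q')|));
    last by ring.
  rewrite ler_wpM2l// mulrDr [p * q']mulrC.
  by apply: (le_trans (ler_normD _ _)); rewrite lerD2r; exact: ler_normD.
move: S1 S2 S3; set i := 1 / (4 * e).
move: `|_| `|_| `|_| => n1 n2 n3; lra.
Qed.

Lemma combine_errors {R : realType} (X A P B Q a b : R) : A * P <= a -> B * Q <= b ->
  X - a - b <= X + (- A * P + - B * Q).
Proof. lra. Qed.

Lemma double_bound {R : realType} (p q a : R) : p <= a -> q <= a -> p + q <= 2 * a.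
Proof. lra. Qed.

Lemma combine_main {R : realType} (X C e a s i d P N : R) :
  X - C * e * a - C * s * d <= P -> N <= 2 * C * e * a + C * (i + 2) * d ->
  X - 3 * C * e * a - C * (s + i + 2) * d <= P - N.
Proof. lra. Qed.

Section coercivity.
Context {R : realType}.
Variables (nu rho r S C1 : R) (b : R -> R) (u ux uy : R -> R -> R).
Hypotheses (rho0 : 0 < rho) (r0 : 0 < r) (nuE : nu = rho * r ^+ 2).
Hypotheses (C10 : 0 < C1) (cb : continuous b)
  (cu : continuous (fun p : R * R => u p.1 p.2))
  (cux : continuous (fun p : R * R => ux p.1 p.2))
  (cuy : continuous (fun p : R * R => uy p.1 p.2)).
Hypotheses
  (dux : forall x y : R, 0 < y < 1 -> is_derive x (1 : R) (fun x => u x y) (ux x y))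
  (duy : forall x y : R, 0 < y < 1 -> is_derive y (1 : R) (u x) (uy x y))
  (perx : forall x y : R, 0 < y < 1 -> u (x + 1) y = u x y)
  (pery : forall x y : R, 0 < y < 1 -> uy (x + 1) y = uy x y)
  (mean0 : forall y : R, 0 < y < 1 -> itg 0 1 (u^~ y) = 0).

Let E := itg 0 1 (fun x => itg 0 1 (fun y => u x y ^+ 2)).
Let D := itg 0 1 (fun x => itg 0 1 (fun y => uy x y ^+ 2)).

(** The sawtooth w - 1/2 jumps by 1 across a period, which produces u(x, y); its slope 1 leaves the
    x-mean of u, which is 0. *)
Lemma zigzag_pairing (x y : R) : 0 < y < 1 ->
  itg 0 1 (fun w => (w - 1 / 2) * ux (x + w) y) = u x y.
Proof.
move=> y01.
have c1 : continuous (fun w => u (x + w) y) by cts.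
have c2 : continuous (fun w : R => (w - 1 / 2) * ux (x + w) y) by cts.
have c3 : continuous (fun w : R => (w - 1 / 2) * u (x + w) y) by cts.
have K : itg 0 1 (fun w => (w - 1 / 2) * ux (x + w) y + u (x + w) y) = u x y.
  pose W w := (w - 1 / 2) * u (x + w) y.
  have -> : u x y = W 1 - W 0.
    by rewrite /W perx// addr0; field.
  apply: itg_FTC; [exact: ler01|exact: c3|exact: ctsD|move=> w _].
  apply: isd_eq (isdM (isdD (isd_id w) (isd_cst w (- (1 / 2))))
    (@isd_comp _ w (fun x => u x y) (fun w => x + w) _ _ (dux (x + w) y01)
       (isdD (isd_cst w x) (isd_id w)))) _.
  by ring.
rewrite itgD// in K.
have M : itg 0 1 (fun w => u (x + w) y) = 0.
  rewrite (_ : (fun w => u (x + w) y) = (fun w => u (w + x) y)); last first.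
    by apply/funext => w; rewrite addrC.
  by rewrite (@itg_shift_periodic _ (u^~ y) x); [exact: mean0|cts|move=> z; exact: perx].
by rewrite M addr0 in K.
Qed.

(** Of the three portions of C1 eta rho E, one pays for replacing u at height y + s by u at height
    y, and two pay for the dissipation terms, one at each point of the correlation. *)
Lemma rate_lower_bound (be s eta : R) (ka dka : R -> R) :
  0 <= be -> 0 <= s -> s <= S * r -> be + s <= 1 -> 0 < eta ->
  continuous ka -> continuous dka ->
  (forall y, 0 < y < be -> `|ka y| <= C1) ->
  (forall y, 0 < y < be -> `|dka y| * r <= C1) ->
  (forall y, 0 < y < be -> `|ka y * (b y - b (y + s))| <= C1 * rho) ->
  itg 0 1 (fun x => itg 0 be (fun y => ka y * (b y - b (y + s)) * u x y ^+ 2))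
    - 3 * C1 * eta * (rho * E)
    - C1 * (S ^+ 2 / (2 * eta) + 1 / (2 * eta) + 2) * (nu * D) <=
  itg 0 1 (fun w => (w - 1 / 2) * pairing_rate nu 0 be s w b ka dka u ux uy).
Proof.
move=> be0 s0 sS bes eta0 cka cdka bka bdka bK.
have be1 : be <= 1 by lra.
have in01 (y : R) : 0 < y < be -> (0 < y < 1) /\ (0 < y + s < 1).
  exact: shift_in_unit.
have cprod : continuous (fun p : R * R => u p.1 p.2 ^+ 2) by cts.
have cprody : continuous (fun p : R * R => uy p.1 p.2 ^+ 2) by cts.
pose K y := ka y * (b y - b (y + s)).
pose N w x y := dka y * (uy x y * u (x + w) (y + s) + u x y * uy (x + w) (y + s)) +
          2 * ka y * (uy x y * uy (x + w) (y + s)).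
have cN : continuous (fun p : R * R * R => N p.1.1 p.1.2 p.2) by rewrite /N; cts.
have cK : continuous K by rewrite /K; cts.
(* The w-integral of the transport term is evaluated by [zigzag_pairing] at height y + s. *)
have splitE : itg 0 1 (fun w => (w - 1 / 2) * pairing_rate nu 0 be s w b ka dka u ux uy) =
    itg 0 1 (fun x => itg 0 be (fun y => K y * (u x y * u x (y + s)))) -
    itg 0 1 (fun w => itg 0 1 (fun x => itg 0 be (fun y => (w - 1 / 2) * (nu * N w x y)))).
  have -> : itg 0 1 (fun x => itg 0 be (fun y => K y * (u x y * u x (y + s)))) =
      itg 0 1 (fun w => itg 0 1 (fun x => itg 0 be (fun y =>
        (w - 1 / 2) * (K y * (u x y * ux (x + w) (y + s)))))).
    rewrite (@itg_swap R 0 1 0 1 (fun w x => itg 0 be (fun y =>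
        (w - 1 / 2) * (K y * (u x y * ux (x + w) (y + s))))) ler01 ler01); last by cts.
    apply: itg_eq; [by cts|by cts|move=> x _].
    rewrite (@itg_swap R 0 1 0 be (fun w y =>
        (w - 1 / 2) * (K y * (u x y * ux (x + w) (y + s)))) ler01 be0); last by cts.
    apply: itg_eq; [by cts|by cts|move=> y /in01[y01 ys01]].
    rewrite -(zigzag_pairing x ys01) mulrA -itgZ; last by cts.
    by congr itg; apply/funext => w; ring.
  rewrite -itgB; [|by cts|by cts].
  congr itg; apply/funext => w; rewrite /pairing_rate -itgZ; last by cts.
  rewrite -itgB; [|by cts|by cts].
  congr itg; apply/funext => x; rewrite -itgZ; last by cts.
  rewrite -itgB; [|by cts|by cts].
  by congr itg; apply/funext => y; rewrite /K /N; ring.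
rewrite splitE.
have main : itg 0 1 (fun x => itg 0 be (fun y => K y * u x y ^+ 2)) -
     C1 * eta * (rho * E) - C1 * (S ^+ 2 / (2 * eta)) * (nu * D) <=
    itg 0 1 (fun x => itg 0 be (fun y => K y * (u x y * u x (y + s)))).
  have sub : itg 0 1 (fun x => itg 0 be (fun y => u x y ^+ 2)) <= E.
    apply: itg_le; [by cts|by cts|move=> x _].
    by apply: itg_sub; [by []|by []|exact: be1|by cts|move=> y _; exact: sqr_ge0].
  have sh := shift_bound cu cuy duy be0 s0 bes.
  have D0 : 0 <= D.
    by apply: itg_ge0; [cts|move=> x _; apply: itg_ge0; [cts|move=> y _; exact: sqr_ge0]].
  have H1 : itg 0 1 (fun x => itg 0 be (fun y => K y * u x y ^+ 2 +
      ((- (C1 * rho * eta)) * u x y ^+ 2 +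
       (- (C1 * rho / (4 * eta))) * (u x (y + s) - u x y) ^+ 2))) <=
      itg 0 1 (fun x => itg 0 be (fun y => K y * (u x y * u x (y + s)))).
    apply: itg_le; [by cts|by cts|move=> x _].
    apply: itg_le; [by cts|by cts|move=> y yb].
    by apply: young_increment => //; [rewrite mulr_ge0// ltW|exact: bK].
  apply: le_trans H1.
  have -> : itg 0 1 (fun x => itg 0 be (fun y => K y * u x y ^+ 2 +
      ((- (C1 * rho * eta)) * u x y ^+ 2 +
       (- (C1 * rho / (4 * eta))) * (u x (y + s) - u x y) ^+ 2))) =
     itg 0 1 (fun x => itg 0 be (fun y => K y * u x y ^+ 2)) +
     ((- (C1 * rho * eta)) * itg 0 1 (fun x => itg 0 be (fun y => u x y ^+ 2)) +
      (- (C1 * rho / (4 * eta))) * itg 0 1 (fun x => itg 0 be (fun y => (u x (y + s) - u x y) ^+ 2))).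
    rewrite -!itgZ; [|by cts|by cts].
    rewrite -!itgD; [|by cts|by cts|by cts|by cts].
    congr itg; apply/funext => x.
    rewrite -!itgZ; [|by cts|by cts].
    by rewrite -!itgD; [|by cts|by cts|by cts|by cts].
  have a1 : C1 * rho * eta * itg 0 1 (fun x => itg 0 be (fun y => u x y ^+ 2)) <=
      C1 * eta * (rho * E).
    rewrite (_ : C1 * eta * (rho * E) = C1 * rho * eta * E); last by ring.
    by apply: ler_wpM2l => //; rewrite !mulr_ge0// ltW.
  have a2 : C1 * rho / (4 * eta) *
      itg 0 1 (fun x => itg 0 be (fun y => (u x (y + s) - u x y) ^+ 2)) <=
      C1 * (S ^+ 2 / (2 * eta)) * (nu * D).
    apply: (@le_trans _ _ (C1 * rho / (4 * eta) * (2 * (S * r) ^+ 2 * D))).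
      apply: ler_wpM2l; first by rewrite divr_ge0 ?mulr_ge0 ?ltW.
      apply: (le_trans sh); apply: ler_wpM2r => //; apply: ler_wpM2l => //.
      by rewrite lerXn2r ?nnegrE// (le_trans s0).
    by rewrite nuE le_eqVlt; apply/orP; left; apply/eqP; field; rewrite gt_eqF.
  exact: combine_errors a1 a2.
have err : itg 0 1 (fun w => itg 0 1 (fun x => itg 0 be (fun y => (w - 1 / 2) * (nu * N w x y)))) <=
   2 * C1 * eta * (rho * E) + C1 * (1 / (2 * eta) + 2) * (nu * D).
  pose A := C1 * rho * eta; pose B := C1 * nu * (1 / (4 * eta) + 1).
  have A0 : 0 <= A by rewrite /A !mulr_ge0// ltW.
  have nu0 : 0 <= nu by rewrite nuE mulr_ge0 ?sqr_ge0// ltW.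
  have B0 : 0 <= B by rewrite /B !mulr_ge0 ?addr_ge0 ?divr_ge0 ?mulr_ge0// ltW.
  have H1 : itg 0 1 (fun w => itg 0 1 (fun x => itg 0 be (fun y => (w - 1 / 2) * (nu * N w x y)))) <=
     itg 0 1 (fun w => itg 0 1 (fun x => itg 0 be (fun y =>
       (A * u x y ^+ 2 + B * uy x y ^+ 2) +
       (A * u (x + w) (y + s) ^+ 2 + B * uy (x + w) (y + s) ^+ 2)))).
    apply: itg_le; [by cts|by cts|move=> w /andP[w0 w1]].
    apply: itg_le; [by cts|by cts|move=> x _].
    apply: itg_le; [by cts|by cts|move=> y yb].
    apply: (@dissipation_error _ nu rho r) => //; [|exact: bdka|exact: bka].
    by apply: half_shift_le1; rewrite w0.
  apply: (le_trans H1).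
  have cG : continuous (fun p : R * R => A * u p.1 p.2 ^+ 2 + B * uy p.1 p.2 ^+ 2) by cts.
  have SB := @sheared_shift_bound R (fun x y => A * u x y ^+ 2 + B * uy x y ^+ 2) be s be0 s0 bes cG.
  have SB0 := @sheared_shift_bound R (fun x y => A * u x y ^+ 2 + B * uy x y ^+ 2) be 0 be0 (lexx _).
  have G0 (x y : R) : 0 <= A * u x y ^+ 2 + B * uy x y ^+ 2.
    by rewrite addr_ge0// mulr_ge0// sqr_ge0.
  have pG (x y : R) : 0 < y < 1 ->
     A * u (x + 1) y ^+ 2 + B * uy (x + 1) y ^+ 2 = A * u x y ^+ 2 + B * uy x y ^+ 2.
    by move=> y01; rewrite perx// pery.
  have {}SB := SB G0 pG.
  have GE : itg 0 1 (fun x => itg 0 1 (fun y => A * u x y ^+ 2 + B * uy x y ^+ 2)) = A * E + B * D.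
    rewrite /E /D -!itgZ; [|by cts|by cts].
    rewrite -itgD; [|by cts|by cts].
    congr itg; apply/funext => x.
    rewrite -!itgZ; [|by cts|by cts].
    by rewrite -itgD; [|by cts|by cts].
  have -> : itg 0 1 (fun w => itg 0 1 (fun x => itg 0 be (fun y =>
       (A * u x y ^+ 2 + B * uy x y ^+ 2) +
       (A * u (x + w) (y + s) ^+ 2 + B * uy (x + w) (y + s) ^+ 2)))) =
     itg 0 1 (fun x => itg 0 be (fun y => A * u x y ^+ 2 + B * uy x y ^+ 2)) +
     itg 0 1 (fun w => itg 0 1 (fun x => itg 0 be (fun y =>
        A * u (x + w) (y + s) ^+ 2 + B * uy (x + w) (y + s) ^+ 2))).
    rewrite -[X in _ = X + _]mulr1 -[X in _ = _ * X + _](subr0 1) -itg_cst ?ler01//.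
    rewrite -itgD; [|by cts|by cts].
    congr itg; apply/funext => w; rewrite -itgD; [|by cts|by cts].
    by congr itg; apply/funext => x; rewrite -itgD; [|by cts|by cts].
  have SA : itg 0 1 (fun x => itg 0 be (fun y => A * u x y ^+ 2 + B * uy x y ^+ 2)) <= A * E + B * D.
    rewrite -GE; apply: itg_le; [by cts|by cts|move=> x _].
    by apply: itg_sub; [by []|by []|exact: be1|by cts|by move=> y _; exact: G0].
  rewrite GE in SB.
  have -> : 2 * C1 * eta * (rho * E) + C1 * (1 / (2 * eta) + 2) * (nu * D) = 2 * (A * E + B * D).
    by rewrite /A /B; field; rewrite gt_eqF.
  exact: double_bound SA SB.
exact: combine_main main err.
Qed.

End coercivity.

(** * Taylor expansion and interpolation at the nodes 1, ..., n *)

Section taylor.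
Context {R : realType}.

(** Induction on m for all families G at once: the h-derivative of a remainder is the previous
    remainder for [fun k => G k.+1]. The mean value theorem stands in for integration, hence no
    factorial in the bound. *)
Lemma taylor_remainder (m : nat) (G : nat -> R -> R) (K y h : R) :
  (forall k, continuous (G k)) ->
  (forall k (z : R), 0 < z < 1 -> is_derive z (1 : R) (G k) (G k.+1 z)) ->
  (forall z, `|G m z| <= K) -> 0 < y -> 0 <= h -> y + h < 1 ->
  `|G 0%N (y + h) - \sum_(k < m) h ^+ k / k`!%:R * G k y| <= K * h ^+ m.
Proof.
move=> + + + y0.
elim: m G h => [|m IH] G h cG dG GK h0 yh; first by rewrite big_ord0 subr0 mulr1.
pose phi t := G 0%N (y + t) - \sum_(k < m.+1) t ^+ k / k`!%:R * G k y.
pose dphi t := G 1%N (y + t) - \sum_(k < m) t ^+ k / k`!%:R * G k.+1 y.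
have phi0 : phi 0 = 0.
  rewrite /phi addr0 big_ord_recl big1 => [|i _]; first by rewrite /= fact0; field.
  by rewrite exprS !mul0r.
have cphi : continuous phi by rewrite /phi; cts.
have dphiE (t : R) : t \in `]0, h[ -> is_derive t (1 : R) phi (dphi t).
  rewrite in_itv/= => /andP[t0 th].
  have yt : 0 < y + t < 1 by rewrite addr_gt0// (lt_trans _ yh)// ltrD2l.
  have ds : is_derive t (1 : R) (fun t => \sum_(k < m.+1) t ^+ k / k`!%:R * G k y)
     (\sum_(k < m) t ^+ k / k`!%:R * G k.+1 y).
    have -> : (fun t => \sum_(k < m.+1) t ^+ k / k`!%:R * G k y) =
      (fun t => G 0%N y + \sum_(k < m) t ^+ k.+1 / (k.+1)`!%:R * G k.+1 y).
      apply/funext => z; rewrite big_ord_recl /= fact0; congr (_ + _).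
      by rewrite expr0 divr1 mul1r.
    suff : is_derive t (1 : R)
      (fun t => G 0%N y + \sum_(k < m) t ^+ k.+1 / (k.+1)`!%:R * G k.+1 y)
      (0 + \sum_(k < m) t ^+ k / k`!%:R * G k.+1 y) by rewrite add0r.
    apply: (isdD (isd_cst t _)); apply: isd_sum => k.
    apply: isd_eq (isdM (isdM (isdX k (isd_id t)) (isd_cst _ _)) (isd_cst _ _)) _.
    have k1 : k.+1%:R != 0 :> R by rewrite pnatr_eq0.
    have k2 : k`!%:R != 0 :> R by rewrite pnatr_eq0 -lt0n fact_gt0.
    rewrite factS natrM; move: k.+1%:R k`!%:R k1 k2 => k1 k2 k1n k2n.
    by field; rewrite k1n k2n.
  apply: (isdD _ (isdN ds)).
  apply: isd_eq (@isd_comp _ t (G 0%N) (fun t => y + t) _ _ (dG 0%N _ yt)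
    (isdD (isd_cst t y) (isd_id t))) _.
  by rewrite add0r mulr1.
have [c] := @MVT_segment R phi dphi 0 h h0 dphiE (continuous_subspaceT cphi).
rewrite in_itv/= phi0 !subr0 => /andP[c0 ch]; rewrite -/(phi h) => ->.
rewrite normrM (ger0_norm h0) exprSr mulrA ler_wpM2r//.
have := IH (fun k => G k.+1) c (fun k => cG k.+1) (fun k => dG k.+1) GK c0.
rewrite -/(dphi c) => /(_ (le_lt_trans _ yh)); rewrite lerD2l ch => /(_ isT) H.
apply: (le_trans H); apply: ler_wpM2l; first by apply: le_trans (GK 0).
by rewrite lerXn2r ?nnegrE.
Qed.

(** Powers start at 1 and are divided by factorials, so the matrix is a Vandermonde matrix between
    two invertible diagonal ones. Its inverse isolates each term r^j b^(j) from the Taylor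
    polynomials at the n shifts. *)
Lemma interpolation_coefficients (n : nat) : exists c : 'I_n -> 'I_n -> R,
  forall j k : 'I_n, \sum_(i < n) c j i * (i.+1%:R ^+ k.+1 / (k.+1)`!%:R) = (j == k)%:R.
Proof.
pose a : 'rV[R]_n := \row_i i.+1%:R.
pose d : 'rV[R]_n := \row_k ((k.+1)`!%:R)^-1.
pose M : 'M[R]_n := diag_mx d *m (Vandermonde n a *m diag_mx a).
have Mu : M \in unitmx.
  rewrite !unitmx_mul !unitmxE !det_diag det_Vandermonde !unitfE.
  apply/and3P; split; apply/prodf_neq0 => i _.
  - by rewrite mxE invr_eq0 pnatr_eq0 -lt0n fact_gt0.
  - apply/prodf_neq0 => j ij; rewrite !mxE subr_eq0 eqr_nat eqSS.
    by rewrite eq_sym neq_ltn ij.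
  - by rewrite mxE pnatr_eq0.
have ME (k i : 'I_n) : M k i = i.+1%:R ^+ k.+1 / (k.+1)`!%:R.
  rewrite /M mul_diag_mx mxE mul_mx_diag !mxE exprSr; ring.
exists (fun j i => (invmx M) i j) => j k.
have := congr1 (fun A : 'M[R]_n => A k j) (mulmxV Mu).
rewrite !mxE eq_sym => <-.
by apply: eq_bigr => i _; rewrite ME mulrC.
Qed.

End taylor.

(** * A cutoff at the ends of [0, be] on the scale r *)

Section cutoff.
Context {R : realType}.
Variables (r be : R).
Hypotheses (r0 : 0 < r) (be0 : 0 <= be) (be1 : be <= 1).

(** A rational function of z = y (be - y): it vanishes at both ends and has a closed-form derivative
    on the whole line. *)
Definition cutoff (y : R) : R :=
  (y * (be - y)) ^+ 2 * ((y * (be - y)) ^+ 2 + r ^+ 2)^-1.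

Definition cutoff' (y : R) : R :=
  2 * (y * (be - y)) * (be - 2 * y) * r ^+ 2 * ((y * (be - y)) ^+ 2 + r ^+ 2) ^- 2.

Let den0 y : 0 < (y * (be - y)) ^+ 2 + r ^+ 2.
Proof. by rewrite ltr_wpDl ?sqr_ge0// exprn_gt0. Qed.

Lemma cutoff_cts : continuous cutoff.
Proof.
rewrite /cutoff; apply: ctsM; first by cts.
by apply: ctsV; [move=> y; rewrite gt_eqF|cts].
Qed.

Lemma cutoff'_cts : continuous cutoff'.
Proof.
rewrite /cutoff'; apply: ctsM; first by cts.
by apply: ctsV; [move=> y; rewrite expf_neq0// gt_eqF|cts].
Qed.

Lemma is_derive_cutoff (y : R) : is_derive y (1 : R) cutoff (cutoff' y).
Proof.
have dz : is_derive y (1 : R) (fun y => y * (be - y)) (be - 2 * y).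
  apply: isd_eq (isdM (isd_id y) (isdD (isd_cst y be) (isdN (isd_id y)))) _; ring.
have dz2 := isdX 1 dz.
have dd := @isdV _ y (fun z => (z * (be - z)) ^+ 2 + r ^+ 2) _ (lt0r_neq0 (den0 y))
  (isdD dz2 (isd_cst y (r ^+ 2))).
apply: isd_eq (isdM dz2 dd) _; rewrite /cutoff'.
by field; rewrite gt_eqF.
Qed.

Lemma cutoff_ge0 y : 0 <= cutoff y.
Proof. by rewrite mulr_ge0 ?sqr_ge0// invr_ge0 ltW. Qed.

Lemma cutoff_le1 y : cutoff y <= 1.
Proof. by rewrite ler_pdivrMr// mul1r lerDl sqr_ge0. Qed.

Lemma cutoff_left : cutoff 0 = 0.
Proof. by rewrite /cutoff mul0r expr0n mul0r. Qed.

Lemma cutoff_right : cutoff be = 0.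
Proof. by rewrite /cutoff subrr mulr0 expr0n mul0r. Qed.

(** The three ingredients are |be - 2 y| <= 1, 2 z r <= z^2 + r^2 and r^2 <= z^2 + r^2. *)
Lemma cutoff'_bound y : 0 < y < be -> `|cutoff' y| * r <= 1.
Proof.
move=> /andP[y0 yb]; rewrite /cutoff'.
have : 0 < y * (be - y) by rewrite mulr_gt0// subr_gt0.
have : 0 < (y * (be - y)) ^+ 2 + r ^+ 2 by exact: den0.
move: (y * (be - y)) => z e0 z0.
have z2 : 0 <= 2 * z by rewrite mulr_ge0// ltW.
rewrite normrM normfV (ger0_norm (exprn_ge0 2 (ltW e0))) normrM.
rewrite (ger0_norm (exprn_ge0 2 (ltW r0))) normrM (ger0_norm z2).
have b1 : `|be - 2 * y| <= 1 by have be1' := be1; rewrite ler_norml; lra.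
rewrite mulrAC ler_pdivrMr ?exprn_gt0// mul1r.
apply: (@le_trans _ _ ((2 * (z * r)) * r ^+ 2)).
  rewrite (_ : 2 * z * _ * r ^+ 2 * r = `|be - 2 * y| * (2 * (z * r) * r ^+ 2)); last by ring.
  by rewrite ler_piMl// !mulr_ge0// ltW.
rewrite [leRHS]expr2; apply: ler_pM.
- by rewrite !mulr_ge0// ltW.
- by rewrite exprn_ge0// ltW.
- by have := sqr_ge0 (z - r); lra.
- by rewrite lerDr sqr_ge0.
Qed.

(** One of y and be - y is at least be / 2 >= 1/4 and the other at least r, so z >= r/4 and z^2 /
    (z^2 + r^2) >= 1/17. *)
Lemma cutoff_lower y : 1 / 2 <= be -> r <= y -> r <= be - y -> 1 / 17 <= cutoff y.
Proof.
move=> be2 ry rb; have r0' := r0; rewrite /cutoff; set z := y * (be - y).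
have z4 : r / 4 <= z.
  have [yle|ylt] := leP y (be / 2).
    have : r * (1 / 4) <= y * (be - y) by apply: ler_pM; lra.
    rewrite /z; lra.
  have : (1 / 4) * r <= y * (be - y) by apply: ler_pM; lra.
  rewrite /z; lra.
have z16 : r ^+ 2 / 16 <= z ^+ 2.
  have -> : r ^+ 2 / 16 = (r / 4) ^+ 2 by field.
  by rewrite lerXn2r ?nnegrE//; lra.
rewrite ler_pdivlMr; last by exact: den0.
lra.
Qed.

End cutoff.

(** * Weights that give the combined increment of b a sign *)

Section weights.
Context {R : realType}.
Variables (n : nat) (G : nat -> R -> R) (K c0 : R) (c : 'I_n -> 'I_n -> R).
Hypotheses (cG : forall k, continuous (G k))
  (dG : forall k (z : R), 0 < z < 1 -> is_derive z (1 : R) (G k) (G k.+1 z))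
  (K0 : 0 <= K) (GK : forall k z, (k <= n.+1)%N -> `|G k z| <= K)
  (c00 : 0 < c0) (Gc : forall z, c0 <= \sum_(j < n) G j.+1 z ^+ 2).
Hypothesis cE : forall j k : 'I_n,
  \sum_(i < n) c j i * (i.+1%:R ^+ k.+1 / (k.+1)`!%:R) = (j == k)%:R.
Variable r : R.
Hypotheses (r0 : 0 < r) (r1 : r <= 1).

(** [A j] is, up to a factorial, the Taylor term of order j + 1 at scale r, and q, the root of Q, is
    the size of all of them together. Comparing everything with q makes the degeneracy of b
    cancel. *)
Let A (j : nat) y := r ^+ j.+1 * G j.+1 y.
Let A' (j : nat) y := r ^+ j.+1 * G j.+2 y.
Let Q y := \sum_(j < n) A j y ^+ 2.
Let Q' y := \sum_(j < n) 2 * A j y * A' j y.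
Let T i y := \sum_(j < n) c j i * A j y.
Let T' i y := \sum_(j < n) c j i * A' j y.
Let be := 1 - n%:R * r.
Let q y := Num.sqrt (Q y).
Let cmin := Num.sqrt c0.
Let csum := \sum_(j < n) \sum_(i < n) `|c j i|.
Let L := 1 + K / cmin.

Let cmin0 : 0 < cmin. Proof. by rewrite sqrtr_gt0. Qed.

(** Since r <= 1, every factor r^(j+1) is at least r^n. *)
Lemma Q_lower y : c0 * r ^+ n ^+ 2 <= Q y.
Proof.
apply: (@le_trans _ _ (r ^+ n ^+ 2 * \sum_(j < n) G j.+1 y ^+ 2)).
  by rewrite mulrC ler_wpM2l// exprn_ge0// exprn_ge0// ltW.
rewrite mulr_sumr; apply: ler_sum => j _.
rewrite /A exprMn ler_wpM2r ?sqr_ge0// lerXn2r ?nnegrE ?exprn_ge0 ?(ltW r0)//.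
by rewrite ler_wiXn2l// ltW.
Qed.

Lemma Q_gt0 y : 0 < Q y.
Proof. by apply: lt_le_trans (Q_lower y); rewrite mulr_gt0// !exprn_gt0. Qed.

Lemma q_gt0 y : 0 < q y. Proof. by rewrite sqrtr_gt0 Q_gt0. Qed.

Lemma q_sqr y : q y ^+ 2 = Q y. Proof. by rewrite sqr_sqrtr// ltW// Q_gt0. Qed.

Lemma q_lower y : cmin * r ^+ n <= q y.
Proof.
have rn0 : 0 <= r ^+ n by rewrite exprn_ge0// ltW.
rewrite /cmin /q -(ger0_norm rn0) -sqrtr_sqr -sqrtrM; last exact: ltW.
by apply: ler_wsqrtr; exact: Q_lower.
Qed.

Lemma A_le_q (j : 'I_n) y : `|A j y| <= q y.
Proof.
rewrite -sqrtr_sqr ler_wsqrtr// /Q (bigD1 j)//= lerDl.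
by apply: sumr_ge0 => i _; exact: sqr_ge0.
Qed.

Lemma rn_le_q y : r ^+ n <= q y / cmin.
Proof. by rewrite ler_pdivlMr// mulrC q_lower. Qed.

Lemma L_ge1 : 1 <= L.
Proof. by rewrite /L lerDl divr_ge0// ltW. Qed.

(** r A'_j is the next term A_(j+1). At the last index it contains the derivative of order n + 1;
    there it is at most K r^n, and r^n <= q / cmin. *)
Lemma A'_bound (j : 'I_n) y : `|A' j y| * r <= L * q y.
Proof.
have q0 := ltW (q_gt0 y).
have rE : `|A' j y| * r = `|r ^+ j.+2 * G j.+2 y|.
  by rewrite /A' [in RHS]exprSr mulrAC [RHS]normrM (gtr0_norm r0).
have [jn|jn] := ltnP j.+1 n.
  rewrite rE; apply: (le_trans (A_le_q (Ordinal jn) y)).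
  by rewrite ler_peMl// L_ge1.
have jE : j.+1 = n by apply/eqP; rewrite eqn_leq jn andbT.
have e1 : `|r ^+ n.+1| <= r ^+ n.
  by rewrite ger0_norm ?exprn_ge0 ?(ltW r0)// exprSr ler_piMr// exprn_ge0// ltW.
rewrite rE jE normrM.
apply: (le_trans (ler_pM (normr_ge0 _) (normr_ge0 _) e1 (GK y (leqnn _)))).
apply: (le_trans (ler_wpM2r K0 (rn_le_q y))).
by rewrite mulrDl mul1r mulrAC -[K / cmin * _]mulrAC [q y * K]mulrC lerDr.
Qed.

Lemma Q'_bound y : `|Q' y| * r <= 2 * n%:R * L * Q y.
Proof.
rewrite -q_sqr; apply: (@le_trans _ _ (\sum_(j < n) 2 * `|A j y| * (`|A' j y| * r))).
  rewrite -[leRHS](_ : (\sum_(j < n) 2 * `|A j y| * `|A' j y|) * r = _); last first.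
    by rewrite mulr_suml; apply: eq_bigr => j _; rewrite mulrA.
  rewrite ler_wpM2r ?(ltW r0)//; apply: (le_trans (ler_norm_sum _ _ _)).
  by apply: ler_sum => j _; rewrite !normrM ger0_norm.
rewrite (_ : 2 * n%:R * L * q y ^+ 2 = \sum_(j < n) 2 * q y * (L * q y)); last first.
  by rewrite sumr_const card_ord -mulr_natl; ring.
apply: ler_sum => j _; apply: ler_pM.
- by rewrite mulr_ge0.
- by rewrite mulr_ge0// ltW.
- by rewrite ler_wpM2l// A_le_q.
- exact: A'_bound.
Qed.

Lemma c_le_csum (i : 'I_n) : \sum_(j < n) `|c j i| <= csum.
Proof.
apply: ler_sum => j _; rewrite (bigD1 i)//= lerDl.
by apply: sumr_ge0.
Qed.

Lemma csum_ge0 : 0 <= csum.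
Proof. by apply: sumr_ge0 => j _; apply: sumr_ge0. Qed.

Lemma T_bound (i : 'I_n) y : `|T i y| <= csum * q y.
Proof.
apply: (le_trans (ler_norm_sum _ _ _)).
apply: (@le_trans _ _ (\sum_(j < n) `|c j i| * q y)).
  by apply: ler_sum => j _; rewrite normrM ler_wpM2l// A_le_q.
by rewrite -mulr_suml; apply: ler_wpM2r; [exact: ltW (q_gt0 y)|exact: c_le_csum].
Qed.

Lemma T'_bound (i : 'I_n) y : `|T' i y| * r <= csum * L * q y.
Proof.
apply: (@le_trans _ _ ((\sum_(j < n) `|c j i * A' j y|) * r)).
  by rewrite ler_wpM2r ?(ltW r0)// ler_norm_sum.
rewrite mulr_suml; apply: (@le_trans _ _ (\sum_(j < n) `|c j i| * (L * q y))).
  by apply: ler_sum => j _; rewrite normrM -mulrA ler_wpM2l// A'_bound.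
rewrite -mulr_suml -mulrA ler_wpM2r ?c_le_csum// mulr_ge0 ?(ltW (q_gt0 y))//.
exact: le_trans L_ge1.
Qed.


(** The sum over i of [T i] times b(y + s i) - b(y) is about Q, so division by Q normalizes it. The
    factor r^n keeps the weights bounded uniformly in r, because |T| <= csum q and q >= cmin r^n. *)
Definition weight i y := - (r ^+ n * cutoff r be y * T i y * (Q y)^-1).
Definition weight' i y := - (r ^+ n * (cutoff' r be y * T i y * (Q y)^-1 + cutoff r be y * T' i y * (Q y)^-1 -
  cutoff r be y * T i y * Q' y * (Q y) ^- 2)).
Let s (i : nat) := i.+1%:R * r.

Lemma weight_cts i : continuous (weight i).
Proof.
have cc := @cutoff_cts R r be r0.
apply: ctsN; apply: ctsM; first by rewrite /T /A; cts.
by apply: ctsV; [move=> y; rewrite gt_eqF// Q_gt0|rewrite /Q /A; cts].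
Qed.

Lemma weight'_cts i : continuous (weight' i).
Proof.
have cc := @cutoff_cts R r be r0; have cc' := @cutoff'_cts R r be r0.
have cQ : continuous Q by rewrite /Q /A; cts.
have cQ' : continuous Q' by rewrite /Q' /A /A'; cts.
have cT : continuous (T i) by rewrite /T /A; cts.
have cT' : continuous (T' i) by rewrite /T' /A'; cts.
have cV : continuous (fun y => (Q y)^-1) by apply: ctsV => // y; rewrite gt_eqF// Q_gt0.
have cV2 : continuous (fun y => (Q y) ^- 2).
  by apply: ctsV; [move=> y; rewrite expf_neq0// gt_eqF// Q_gt0|exact: ctsX].
apply: ctsN; apply: ctsM; first by cts.
by apply: ctsD; [apply: ctsD|apply: ctsN]; apply: ctsM => //; cts.
Qed.

Lemma is_derive_weight i (y : R) : 0 < y < 1 -> is_derive y (1 : R) (weight i) (weight' i y).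
Proof.
move=> y01.
have dA (j : nat) : is_derive y (1 : R) (A j) (A' j y) by apply: isdZ; exact: dG.
have dT : is_derive y (1 : R) (T i) (T' i y) by apply: isd_sum => j; exact: isdZ.
have dQ : is_derive y (1 : R) Q (Q' y).
  apply: isd_sum => j.
  by apply: isd_eq (isdX 1 (dA j)) _; rewrite expr1; ring.
have Q0 := Q_gt0 y.
have dc := is_derive_cutoff be r0 y.
have dV := @isdV _ y Q _ (lt0r_neq0 Q0) dQ.
apply: isd_eq (isdN (isdM (isdM (isdZ (r ^+ n) dc) dT) dV)) _.
by rewrite /weight'; field; rewrite gt_eqF.
Qed.

Lemma weight_left i : weight i 0 = 0.
Proof. by rewrite /weight cutoff_left mulr0 !mul0r oppr0. Qed.

Lemma weight_right i : weight i be = 0.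
Proof. by rewrite /weight cutoff_right mulr0 !mul0r oppr0. Qed.

Lemma norm_cutoff y : `|cutoff r be y| <= 1.
Proof. by rewrite ger0_norm ?cutoff_le1 ?cutoff_ge0. Qed.

Lemma weight_bound (i : 'I_n) y : `|weight i y| <= csum / cmin.
Proof.
have q0 := q_gt0 y; have rn0 : 0 <= r ^+ n by rewrite exprn_ge0// ltW.
rewrite /weight normrN -q_sqr; have := T_bound i y; have := norm_cutoff y.
move: (cutoff r be y) (T i y) => ch t hch ht.
rewrite normrM normfV (ger0_norm (sqr_ge0 (q y))) !normrM (ger0_norm rn0).
rewrite ler_pdivrMr ?exprn_gt0//.
apply: (@le_trans _ _ (q y / cmin * 1 * (csum * q y))).
  apply: ler_pM => //; first by rewrite mulr_ge0.
  by apply: ler_pM => //; exact: rn_le_q.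
by rewrite le_eqVlt; apply/orP; left; apply/eqP; field; rewrite gt_eqF.
Qed.

(** Differentiating the cutoff, T or Q costs 1/r relative to that factor; the three contributions
    are 1, L and 2 n L. *)
Lemma weight'_bound (i : 'I_n) y : 0 < y < be -> be <= 1 -> 0 <= be ->
  `|weight' i y| * r <= csum / cmin * (1 + L + 2 * n%:R * L).
Proof.
move=> yb be1 be0.
have q0 := q_gt0 y; have rn0 : 0 <= r ^+ n by rewrite exprn_ge0// ltW.
have cs0 := csum_ge0; have L1 := L_ge1; have L0 : 0 <= L by exact: le_trans L1.
have qn0 : q y != 0 by rewrite gt_eqF.
have q20 : 0 < q y ^+ 2 by rewrite exprn_gt0.
have P1 : `|cutoff' r be y * T i y * (Q y)^-1| * r <= csum / q y.
  have := T_bound i y; have := cutoff'_bound r0 be1 yb.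
  rewrite -q_sqr; move: (cutoff' r be y) (T i y) => ch t hch ht.
  rewrite normrM normfV (gtr0_norm q20) !normrM mulrAC ler_pdivrMr//.
  rewrite mulrAC (_ : csum / q y * q y ^+ 2 = 1 * (csum * q y)); last by field.
  by apply: ler_pM => //; rewrite mulr_ge0// ltW.
have P2 : `|cutoff r be y * T' i y * (Q y)^-1| * r <= csum * L / q y.
  have := T'_bound i y; have := norm_cutoff y.
  rewrite -q_sqr; move: (cutoff r be y) (T' i y) => ch t hch ht.
  rewrite normrM normfV (gtr0_norm q20) !normrM mulrAC ler_pdivrMr//.
  rewrite (_ : csum * L / q y * q y ^+ 2 = 1 * (csum * L * q y)); last by field.
  rewrite -[leLHS]mulrA.
  by apply: ler_pM => //; rewrite mulr_ge0// ltW.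
have P3 : `|cutoff r be y * T i y * Q' y * (Q y) ^- 2| * r <= csum * (2 * n%:R * L) / q y.
  have := Q'_bound y; have := T_bound i y; have := norm_cutoff y.
  rewrite -q_sqr; move: (cutoff r be y) (T i y) (Q' y) => ch t Qd hch ht hQ.
  rewrite normrM normfV (gtr0_norm (exprn_gt0 2 q20)) mulrAC ler_pdivrMr ?exprn_gt0//.
  rewrite !normrM -(mulrA (`|ch| * `|t|)).
  rewrite (_ : csum * (2 * n%:R * L) / q y * (q y ^+ 2) ^+ 2 =
    1 * (csum * q y) * (2 * n%:R * L * q y ^+ 2)); last by field.
  apply: ler_pM; [exact: mulr_ge0|by apply: mulr_ge0; [|exact: ltW]| |exact: hQ].
  exact: ler_pM.
rewrite /weight' normrN normrM (ger0_norm rn0).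
apply: (@le_trans _ _ (q y / cmin * (csum / q y + csum * L / q y + csum * (2 * n%:R * L) / q y))).
  rewrite -(mulrA (r ^+ n)); apply: ler_pM => //; [by rewrite mulr_ge0// ltW|exact: rn_le_q|].
  apply: (le_trans (ler_wpM2r (ltW r0) (le_trans (ler_normB _ _) (lerD (ler_normD _ _) (lexx _))))).
  by rewrite [leLHS]mulrDl [X in X + _ <= _]mulrDl; apply: lerD => //; apply: lerD.
by rewrite le_eqVlt; apply/orP; left; apply/eqP; field; rewrite qn0 gt_eqF.
Qed.

(* The constant term of the Taylor expansion cancels. *)
Lemma increment_taylor (i : 'I_n) y : 0 < y -> y + s i < 1 ->
  `|(G 0%N (y + s i) - G 0%N y) - \sum_(j < n) i.+1%:R ^+ j.+1 / (j.+1)`!%:R * A j y| <=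
  K * n%:R ^+ n.+1 * r ^+ n.+1.
Proof.
move=> y0 ys1.
have si0 : 0 <= s i by rewrite mulr_ge0// ltW.
have := @taylor_remainder R n.+1 G K y (s i) cG dG (fun z => GK z (leqnn _)) y0 si0 ys1.
rewrite big_ord_recl /= fact0 expr0 divr1 mul1r opprD addrA.
rewrite (eq_bigr (fun j : 'I_n => i.+1%:R ^+ j.+1 / (j.+1)`!%:R * A j y)); last first.
  by move=> j _; rewrite /= /A /s exprMn; ring.
move=> H; apply: (le_trans H); rewrite -mulrA -exprMn; apply: ler_wpM2l => //.
rewrite lerXn2r ?nnegrE ?mulr_ge0 ?(ltW r0)//.
by rewrite ler_wpM2r ?(ltW r0)// ler_nat.
Qed.

(** A bound by q, and not merely by r, is what the quotient T / Q of size 1 / q can absorb. *)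
Lemma increment_bound (i : 'I_n) y : 0 < y -> y + s i < 1 ->
  `|G 0%N (y + s i) - G 0%N y| <= (n%:R * n%:R ^+ n + K * n%:R ^+ n.+1 / cmin) * q y.
Proof.
move=> y0 ys1; have q0 := ltW (q_gt0 y).
rewrite -(subrK (\sum_(j < n) i.+1%:R ^+ j.+1 / (j.+1)`!%:R * A j y)
  (G 0%N (y + s i) - G 0%N y)).
apply: (le_trans (ler_normD _ _)); rewrite addrC mulrDl; apply: lerD.
  apply: (le_trans (ler_norm_sum _ _ _)).
  rewrite (_ : n%:R * n%:R ^+ n * q y = \sum_(j < n) n%:R ^+ n * q y); last first.
    by rewrite sumr_const card_ord -[RHS]mulr_natl mulrA.
  apply: ler_sum => j _; rewrite normrM; apply: ler_pM => //; last exact: A_le_q.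
  rewrite ger0_norm ?divr_ge0 ?exprn_ge0//.
  rewrite ler_pdivrMr ?ltr0n ?fact_gt0//.
  apply: (@le_trans _ _ (n%:R ^+ n)); last first.
    by rewrite ler_peMr ?exprn_ge0// ler1n fact_gt0.
  apply: (@le_trans _ _ (n%:R ^+ j.+1)).
    by rewrite lerXn2r ?nnegrE// ler_nat.
  rewrite ler_weXn2l// ler1n; exact: leq_ltn_trans (leq0n j) (ltn_ord j).
apply: (le_trans (increment_taylor y0 ys1)).
rewrite -!mulrA; apply: ler_wpM2l => //; apply: ler_wpM2l; first exact: exprn_ge0.
rewrite mulrC; apply: le_trans (rn_le_q y).
by rewrite exprSr ler_piMr// exprn_ge0// ltW.
Qed.

(** T and the increment are both O(q); their product cancels Q = q^2 and leaves r^n. *)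
Lemma weight_increment_bound (i : 'I_n) y : 0 < y -> y + s i < 1 ->
  `|weight i y * (G 0%N y - G 0%N (y + s i))| <=
  csum * (n%:R * n%:R ^+ n + K * n%:R ^+ n.+1 / cmin) * r ^+ n.
Proof.
move=> y0 ys1; have H := increment_bound y0 ys1.
have q0 := q_gt0 y; have rn0 : 0 <= r ^+ n by rewrite exprn_ge0// ltW.
have q20 : 0 < q y ^+ 2 by rewrite exprn_gt0.
rewrite normrM distrC /weight normrN -q_sqr.
have := T_bound i y; have := norm_cutoff y.
move: (cutoff r be y) (T i y) => ch t hch ht.
rewrite normrM normfV (gtr0_norm q20) !normrM (ger0_norm rn0).
rewrite mulrAC ler_pdivrMr//.
apply: (@le_trans _ _ (r ^+ n * 1 * (csum * q y) *
  ((n%:R * n%:R ^+ n + K * n%:R ^+ n.+1 / cmin) * q y))); last first.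
  by rewrite le_eqVlt; apply/orP; left; apply/eqP; ring.
apply: ler_pM => //; first by rewrite !mulr_ge0.
apply: ler_pM => //; first by rewrite mulr_ge0.
exact: ler_pM.
Qed.

(** The Taylor polynomials contribute exactly r^n times the cutoff. The remainders are O(r^(n+1)) =
    O(r q) and T is O(q), so division by Q leaves a relative error O(r). *)
Lemma weight_sum_lower y : 0 < y -> y + n%:R * r < 1 ->
  r ^+ n * cutoff r be y * (1 - csum * n%:R * K * n%:R ^+ n.+1 / cmin * r) <=
  \sum_(i < n) weight i y * (G 0%N y - G 0%N (y + s i)).
Proof.
move=> y0 ys1; have q0 := q_gt0 y.
have rn0 : 0 <= r ^+ n by rewrite exprn_ge0// ltW.
pose e (i : 'I_n) := (G 0%N (y + s i) - G 0%N y) -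
  \sum_(j < n) i.+1%:R ^+ j.+1 / (j.+1)`!%:R * A j y.
have eB i : `|e i| <= K * n%:R ^+ n.+1 * r ^+ n.+1.
  apply: increment_taylor => //; apply: le_lt_trans ys1.
  by rewrite lerD2l ler_wpM2r ?(ltW r0)// ler_nat.
(* Summing over i first, [cE] makes the double sum over j and k diagonal. *)
have TA : \sum_(i < n) T i y * (\sum_(k < n) i.+1%:R ^+ k.+1 / (k.+1)`!%:R * A k y) = Q y.
  rewrite (eq_bigr (fun i : 'I_n => \sum_(j < n) \sum_(k < n)
     (c j i * (i.+1%:R ^+ k.+1 / (k.+1)`!%:R)) * (A j y * A k y))); last first.
    move=> i _; rewrite /T mulr_suml; apply: eq_bigr => j _.
    by rewrite mulr_sumr; apply: eq_bigr => k _; ring.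
  rewrite exchange_big /=; apply: eq_bigr => j _.
  rewrite exchange_big /= (bigD1 j)//= [X in _ + X]big1 ?addr0; last first.
    by move=> k kj; rewrite -mulr_suml cE eq_sym (negbTE kj) mul0r.
  by rewrite -mulr_suml cE eqxx mul1r expr2.
have -> : \sum_(i < n) weight i y * (G 0%N y - G 0%N (y + s i)) =
    r ^+ n * cutoff r be y * (1 + (\sum_(i < n) T i y * e i) / Q y).
  rewrite (eq_bigr (fun i : 'I_n => r ^+ n * cutoff r be y / Q y *
    (T i y * (\sum_(k < n) i.+1%:R ^+ k.+1 / (k.+1)`!%:R * A k y) + T i y * e i))); last first.
    by move=> i _; rewrite /weight /e; ring.
  rewrite -mulr_sumr big_split /= TA; field.
  by rewrite gt_eqF// Q_gt0.
apply: ler_wpM2l; first by rewrite mulr_ge0// cutoff_ge0.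
rewrite lerD2l lerNl -mulNr ler_pdivrMr ?Q_gt0//.
apply: (le_trans (ler_norm _)); rewrite normrN.
apply: (le_trans (ler_norm_sum _ _ _)).
apply: (@le_trans _ _ (\sum_(i < n) (csum * q y) * (K * n%:R ^+ n.+1 * r ^+ n.+1))).
  apply: ler_sum => i _; rewrite normrM; apply: ler_pM => //; exact: T_bound.
rewrite sumr_const card_ord -[leLHS]mulr_natl -q_sqr (exprSr r n).
rewrite [leLHS](_ : _ = csum * n%:R * K * n%:R ^+ n.+1 * r * q y * r ^+ n); last by ring.
apply: (@le_trans _ _ (csum * n%:R * K * n%:R ^+ n.+1 * r * q y * (q y / cmin))).
  apply: ler_wpM2l; last exact: rn_le_q.
  by rewrite !mulr_ge0 ?exprn_ge0 ?csum_ge0 ?(ltW r0) ?(ltW q0).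
by rewrite le_eqVlt; apply/orP; left; apply/eqP; ring.
Qed.

End weights.

Lemma shear_weights {R : realType} (n : nat) (G : nat -> R -> R) (K c0 : R) :
  (0 < n)%N -> (forall k, continuous (G k)) ->
  (forall k (z : R), 0 < z < 1 -> is_derive z (1 : R) (G k) (G k.+1 z)) ->
  0 <= K -> (forall k z, (k <= n.+1)%N -> `|G k z| <= K) ->
  0 < c0 -> (forall z, c0 <= \sum_(j < n) G j.+1 z ^+ 2) ->
  exists C1 r1 : R, [/\ 0 < C1, 0 < r1, r1 <= 1, 8 * n%:R * r1 <= 1 &
    forall r : R, 0 < r -> r <= r1 -> exists ka dka : 'I_n -> R -> R,
    let be := 1 - n%:R * r in
    [/\ forall i, [/\ continuous (ka i), continuous (dka i),
          forall y : R, 0 < y < 1 -> is_derive y (1 : R) (ka i) (dka i y),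
          ka i 0 = 0 & ka i be = 0],
        forall i y, 0 < y < be -> `|ka i y| <= C1,
        forall i y, 0 < y < be -> `|dka i y| * r <= C1,
        forall i y, 0 < y < be ->
          `|ka i y * (G 0%N y - G 0%N (y + i.+1%:R * r))| <= C1 * r ^+ n &
        (forall y, 0 < y < be ->
          0 <= \sum_(i < n) ka i y * (G 0%N y - G 0%N (y + i.+1%:R * r))) /\
        (forall y, 2 * n%:R * r < y < 1 - 2 * n%:R * r ->
          1 / 34 * r ^+ n <= \sum_(i < n) ka i y * (G 0%N y - G 0%N (y + i.+1%:R * r)))]].
Proof.
move=> n0 cG dG K0 GK c00 Gc.
have [c cE] := @interpolation_coefficients R n.
pose csum := \sum_(j < n) \sum_(i < n) `|c j i|.
pose cmin := Num.sqrt c0; pose L := 1 + K / cmin.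
have cmin0 : 0 < cmin by rewrite sqrtr_gt0.
have cs0 : 0 <= csum by apply: sumr_ge0 => j _; apply: sumr_ge0.
have L0 : 0 <= L by rewrite addr_ge0// divr_ge0// ltW.
have n1 : 1 <= n%:R :> R by rewrite ler1n.
have nn0 : 0 <= n%:R :> R by [].
pose B1 := csum / cmin; pose B2 := csum / cmin * (1 + L + 2 * n%:R * L).
pose B3 := csum * (n%:R * n%:R ^+ n + K * n%:R ^+ n.+1 / cmin).
pose B4 := csum * n%:R * K * n%:R ^+ n.+1 / cmin.
have B10 : 0 <= B1 by rewrite divr_ge0// ltW.
have nL : 0 <= 2 * n%:R * L by apply: mulr_ge0 => //; exact: mulr_ge0.
have B20 : 0 <= B2 by apply: mulr_ge0; [exact: B10|by apply: addr_ge0 => //; apply: addr_ge0].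
have B30 : 0 <= B3.
  by rewrite mulr_ge0// addr_ge0// ?divr_ge0// ?mulr_ge0 ?exprn_ge0// ltW.
have B40 : 0 <= B4 by rewrite divr_ge0 ?mulr_ge0 ?exprn_ge0// ltW.
(* The two summands ensure 8 n r1 <= 1, so that the boundary zones are short, and B4 r1 <= 1/2, so
   that the Taylor error takes at most half of the main term. *)
pose r1 := (8 * n%:R + 2 * B4)^-1.
have den0 : 0 < 8 * n%:R + 2 * B4 by lra.
have r10 : 0 < r1 by rewrite invr_gt0.
have r1E : r1 * (8 * n%:R + 2 * B4) = 1 by rewrite mulVf// gt_eqF.
have r1n : 8 * n%:R * r1 <= 1.
  have := mulr_ge0 (ltW r10) B40; rewrite mulrDr in r1E; lra.
have r1B : B4 * r1 <= 1 / 2.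
  have := mulr_ge0 (ltW r10) nn0; rewrite mulrDr in r1E; lra.
have r11 : r1 <= 1.
  have : 1 * r1 <= n%:R * r1 by rewrite ler_wpM2r// ltW.
  lra.
exists (B1 + B2 + B3 + 1), r1; split => //; first by lra.
move=> r r0 rr1; have r1' : r <= 1 by exact: le_trans r11.
have rn1 : 8 * n%:R * r <= 1.
  by apply: le_trans r1n; rewrite ler_wpM2l// mulr_ge0.
have rB : B4 * r <= 1 / 2 by apply: le_trans r1B; rewrite ler_wpM2l.
have nr0 : 0 < n%:R * r by rewrite mulr_gt0// ltr0n.
have rnr : r <= n%:R * r by rewrite ler_peMl// ltW.
have rpn0 : 0 <= r ^+ n by rewrite exprn_ge0// ltW.
pose be := 1 - n%:R * r.
have be0 : 0 <= be by rewrite /be; lra.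
have be1 : be <= 1 by rewrite /be; lra.
have ys (i : 'I_n) y : 0 < y < be -> 0 < y /\ y + i.+1%:R * r < 1.
  move=> /andP[y0 yb]; split => //.
  have : i.+1%:R * r <= n%:R * r by rewrite ler_wpM2r ?(ltW r0)// ler_nat.
  by rewrite /be in yb; lra.
exists (weight G c r); exists (weight' G c r); split.
- move=> i; split.
  + exact: (@weight_cts R n G c0 c cG c00 Gc r r0 r1' i).
  + exact: (@weight'_cts R n G c0 c cG c00 Gc r r0 r1' i).
  + by move=> y; exact: (is_derive_weight c dG c00 Gc r0 r1' i).
  + exact: weight_left.
  + exact: weight_right.
- move=> i y yb; apply: (le_trans (weight_bound c c00 Gc r0 r1' i y)).
  rewrite -/csum -/cmin -/B1; lra.
- move=> i y yb.
  apply: (le_trans (weight'_bound c K0 GK c00 Gc r0 r1' i yb be1 be0)).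
  rewrite -/csum -/cmin -/L -/B2; lra.
- move=> i y yb; have [y0 y1] := ys i y yb.
  apply: (le_trans (weight_increment_bound c cG dG K0 GK c00 Gc r0 r1' y0 y1)).
  rewrite -/csum -/cmin -/B3 ler_wpM2r//; lra.
have low y : 0 < y < be -> r ^+ n * cutoff r be y * (1 / 2) <=
    \sum_(i < n) weight G c r i y * (G 0%N y - G 0%N (y + i.+1%:R * r)).
  move=> /andP[y0 yb]; have y1 : y + n%:R * r < 1 by rewrite /be in yb; lra.
  apply: le_trans (weight_sum_lower cG dG K0 GK c00 Gc cE r0 r1' y0 y1).
  rewrite -/csum -/cmin -/B4; apply: ler_wpM2l; first by apply: mulr_ge0 => //; exact: cutoff_ge0.
  lra.
split => y yb.
  apply: le_trans (low y yb); apply: mulr_ge0 => //.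
  by apply: mulr_ge0 => //; exact: cutoff_ge0.
have /andP[ya yc] := yb.
have yb' : 0 < y < be by rewrite /be; lra.
apply: le_trans (low y yb').
(* Together with the factor 1/2 in [low], this yields 1/34. *)
have cl : 1 / 17 <= cutoff r be y by apply: cutoff_lower => //; rewrite /be; lra.
have := ler_wpM2l rpn0 cl; lra.
Qed.

(** * Exponential decay of the energy of a shear flow *)

Lemma exp_decay {R : realType} (E : R -> R) (t0 rho C : R) : 0 < rho -> 0 < C ->
  (forall t, t0 <= t -> 0 <= E t) ->
  (forall a c, t0 <= a -> a <= c -> E c <= E a) ->
  (forall a c, t0 <= a -> a <= c -> rho * (c - a) * E c <= C * E a) ->
  forall t, t0 <= t -> E t <= expR 1 * expR (- (rho * (t - t0) / (expR 1 * C))) * E t0.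
Proof.
move=> rho0 C0 E0 Emono Eint t t0t.
have e0 : 0 < expR 1 :> R := expR_gt0 1.
(* After a time tau = e C / rho the hypothesis gives a reduction by the factor e. Monotonicity
   covers the last incomplete step, at the cost of the factor e in front. *)
pose tau := expR 1 * C / rho.
have tau0 : 0 < tau by rewrite divr_gt0// mulr_gt0.
have step (k : nat) : E (t0 + k%:R * tau) <= expR (- k%:R) * E t0.
  elim: k => [|k IH]; first by rewrite mul0r addr0 oppr0 expR0 mul1r.
  have tk : t0 <= t0 + k%:R * tau by rewrite lerDl mulr_ge0// ltW.
  have tk1 : t0 + k%:R * tau <= t0 + k.+1%:R * tau.
    by rewrite lerD2l ler_wpM2r ?(ltW tau0)// ler_nat.
  have := Eint _ _ tk tk1.
  rewrite (_ : rho * _ = expR 1 * C); last first.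
    by rewrite -(natr1 k) /tau; field; rewrite gt_eqF.
  rewrite (mulrC (expR 1)) -mulrA ler_pM2l// => H.
  have -> : expR (- k.+1%:R) = expR (- k%:R) / expR 1 :> R.
    by rewrite -natr1 opprD expRD (expRN 1).
  rewrite mulrAC ler_pdivlMr// [leLHS]mulrC.
  exact: (le_trans H IH).
have xge0 : 0 <= (t - t0) / tau by rewrite divr_ge0 ?subr_ge0// ltW.
have /andP[k1 k2] := truncn_itv xge0.
set k := Num.truncn _ in k1 k2.
have tk : t0 + k%:R * tau <= t.
  by rewrite -lerBrDl -ler_pdivlMr.
apply: (le_trans (Emono _ _ _ tk)); first by rewrite lerDl mulr_ge0// ltW.
apply: (le_trans (step k)); rewrite ler_wpM2r ?E0//.
rewrite -expRD ler_expR.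
have -> : rho * (t - t0) / (expR 1 * C) = (t - t0) / tau.
  by rewrite /tau; field; rewrite !gt_eqF.
by rewrite -natr1 in k2; lra.
Qed.

(** W yields rho E / 136, where 136 = 4 * 34, and eta makes 3 n C1 eta equal to 1/272; half of the
    gain survives. *)
Lemma coercive_rate {R : realType} (W n C1 eta rho S i E nuD P X r2 : R) :
  0 < n -> 0 < C1 -> eta = (816 * n * C1)^-1 ->
  rho * E <= 4 * (rho * P) + 16 * n ^+ 2 * nuD ->
  rho * P <= 34 * W ->
  W - n * (3 * C1 * eta * (rho * E) + S * nuD) <= X ->
  rho * E / 272 - (16 * n ^+ 2 / 136 + n * S) * nuD <= X.
Proof.
move=> n0 C10 etaE H1 H2.
have -> : n * (3 * C1 * eta * (rho * E) + S * nuD) = rho * E / 272 + n * S * nuD.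
  by rewrite etaE; field; rewrite !gt_eqF.
lra.
Qed.

(** Because W >= 0, the part of the integral outside (d, 1 - d) may be dropped. *)
Lemma weighted_lower_bound {R : realType} (u : R -> R -> R) (W : R -> R) (rho d be : R) :
  0 <= d -> d <= 1 - d -> 1 - d <= be ->
  continuous (fun p : R * R => u p.1 p.2) -> continuous W ->
  (forall y, 0 < y < be -> 0 <= W y) ->
  (forall y, d < y < 1 - d -> 1 / 34 * rho <= W y) ->
  rho * itg 0 1 (fun x => itg d (1 - d) (fun y => u x y ^+ 2)) <=
  34 * itg 0 1 (fun x => itg 0 be (fun y => W y * u x y ^+ 2)).
Proof.
move=> d0 dd db cu cW W0 Wl.
have be0 : 0 <= be by exact: le_trans d0 (le_trans dd db).
have Wl' y : d < y < 1 - d -> rho <= 34 * W y by move=> /Wl; lra.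
rewrite -itgZ; last by cts.
rewrite -itgZ; last by cts.
apply: itg_le; [by cts|by cts|move=> x _].
rewrite -itgZ; last by cts.
rewrite -itgZ; last by cts.
apply: (@le_trans _ _ (itg d (1 - d) (fun y => 34 * (W y * u x y ^+ 2)))).
  apply: itg_le; [by cts|by cts|move=> y yd].
  by rewrite mulrA; apply: ler_wpM2r; [exact: sqr_ge0|exact: Wl'].
apply: itg_sub; [exact: d0|exact: dd|exact: db|by cts|move=> y yb].
by apply: mulr_ge0 => //; apply: mulr_ge0; [exact: W0|exact: sqr_ge0].
Qed.

Lemma itg_ge_cst {R : realType} (a c k : R) (u : R -> R) : a <= c -> continuous u ->
  (forall t, a < t < c -> k <= u t) -> (c - a) * k <= itg a c u.
Proof.
move=> ac cu ku; rewrite mulrC -itg_cst//; apply: itg_le => //; exact: cts_cst.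
Qed.

Lemma difference_bound {R : realType} (ja jc k ea ec : R) :
  `|ja| <= k * ea -> `|jc| <= k * ec -> k * ec <= k * ea -> jc - ja <= 2 * (k * ea).
Proof. by rewrite !ler_norml => /andP[? ?] /andP[? ?]; lra. Qed.

(** The energy identity bounds 2 nu id by ea, which accounts for the summand C4 / 2. *)
Lemma absorb_dissipation {R : realType} (rho C4 nu k ie id j ea x : R) :
  rho / 272 * ie - C4 * nu * id <= j -> j <= 2 * (k * ea) -> x <= rho * ie ->
  C4 * (2 * nu * id) <= C4 * ea -> x <= 272 * (2 * k + C4 / 2) * ea.
Proof. lra. Qed.

Section flow_decay.
Context {R : realType}.
Variables (n : nat) (C1 r nu t0 : R) (b : R -> R) (f ft fx fy fyy : R -> R -> R -> R).
Variables (ka dka : 'I_n -> R -> R).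
Hypotheses (n0 : (0 < n)%N) (C10 : 0 < C1) (r0 : 0 < r) (nr : 8 * n%:R * r <= 1)
  (nuE : nu = r ^+ n * r ^+ 2).
Hypothesis F : shear_flow t0 nu b f ft fx fy fyy.
Hypothesis mean0 : forall t y : R, t0 < t -> 0 < y < 1 -> itg 0 1 (fun x => f t x y) = 0.
Let be := 1 - n%:R * r.
Let s (i : 'I_n) := i.+1%:R * r.
Hypothesis wcts : forall i, [/\ continuous (ka i), continuous (dka i),
  forall y : R, 0 < y < 1 -> is_derive y (1 : R) (ka i) (dka i y),
  ka i 0 = 0 & ka i be = 0].
Hypothesis wB : forall i y, 0 < y < be -> `|ka i y| <= C1.
Hypothesis wdB : forall i y, 0 < y < be -> `|dka i y| * r <= C1.
Hypothesis wKB : forall i y, 0 < y < be -> `|ka i y * (b y - b (y + s i))| <= C1 * r ^+ n.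
Hypothesis wpos : forall y, 0 < y < be -> 0 <= \sum_(i < n) ka i y * (b y - b (y + s i)).
Hypothesis wlow : forall y, 2 * n%:R * r < y < 1 - 2 * n%:R * r ->
  1 / 34 * r ^+ n <= \sum_(i < n) ka i y * (b y - b (y + s i)).

Let cb := sf_cb F.
Let cf := sf_cf F.
Let cft := sf_cft F.
Let cfx := sf_cfx F.
Let cfy := sf_cfy F.
Let cfyy := sf_cfyy F.
Let rho := r ^+ n.
Let E t := itg 0 1 (fun x => itg 0 1 (fun y => f t x y ^+ 2)).
Let D t := itg 0 1 (fun x => itg 0 1 (fun y => fy t x y ^+ 2)).
Let J t := \sum_(i < n) itg 0 1 (fun w => (w - 1 / 2) * pairing 0 be (s i) w (ka i) (f t)).
Let rate t := \sum_(i < n) itg 0 1 (fun w => (w - 1 / 2) *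
  pairing_rate nu 0 be (s i) w b (ka i) (dka i) (f t) (fx t) (fy t)).
Let eta := (816 * n%:R * C1)^-1.
(** The coefficient of nu D in [rate_lower_bound] for shifts up to n r; [C4] sums it over the n
    shifts and adds the loss from the boundary layer. *)
Let S := C1 * (n%:R ^+ 2 / (2 * eta) + 1 / (2 * eta) + 2).
Let C4 := 16 * n%:R ^+ 2 / 136 + n%:R * S.

Let cka i : continuous (ka i). Proof. by have [] := wcts i. Qed.
Let cdka i : continuous (dka i). Proof. by have [] := wcts i. Qed.
Let cE : continuous E. Proof. by rewrite /E; cts. Qed.
Let cD : continuous D. Proof. by rewrite /D; cts. Qed.

Let n1 : 1 <= n%:R :> R. Proof. by rewrite ler1n. Qed.
Let rho0 : 0 < rho. Proof. by rewrite exprn_gt0. Qed.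
Let nu0 : 0 < nu. Proof. by rewrite nuE mulr_gt0 ?exprn_gt0. Qed.
Let eta0 : 0 < eta. Proof. by rewrite invr_gt0 !mulr_gt0 ?ltr0n. Qed.
Let nr0 : 0 < n%:R * r. Proof. by rewrite mulr_gt0 ?ltr0n. Qed.
Let be0 : 0 <= be. Proof. by have := nr; have := nr0; rewrite /be; lra. Qed.
Let be1 : be <= 1. Proof. by have := nr0; rewrite /be; lra. Qed.
Let s0 i : 0 <= s i. Proof. by rewrite mulr_ge0// ltW. Qed.
Let sn i : s i <= n%:R * r. Proof. by rewrite ler_wpM2r ?(ltW r0)// ler_nat. Qed.
Let bes i : be + s i <= 1. Proof. by have := sn i; rewrite /be; lra. Qed.

Lemma E_pairing t : pairing 0 1 0 0 (fun=> 1) (f t) = E t.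
Proof.
rewrite /pairing /E; congr itg; apply/funext => x; congr itg; apply/funext => y.
by rewrite !addr0 mul1r expr2.
Qed.

Lemma D_pairing t : pairing 0 1 0 0 (fun=> 1) (fy t) = D t.
Proof.
rewrite /pairing /D; congr itg; apply/funext => x; congr itg; apply/funext => y.
by rewrite !addr0 mul1r expr2.
Qed.

Lemma E_ge0 t : 0 <= E t.
Proof.
apply: itg_ge0; first by cts.
by move=> x _; apply: itg_ge0; [cts|move=> y _; exact: sqr_ge0].
Qed.

Lemma D_ge0 t : 0 <= D t.
Proof.
apply: itg_ge0; first by cts.
by move=> x _; apply: itg_ge0; [cts|move=> y _; exact: sqr_ge0].
Qed.

Lemma energy_dissipation a c : t0 <= a -> a <= c ->
  E c + 2 * nu * itg a c D = E a.
Proof.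
move=> t0a ac; have := energy_identity F t0a ac.
by rewrite !E_pairing; under eq_fun do rewrite D_pairing.
Qed.

Lemma energy_monotone a c : t0 <= a -> a <= c -> E c <= E a.
Proof.
move=> t0a ac; rewrite -(energy_dissipation t0a ac) lerDl.
rewrite mulr_ge0//; first by rewrite mulr_ge0// ltW.
by apply: itg_ge0 => // t _; exact: D_ge0.
Qed.

Lemma J_evolution a c : t0 <= a -> a <= c -> J c - J a = itg a c rate.
Proof.
move=> t0a ac; rewrite /J /rate itg_sum; last by move=> i; rewrite /pairing_rate; cts.
rewrite -sumrB; apply: eq_bigr => i _; have [_ _ dk k0 k1] := wcts i.
apply: (@weighted_pairing_evolution R t0 nu b f ft fx fy fyy F (fun w => w - 1 / 2)) => //.
- by rewrite add0r.
- by cts.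
- by move=> y /andP[y0 yb]; apply: dk; rewrite y0 (lt_le_trans yb be1).
(* Both boundary terms vanish with the weights, whatever f does there. *)
- by move=> t x w _; rewrite k0 k1 !mul0r.
Qed.

(** J has no sign; its size is controlled through 2 |p q| <= p^2 + q^2, with p and q the values at
    the two points of the correlation. *)
Lemma J_bound t : t0 < t -> `|J t| <= n%:R * C1 * E t.
Proof.
move=> t0t; apply: (le_trans (ler_norm_sum _ _ _)).
rewrite -mulrA mulr_natl -[n in leRHS]card_ord -sumr_const; apply: ler_sum => i _.
pose g x y := C1 * (1 / 2) * f t x y ^+ 2.
have cg : continuous (fun p : R * R => g p.1 p.2) by rewrite /g; cts.
have g0 x y : 0 <= g x y by rewrite /g mulr_ge0 ?sqr_ge0// mulr_ge0// ltW.
have H : itg 0 1 (fun w => itg 0 1 (fun x => itg 0 be (fun y => g x y + g (x + w) (y + s i)))) <=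
    C1 * E t.
  have gE : itg 0 1 (fun x => itg 0 1 (g x)) = C1 * (1 / 2) * E t.
    rewrite /g /E -itgZ; last by cts.
    by congr itg; apply/funext => x; rewrite -itgZ; last by cts.
  have H1 : itg 0 1 (fun w => itg 0 1 (fun x => itg 0 be (fun y => g (x + w) (y + s i)))) <=
      C1 * (1 / 2) * E t.
    rewrite -gE; apply: sheared_shift_bound => //.
    by move=> x y y01; rewrite /g (sf_per F).
  have H2 : itg 0 1 (fun x => itg 0 be (g x)) <= C1 * (1 / 2) * E t.
    rewrite -gE; apply: itg_le; [by cts|by cts|move=> x _].
    by apply: itg_sub => //; cts.
  have -> : itg 0 1 (fun w => itg 0 1 (fun x => itg 0 be (fun y => g x y + g (x + w) (y + s i)))) =
     itg 0 1 (fun x => itg 0 be (g x)) +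
     itg 0 1 (fun w => itg 0 1 (fun x => itg 0 be (fun y => g (x + w) (y + s i)))).
    have <- : itg 0 1 (fun _ : R => itg 0 1 (fun x => itg 0 be (g x))) =
        itg 0 1 (fun x => itg 0 be (g x)) by rewrite itg_cst ?ler01// subr0 mulr1.
    rewrite -itgD; [|by cts|by cts].
    congr itg; apply/funext => w; rewrite -itgD; [|by cts|by cts].
    by congr itg; apply/funext => x; rewrite -itgD; [|by cts|by cts].
  rewrite (_ : C1 * E t = C1 * (1 / 2) * E t + C1 * (1 / 2) * E t); last by field.
  exact: (lerD H2 H1).
have pt w x y : 0 < w < 1 -> 0 < y < be ->
    `|(w - 1 / 2) * (ka i y * (f t x y * f t (x + w) (y + s i)))| <= g x y + g (x + w) (y + s i).
  move=> w01 yb; rewrite normrM -[leRHS]mul1r; apply: ler_pM => //; first exact: half_shift_le1.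
  rewrite /g -mulrDr normrM -mulrA; apply: ler_pM => //; first exact: wB.
  rewrite normrM -(real_normK (num_real (f t x y))) -(real_normK (num_real (f t (x + w) _))).
  move: `|_| `|_| => p q; have := sqr_ge0 (p - q); lra.
have ptN w x y : 0 < w < 1 -> 0 < y < be ->
   - (g x y + g (x + w) (y + s i)) <= (w - 1 / 2) * (ka i y * (f t x y * f t (x + w) (y + s i))).
  by move=> w01 yb; have := pt w x y w01 yb; rewrite ler_norml => /andP[].
have ptP w x y : 0 < w < 1 -> 0 < y < be ->
   (w - 1 / 2) * (ka i y * (f t x y * f t (x + w) (y + s i))) <= g x y + g (x + w) (y + s i).
  by move=> w01 yb; have := pt w x y w01 yb; rewrite ler_norml => /andP[].
have JE : itg 0 1 (fun w => (w - 1 / 2) * pairing 0 be (s i) w (ka i) (f t)) =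
   itg 0 1 (fun w => itg 0 1 (fun x => itg 0 be (fun y =>
     (w - 1 / 2) * (ka i y * (f t x y * f t (x + w) (y + s i)))))).
  congr itg; apply/funext => w; rewrite /pairing -itgZ; last by cts.
  by congr itg; apply/funext => x; rewrite -itgZ; last by cts.
rewrite ler_norml JE; apply/andP; split; last first.
  apply: le_trans H; apply: itg_le; [by cts|by cts|move=> w w01].
  apply: itg_le; [by cts|by cts|move=> x _].
  by apply: itg_le; [by cts|by cts|move=> y yb; exact: ptP].
rewrite lerNl; apply: le_trans H.
rewrite -itgN; last by cts.
apply: itg_le; [by cts|by cts|move=> w w01].
rewrite -itgN; last by cts.
apply: itg_le; [by cts|by cts|move=> x _].
rewrite -itgN; last by cts.
apply: itg_le; [by cts|by cts|move=> y yb].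
by rewrite lerNl; exact: ptN.
Qed.

Lemma rate_coercive t : t0 < t -> rho * E t / 272 - C4 * (nu * D t) <= rate t.
Proof.
move=> t0t.
pose W y := \sum_(i < n) ka i y * (b y - b (y + s i)).
have cW : continuous W.
  by apply: cts_sum => i; apply: ctsM; [exact: cka|cts].
(* At distance d from both ends [wlow] applies; as d is a multiple of r, rho d^2 D is a multiple of
   nu D. *)
pose d := 2 * n%:R * r.
have d0 : 0 <= d by rewrite /d -mulrA mulr_ge0// ltW.
have d4 : d <= 1 / 4 by have := nr; rewrite /d; lra.
have dd : d <= 1 - d by have := d4; lra.
have db : 1 - d <= be by rewrite /d /be; have := nr0; lra.
have ddE : rho * (4 * d ^+ 2 * D t) = 16 * n%:R ^+ 2 * (nu * D t).
  by rewrite /d nuE /rho; ring.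
pose P := itg 0 1 (fun x => itg d (1 - d) (fun y => f t x y ^+ 2)).
have duy (x y : R) : 0 < y < 1 -> is_derive y (1 : R) (f t x) (fy t x y) by exact: (sf_dy F).
have cft' : continuous (fun p : R * R => f t p.1 p.2) by cts.
have cfyt : continuous (fun p : R * R => fy t p.1 p.2) by cts.
have cfxt : continuous (fun p : R * R => fx t p.1 p.2) by cts.
have B := boundary_layer_bound cft' cfyt duy d0 d4.
apply: (@coercive_rate R (itg 0 1 (fun x => itg 0 be (fun y => W y * f t x y ^+ 2)))
   n%:R C1 eta rho S 0 (E t) (nu * D t) P (rate t) 0) => //.
- by rewrite ltr0n.
- rewrite -ddE (_ : 4 * (rho * P) = rho * (4 * P)); last by ring.
  by rewrite -mulrDr ler_wpM2l// ltW.
- exact: weighted_lower_bound.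
have low (i : 'I_n) : itg 0 1 (fun x => itg 0 be (fun y => ka i y * (b y - b (y + s i)) * f t x y ^+ 2))
    - (3 * C1 * eta * (rho * E t) + S * (nu * D t)) <=
    itg 0 1 (fun w => (w - 1 / 2) *
      pairing_rate nu 0 be (s i) w b (ka i) (dka i) (f t) (fx t) (fy t)).
  rewrite opprD addrA.
  apply: (@rate_lower_bound R nu rho r n%:R C1 b (f t) (fx t) (fy t)) => //.
  - by move=> x y; exact: (sf_dx F).
  - by move=> x y; exact: (sf_per F).
  - by move=> x y; exact: (sf_pery F).
  - by move=> y; exact: mean0.
  - by move=> y yb; exact: wB.
  - by move=> y yb; exact: wdB.
  - by move=> y yb; exact: wKB.
apply: le_trans (ler_sum _ (fun i _ => low i)).
rewrite sumrB sumr_const card_ord [n%:R * _]mulr_natl lerD2r le_eqVlt; apply/orP; left; apply/eqP.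
rewrite -itg_sum; last by move=> i; cts.
congr itg; apply/funext => x; rewrite -itg_sum; last by move=> i; cts.
by congr itg; apply/funext => y; rewrite /W mulr_suml.
Qed.

(** J changes by O(E a), while its rate dominates rho E up to dissipation, whose time integral is
    O(E a) too. As E decreases, its integral is at least (c - a) E c. *)
Lemma integrated_decay a c : t0 < a -> a <= c ->
  rho * (c - a) * E c <= 272 * (2 * (n%:R * C1) + C4 / 2) * E a.
Proof.
move=> t0a ac; have t0a' := ltW t0a.
have nn0 : 0 <= n%:R :> R by exact: ler0n.
have e20 : 0 <= 2 * eta by apply: mulr_ge0; [exact: ler0n|exact: ltW].
have S0 : 0 <= S.
  apply: mulr_ge0; first exact: ltW.
  apply: addr_ge0; last exact: ler0n.
  by apply: addr_ge0; apply: divr_ge0 => //; exact: exprn_ge0.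
have C40 : 0 <= C4.
  apply: addr_ge0; last exact: mulr_ge0.
  by apply: divr_ge0; [apply: mulr_ge0; [exact: ler0n|exact: exprn_ge0]|exact: ler0n].
have H1 : itg a c (fun t => rho / 272 * E t - C4 * nu * D t) <= J c - J a.
  rewrite J_evolution//; apply: itg_le; [by cts|by rewrite /rate /pairing_rate; cts|].
  move=> t /andP[at_ _]; have := rate_coercive (lt_trans t0a at_).
  by rewrite mulrAC mulrA.
have H2 : J c - J a <= 2 * (n%:R * C1 * E a).
  apply: (difference_bound (J_bound t0a) (J_bound (lt_le_trans t0a ac))).
  by apply: ler_wpM2l; [apply: mulr_ge0 => //; exact: ltW|exact: energy_monotone].
have H3 := energy_dissipation t0a' ac.
rewrite itgB in H1; [|by cts|by cts].
rewrite !itgZ in H1; [|by cts|by cts].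
have H4 : (c - a) * E c <= itg a c E.
  apply: itg_ge_cst => // t /andP[at_ tc].
  by apply: energy_monotone; [exact: le_trans (ltW at_)|exact: ltW].
have H5 : rho * ((c - a) * E c) <= rho * itg a c E by apply: ler_wpM2l => //; exact: ltW.
have H6 : C4 * (2 * nu * itg a c D) <= C4 * E a.
  by apply: ler_wpM2l => //; rewrite -H3 lerDr; exact: E_ge0.
rewrite -mulrA; exact: absorb_dissipation H1 H2 H5 H6.
Qed.

End flow_decay.

(** * Extension of the profile and of the solution to the whole space *)

Definition clamp {R : realType} (y : R) : R := Num.max 0 (Num.min 1 y).

Section clamp.
Context {R : realType}.

Lemma clamp_bounds (y : R) : 0 <= clamp y <= 1.
Proof. by rewrite /clamp le_max lexx ge_max ler01 ge_min lexx. Qed.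

Lemma clamp_id (y : R) : 0 <= y <= 1 -> clamp y = y.
Proof. by move=> /andP[y0 y1]; rewrite /clamp (min_idPr y1) (max_idPr y0). Qed.

Lemma clamp_in (y : R) : 0 < y < 1 -> clamp y = y.
Proof. by move=> /andP[y0 y1]; rewrite clamp_id// !ltW. Qed.

Lemma clamp_cts : continuous (@clamp R).
Proof. by rewrite /clamp; cts. Qed.

(** Composition with a continuous map into X, later built from [clamp], turns continuity within the
    closed domain into global continuity. *)
Lemma within_comp_cts (T U : topologicalType) (X : set U) (g : U -> R) (h : T -> U) :
  {within X, continuous g} -> (forall t, X (h t)) -> continuous h ->
  continuous (fun t => g (h t)).
Proof.
move=> /subspace_continuousP cg Xh ch t.
apply: (cvg_comp h g); last exact: cg.
move=> P /= PX; have Q : nbhs t (h @^-1` (fun u => X u -> P u)) := ch t _ PX.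
by move: Q; apply: filterS => z Hz; exact: (Hz (Xh z)).
Qed.

Lemma cts_bounded01 (u : R -> R) : continuous u ->
  exists2 K, 0 <= K & forall x, 0 <= x <= 1 -> `|u x| <= K.
Proof.
move=> cu; have cn : continuous (fun x => `|u x|).
  by move=> x; apply: cvg_norm; exact: cu.
have [x _ Hx] := EVT_max (@ler01 R) (continuous_subspaceT cn).
by exists `|u x| => // y yb; apply: Hx; rewrite in_itv.
Qed.

Lemma cts_pos_lower01 (u : R -> R) : continuous u -> (forall x, 0 <= x <= 1 -> 0 < u x) ->
  exists2 k, 0 < k & forall x, 0 <= x <= 1 -> k <= u x.
Proof.
move=> cu u0; have [x x01 Hx] := EVT_min (@ler01 R) (continuous_subspaceT cu).
exists (u x); first by apply: u0; rewrite in_itv in x01.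
by move=> y yb; apply: Hx; rewrite in_itv.
Qed.

End clamp.

Lemma openD_unit {R : realType} D (y : R) : 0 < y < 1 -> openD D y.
Proof. by case: D => //= y01; rewrite in_itv. Qed.

Lemma closedD_unit {R : realType} D (y : R) : 0 <= y <= 1 -> closedD D y.
Proof. by case: D => //= y01; rewrite in_itv. Qed.

Section profile.
Context {R : realType}.
Variables (D : ydomain) (b : R -> R) (B : nat -> R -> R) (hb : smooth_y D b B).
Variables (M : nat) (yc : 'I_M -> R) (Nc : 'I_M -> nat) (hcrit : critical_points D B yc Nc).

Let G k (y : R) := B k (clamp y).

Lemma profile_cts k : continuous (G k).
Proof.
have [_ _ cB _] := hb.
apply: (within_comp_cts (cB k)); last exact: clamp_cts.
by move=> t; apply: closedD_unit; exact: clamp_bounds.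
Qed.

Lemma profile_derive k (z : R) : 0 < z < 1 -> is_derive z (1 : R) (G k) (G k.+1 z).
Proof.
move=> z01; have [_ _ _ dB] := hb.
apply: (isd_oo_near z01 (u := B k)); first by move=> x x01; rewrite /G clamp_in.
by rewrite /G clamp_in//; apply: dB; exact: openD_unit.
Qed.

Lemma profile_bounded (m : nat) :
  exists2 K, 0 <= K & forall k z, (k <= m)%N -> `|G k z| <= K.
Proof.
have one k : exists2 K, 0 <= K & forall z, `|G k z| <= K.
  have [K K0 HK] := cts_bounded01 (@profile_cts k).
  exists K => // z; have := HK (clamp z) (clamp_bounds z).
  by rewrite /G clamp_id// clamp_bounds.
elim: m => [|m [K K0 HK]].
  by have [K K0 HK] := one 0%N; exists K => // k z; rewrite leqn0 => /eqP ->.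
have [K' K'0 HK'] := one m.+1; exists (K + K'); first exact: addr_ge0.
move=> k z; rewrite leq_eqVlt => /predU1P[->|km].
  by apply: (le_trans (HK' z)); rewrite lerDr.
by apply: (le_trans (HK k z km)); rewrite lerDl.
Qed.

(** Periodicity is differentiated repeatedly. It carries nondegeneracy from 0 to 1, since [fundD]
    omits 1 on the circle. *)
Lemma profile_periodic k (y : R) : D = Circle -> B k (y + 1) = B k y.
Proof.
move=> DC; have [pb B0 _ dB] := hb; rewrite DC in pb B0 dB.
elim: k y => [|k IH] y; first by rewrite !B0.
apply: isd_unique (dB k y I).
have := isd_shift (w := 1) (dB k (y + 1) I).
by under eq_fun do rewrite IH.
Qed.

(** At y_i the derivative of order N_i + 1 <= n is nonzero, elsewhere the first one is, and
    compactness of [0, 1] provides c0. For M = 0 the maximum is 0 and b' alone is summed. *)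
Lemma profile_nondegenerate :
  exists2 c0, 0 < c0 &
    forall z, c0 <= \sum_(j < (\max_(i < M) Nc i).+1) G j.+1 z ^+ 2.
Proof.
set n := (_).+1; have [_ crit _ _ nz] := hcrit.
have cQ : continuous (fun z => \sum_(j < n) G j.+1 z ^+ 2).
  by apply: cts_sum => j; apply: ctsX; exact: profile_cts.
have fund z : fundD D z -> exists j : 'I_n, B j.+1 z != 0.
  move=> Dz; have [B1|B1] := eqVneq (B 1%N z) 0; last by exists ord0.
  have /crit[i zi] := conj Dz B1.
  have iN : (Nc i < n)%N by rewrite ltnS; exact: leq_bigmax.
  by exists (Ordinal iN); rewrite zi; exact: nz.
have unit z : 0 <= z <= 1 -> exists j : 'I_n, B j.+1 z != 0.
  move=> z01; case DE : D; last by apply: fund; rewrite DE /= in_itv.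
  move: z01 => /andP[z0]; rewrite le_eqVlt => /predU1P[->|z1].
    have [|j Bj] := fund 0; first by rewrite DE /= in_itv/= lexx ltr01.
    by exists j; rewrite -[1]add0r profile_periodic.
  by apply: fund; rewrite DE /= in_itv/= z0.
have [|c0 c00 H] := cts_pos_lower01 cQ.
  move=> z z01; have [j Bj] := unit z z01.
  rewrite (bigD1 j)//= ltr_pwDl//; last by apply: sumr_ge0 => i _; exact: sqr_ge0.
  by rewrite lt_def sqr_ge0 andbT expf_neq0// /G clamp_id.
exists c0 => // z; have := H (clamp z) (clamp_bounds z).
by under eq_bigr do rewrite /G clamp_id ?clamp_bounds//.
Qed.

End profile.

Section flow_of_solution.
Context {R : realType}.
Variables (c : bcond) (b : R -> R) (B : nat -> R -> R) (nu : R) (f : R -> R -> R -> R).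
Hypothesis hb : smooth_y (bcond_domain c) b B.
Variable F : nat -> nat -> nat -> R -> R -> R -> R.
Hypothesis hF : smooth_txy (bcond_domain c) f F.
Hypothesis hbc : forall t : R, 0 < t -> boundary_condition c (f t) (F 0%N 0%N 1%N t).
Hypothesis hpde : forall t x y : R, 0 < t -> openD (bcond_domain c) y ->
  F 1%N 0%N 0%N t x y + b y * F 0%N 1%N 0%N t x y - nu * F 0%N 0%N 2%N t x y = 0.
Variable a : R.
Hypothesis a0 : 0 < a.

(** Time is frozen before a and y is clamped. Since a > 0, only points where the solution is smooth
    up to the boundary are sampled. *)
Let H i j k (t x y : R) := F i j k (Num.max a t) x (clamp y).

Let HE i j k (t x y : R) : a <= t -> 0 <= y <= 1 -> H i j k t x y = F i j k t x y.
Proof. by move=> at_ y01; rewrite /H clamp_id// (max_idPr at_). Qed.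

Lemma solution_cts i j k : continuous (fun p : R * R * R => H i j k p.1.1 p.1.2 p.2).
Proof.
have [_ _ _ cF _] := hF; have ccl := @clamp_cts R.
apply: (within_comp_cts (h := fun p : R * R * R => (Num.max a p.1.1, p.1.2, clamp p.2)) (cF i j k)).
  move=> p; split => /=; first by rewrite lt_max a0.
  by apply: closedD_unit; exact: clamp_bounds.
by apply: cts_pair; [apply: cts_pair|]; cts.
Qed.

Lemma solution_shear_flow :
  shear_flow a nu (fun y => B 0%N (clamp y)) (H 0 0 0) (H 1 0 0) (H 0 1 0) (H 0 0 1) (H 0 0 2).
Proof.
have [perx pery F0 cF dF] := hF; have [_ B0 _ _] := hb.
have u01 (y : R) : 0 < y < 1 -> 0 <= y <= 1 by move=> /andP[? ?]; rewrite !ltW.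
have cl01 (y : R) : 0 < y < 1 -> closedD (bcond_domain c) y.
  by move=> y01; apply: closedD_unit; exact: u01.
have Fper (t x y : R) : 0 < t -> 0 < y < 1 -> F 0%N 0%N 0%N t (x + 1) y = F 0%N 0%N 0%N t x y.
  move=> t0 y01; rewrite (F0 _ _ _ t0 (cl01 _ y01)) (F0 _ _ _ t0 (cl01 _ y01)).
  exact: perx t0 (cl01 _ y01).
have dyF k (t x y : R) : 0 < t -> 0 < y < 1 ->
    is_derive y (1 : R) (F 0%N 0%N k t x) (F 0%N 0%N k.+1 t x y).
  by move=> t0 y01; have [] := dF 0%N 0%N k t x y t0 (openD_unit _ y01).
have b01 : (0 <= (0 : R) <= 1) /\ (0 <= (1 : R) <= 1) by split; rewrite lexx ler01.
split; [exact: (profile_cts hb)|exact: solution_cts|exact: solution_cts|exact: solution_cts|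
  exact: solution_cts|exact: solution_cts|..].
- move=> t x y at_ y01; have t0 := lt_trans a0 at_.
  have [dt _ _] := dF 0%N 0%N 0%N t x y t0 (openD_unit _ y01).
  rewrite HE ?(ltW at_) ?u01//.
  apply: (isd_oo_near (c := a) (d := t + 1) (u := fun t => F 0%N 0%N 0%N t x y)) => //.
    by rewrite at_ /= ltrDl ltr01.
  by move=> z /andP[az _]; rewrite HE ?(ltW az) ?u01.
- move=> t x y at_ y01; have t0 := lt_trans a0 at_.
  have [_ dx _] := dF 0%N 0%N 0%N t x y t0 (openD_unit _ y01).
  by under eq_fun do rewrite HE ?(ltW at_) ?u01//; rewrite HE ?(ltW at_) ?u01.
- move=> t x y at_ y01; have t0 := lt_trans a0 at_.
  rewrite HE ?(ltW at_) ?u01//.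
  apply: (isd_oo_near y01 (u := F 0%N 0%N 0%N t x)); last exact: dyF.
  by move=> z z01; rewrite HE ?(ltW at_) ?u01.
- move=> t x y at_ y01; have t0 := lt_trans a0 at_.
  rewrite HE ?(ltW at_) ?u01//.
  apply: (isd_oo_near y01 (u := F 0%N 0%N 1%N t x)); last exact: dyF.
  by move=> z z01; rewrite HE ?(ltW at_) ?u01.
- move=> t x y at_ y01; have t0 := lt_trans a0 at_.
  by rewrite !HE ?(ltW at_) ?u01//; exact: Fper.
- move=> t x y at_ y01; have t0 := lt_trans a0 at_.
  rewrite !HE ?(ltW at_) ?u01//.
  (* Periodicity passes from f to [fy] by uniqueness of the derivative. *)
  apply: isd_unique (dyF 0%N t x y t0 y01).
  apply: (isd_oo_near y01 (u := F 0%N 0%N 0%N t (x + 1))); last exact: dyF.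
  by move=> z z01; exact: Fper.
- move=> t x x' at_; have t0 := lt_trans a0 at_; have [b0 b1] := b01.
  rewrite !HE ?(ltW at_)//.
  have clo (y : R) : 0 <= y <= 1 -> closedD (bcond_domain c) y by exact: closedD_unit.
  have := hbc t0; case cE : c => /=.
  (* On the circle the values at 0 and 1 agree, for f by periodicity and for its y-derivative by
     differentiating the periodicity. *)
  + move=> _; have oC (y : R) : openD (bcond_domain c) y by rewrite cE.
    have cC (y : R) : closedD (bcond_domain c) y by rewrite cE.
    have pE (z y : R) : F 0%N 0%N 0%N t z (y + 1) = F 0%N 0%N 0%N t z y.
      by rewrite !F0//; have := pery t z t0; rewrite cE; exact.
    have pE' (z y : R) : F 0%N 0%N 1%N t z (y + 1) = F 0%N 0%N 1%N t z y.
      have [_ _ d1] := dF 0%N 0%N 0%N t z (y + 1) t0 (oC _).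
      have [_ _ d0] := dF 0%N 0%N 0%N t z y t0 (oC _).
      apply: isd_unique d0; have := isd_shift d1.
      by under eq_fun do rewrite pE.
    have e1 z : F 0%N 0%N 0%N t z 1 = F 0%N 0%N 0%N t z 0 by rewrite -[1]add0r pE.
    have e2 z : F 0%N 0%N 1%N t z 1 = F 0%N 0%N 1%N t z 0 by rewrite -[1]add0r pE'.
    by rewrite !e1 !e2.
  + move=> h.
    have e0 z : F 0%N 0%N 0%N t z 0 = 0 by rewrite (F0 _ _ _ t0 (clo _ b0)); case: (h z).
    have e1 z : F 0%N 0%N 0%N t z 1 = 0 by rewrite (F0 _ _ _ t0 (clo _ b1)); case: (h z).
    by rewrite !e0 !e1 !mulr0 !mul0r.
  + move=> h; have [-> ->] := h x; have [-> ->] := h x'.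
    by rewrite !mulr0 !mul0r.
- move=> t x y at_ y01; have t0 := lt_trans a0 at_.
  rewrite !HE ?(ltW at_) ?u01// (clamp_in y01) (B0 _ (cl01 _ y01)).
  by apply: hpde => //; exact: openD_unit.
Qed.

End flow_of_solution.

Lemma shear_flow_decay {R : realType} (n : nat) (G : nat -> R -> R) (K c0 : R) :
  (0 < n)%N -> (forall k, continuous (G k)) ->
  (forall k (z : R), 0 < z < 1 -> is_derive z (1 : R) (G k) (G k.+1 z)) ->
  0 <= K -> (forall k z, (k <= n.+1)%N -> `|G k z| <= K) ->
  0 < c0 -> (forall z, c0 <= \sum_(j < n) G j.+1 z ^+ 2) ->
  exists d r1 : R, [/\ 0 < d, 0 < r1 & forall (r nu t0 : R) (f ft fx fy fyy : R -> R -> R -> R),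
    0 < r -> r <= r1 -> nu = r ^+ n * r ^+ 2 ->
    shear_flow t0 nu (G 0%N) f ft fx fy fyy ->
    (forall t y : R, t0 < t -> 0 < y < 1 -> itg 0 1 (fun x => f t x y) = 0) ->
    forall a t, t0 < a -> a <= t ->
    itg 0 1 (fun x => itg 0 1 (fun y => f t x y ^+ 2)) <=
    expR 1 * expR (- (d * r ^+ n * (t - a))) *
      itg 0 1 (fun x => itg 0 1 (fun y => f a x y ^+ 2))].
Proof.
move=> n0 cG dG K0 GK c00 Gc.
have [C1 [r1 [C10 r10 r11 nr1 HW]]] := shear_weights n0 cG dG K0 GK c00 Gc.
(* These are the constants of [integrated_decay]; they involve only n and C1, so d is fixed before
   r, nu and the flow. *)
pose eta := (816 * n%:R * C1)^-1.
pose S := C1 * (n%:R ^+ 2 / (2 * eta) + 1 / (2 * eta) + 2).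
pose C4 := 16 * n%:R ^+ 2 / 136 + n%:R * S.
pose C := 272 * (2 * (n%:R * C1) + C4 / 2).
have nn0 : 0 < n%:R :> R by rewrite ltr0n.
have eta0 : 0 < eta by rewrite invr_gt0 !mulr_gt0 ?ltr0n.
have e20 : 0 < 2 * eta by apply: mulr_gt0; [rewrite ltr0n|exact: eta0].
have S0 : 0 <= S.
  apply: mulr_ge0; first exact: ltW.
  apply: addr_ge0; last exact: ler0n.
  by apply: addr_ge0; apply: divr_ge0; rewrite ?exprn_ge0// ltW.
have C40 : 0 <= C4.
  apply: addr_ge0; last by apply: mulr_ge0 => //; exact: ltW.
  by apply: divr_ge0; [apply: mulr_ge0; [exact: ler0n|rewrite exprn_ge0// ltW]|exact: ler0n].
have C0 : 0 < C.
  apply: mulr_gt0; first by rewrite ltr0n.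
  apply: ltr_pwDl; first by rewrite !mulr_gt0 ?ltr0n.
  exact: divr_ge0.
exists (expR 1 * C)^-1, r1; split => //; first by rewrite invr_gt0 mulr_gt0// expR_gt0.
move=> r nu t0 f ft fx fy fyy r0 rr1 nuE F mean0 a t t0a at_.
have [ka [dka [wc wB wdB wKB [wpos wlow]]]] := HW r r0 rr1.
have nr : 8 * n%:R * r <= 1.
  by apply: le_trans nr1; apply: ler_wpM2l => //; apply: mulr_ge0 => //; exact: ltW.
pose E t := itg 0 1 (fun x => itg 0 1 (fun y => f t x y ^+ 2)).
have rho0 : 0 < r ^+ n by rewrite exprn_gt0.
have D1 := @exp_decay R E a (r ^+ n) C rho0 C0.
have E0 t' : a <= t' -> 0 <= E t' by move=> _; exact: (E_ge0 F t').
have Em a' c : a <= a' -> a' <= c -> E c <= E a'.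
  move=> aa' a'c; apply: (energy_monotone r0 nuE F) => //.
  exact: le_trans (ltW t0a) aa'.
have Ei a' c : a <= a' -> a' <= c -> r ^+ n * (c - a') * E c <= C * E a'.
  move=> aa' a'c; apply: (integrated_decay n0 C10 r0 nr nuE F mean0 wc wB wdB wKB wpos wlow) => //.
  exact: lt_le_trans t0a aa'.
have := D1 E0 Em Ei t at_.
rewrite (_ : r ^+ n * (t - a) / (expR 1 * C) = (expR 1 * C)^-1 * r ^+ n * (t - a)) //.
by rewrite mulrC mulrA.
Qed.

(** * The limit at time 0 and the conclusion *)

Lemma absorb_initial {R : realType} (k p q e : R) : 0 < k -> q < e / (2 * k) ->
  k * (2 * p + 2 * q) <= 2 * k * p + e.
Proof. by move=> k0; rewrite ltr_pdivlMr ?mulr_gt0// => h; lra. Qed.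

Section initial_layer.
Context {R : realType}.

Lemma square_integral_double (u v : R -> R -> R) :
  continuous (fun p : R * R => u p.1 p.2) -> continuous (fun p : R * R => v p.1 p.2) ->
  itg 0 1 (fun x => itg 0 1 (fun y => u x y ^+ 2)) <=
  2 * itg 0 1 (fun x => itg 0 1 (fun y => v x y ^+ 2)) +
  2 * itg 0 1 (fun x => itg 0 1 (fun y => (u x y - v x y) ^+ 2)).
Proof.
move=> cu cv; rewrite -itgZ; last by cts.
rewrite -itgZ; last by cts.
rewrite -itgD; [|by cts|by cts].
apply: itg_le; [by cts|by cts|move=> x _].
rewrite -itgZ; last by cts.
rewrite -itgZ; last by cts.
rewrite -itgD; [|by cts|by cts].
apply: itg_le; [by cts|by cts|move=> y _].
move: (u x y) (v x y) => p q; have := sqr_ge0 (p - 2 * q); lra.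
Qed.

(** As v has zero x-mean, the x-mean of u is that of u - v, and Jensen's inequality applies. *)
Lemma mean_square_diff (u v : R -> R -> R) :
  continuous (fun p : R * R => u p.1 p.2) -> continuous (fun p : R * R => v p.1 p.2) ->
  (forall y, 0 < y < 1 -> itg 0 1 (v^~ y) = 0) ->
  itg 0 1 (fun y => itg 0 1 (u^~ y) ^+ 2) <=
  itg 0 1 (fun x => itg 0 1 (fun y => (u x y - v x y) ^+ 2)).
Proof.
move=> cu cv mv.
have cd : continuous (fun p : R * R => (u p.1 p.2 - v p.1 p.2) ^+ 2) by cts.
rewrite (@itg_swap R 0 1 0 1 (fun x y => (u x y - v x y) ^+ 2) ler01 ler01 cd).
apply: itg_le; [by cts|by cts|move=> y y01].
have -> : itg 0 1 (u^~ y) = itg 0 1 (fun x => u x y - v x y).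
  rewrite itgB; [|by cts|by cts].
  by rewrite mv// subr0.
by apply: itg_sqr_le; cts.
Qed.

(** Continuity at 0 supplies strictly positive times, where the solution is smooth, as early as
    desired. *)
Lemma small_L2norm (g : R -> R -> R -> R) :
  L2norm (g t) @[t --> within [set t : R | 0 <= t] (nbhs (0 : R))] --> 0%E ->
  forall e T, 0 < e -> 0 < T -> exists2 a : R, 0 < a < T & (L2norm (g a) < e%:E)%E.
Proof.
move=> cg e T e0 T0.
have [d /= d0 Hd] : \forall t \near (0 : R), 0 <= t -> (L2norm (g t) < e%:E)%E.
  apply: (cg [set x | (x < e%:E)%E]).
  by apply: open_nbhs_nbhs; split; [exact: open_ereal_lt_ereal|rewrite /= lte_fin].
pose a := Num.min (d / 2) (T / 2).
have a0 : 0 < a by rewrite lt_min !divr_gt0.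
exists a.
  by rewrite a0 gt_min; apply/orP; right; rewrite ltr_pdivrMr// mulr_natr mulr2n ltrDl.
apply: Hd; last exact: ltW.
rewrite /ball/= sub0r normrN gtr0_norm// gt_min; apply/orP; left.
by rewrite ltr_pdivrMr// mulr_natr mulr2n ltrDl.
Qed.

End initial_layer.

Lemma square_double {R : realType} (e y z : R) : y ^+ 2 = z -> 2 * (e * e * z) <= (2 * e * y) ^+ 2.
Proof.
move=> <-; have -> : (2 * e * y) ^+ 2 = 4 * (e ^+ 2 * y ^+ 2) by ring.
have -> : 2 * (e * e * y ^+ 2) = 2 * (e ^+ 2 * y ^+ 2) by ring.
have := mulr_ge0 (sqr_ge0 e) (sqr_ge0 y); lra.
Qed.

Theorem theorem1p1 (R : realType) (D : ydomain)
    (b : R -> R) (B : nat -> R -> R) (hb : smooth_y D b B)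
    (M : nat) (yc : 'I_M -> R) (Nc : 'I_M -> nat)
    (hcrit : critical_points D B yc Nc)
    (N : nat) (hN : N = (\max_(i < M) Nc i)%N) :
  exists d0 nu0 C : R, [/\ 0 < d0, 0 < nu0, 1 < C &
    forall (c : bcond) (nu : R) (fin : R -> R -> R) (f : R -> R -> R -> R),
      bcond_domain c = D -> 0 < nu < nu0 ->
      initial_datum c fin -> x_mean_zero c fin ->
      solution c b nu fin f ->
      forall t : R, 0 < t ->
        (L2norm (f t) <=
          C%:E * L2norm fin *
          (expR (- d0 * nu `^ (N.+1%:R / N.+3%:R) * t))%:E)%E].
Proof.
(* N + 2 = n + 1: the Taylor remainder involves one derivative beyond the n that are
   interpolated. *)
have [K K0 HK] := profile_bounded hb N.+2.
have [c0 c00 Hc] := profile_nondegenerate hb hcrit.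
rewrite -hN in Hc.
have [d [r1 [d0 r10 decay]]] := shear_flow_decay (G := fun k y => B k (clamp y)) (ltn0Sn N)
  (profile_cts hb) (fun k z => @profile_derive R D b B hb k z) K0 HK c00 Hc.
(* d is a rate for the squared norm, hence d / 2; nu < r1^(N+3) means r < r1. The squared norm gets
   the constant 2 e^2: 2 from comparing the energy at time a with that of the datum, one e from
   [exp_decay], one e from the delayed start. Its root is at most 2 e. *)
exists (d / 2), (r1 ^+ N.+3), (2 * expR 1); split.
- by rewrite divr_gt0.
- by rewrite exprn_gt0.
- by have := expR_ge1Dx (1 : R); lra.
move=> c nu fin f cD /andP[nu0 nu1] [G hG _] hmean [f0 fcont [F [hF hbc hpde]]] t t0.
subst D.
pose r := nu `^ (N.+3%:R)^-1.
have r0 : 0 < r by exact: powR_gt0.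
have rN : r ^+ N.+3 = nu.
  by rewrite -powR_mulrn ?ltW// -powRrM mulVf ?powRr1 ?ltW// pnatr_eq0.
have nuE : nu = r ^+ N.+1 * r ^+ 2 by rewrite -exprD addn2.
have rr1 : r <= r1.
  rewrite leNgt; apply/negP => /ltW r1r; move: nu1; rewrite ltNge -rN => /negP; apply.
  by rewrite lerXn2r ?nnegrE// ltW.
have rateE : nu `^ (N.+1%:R / N.+3%:R) = r ^+ N.+1.
  by rewrite -powR_mulrn ?ltW// -powRrM mulrC.
have [perx _ F0 _ _] := hF; have [_ _ G0 cG _] := hG.
have clo (y : R) : 0 <= y <= 1 -> closedD (bcond_domain c) y by exact: closedD_unit.
have u01 (y : R) : 0 < y < 1 -> 0 <= y <= 1 by move=> /andP[? ?]; rewrite !ltW.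
pose H t x y := F 0%N 0%N 0%N t x (clamp y).
pose h0 x y := G 0%N 0%N x (clamp y).
have ccl := @clamp_cts R.
have ch0 : continuous (fun p : R * R => h0 p.1 p.2).
  apply: (within_comp_cts (h := fun p : R * R => (p.1, clamp p.2)) (cG 0%N 0%N)).
    by move=> p; apply: clo; exact: clamp_bounds.
  by apply: cts_pair; cts.
have maxH (s t' : R) : s <= t' -> (fun x y => F 0%N 0%N 0%N (Num.max s t') x (clamp y)) = H t'.
  by move=> st; rewrite (max_idPr st).
have cH (s : R) : 0 < s -> continuous (fun p : R * R => H s p.1 p.2).
  move=> s0.
  have cS : continuous (fun p : R * R * R =>
      F 0%N 0%N 0%N (Num.max s p.1.1) p.1.2 (clamp p.2)) by exact: (solution_cts hF s0).
  rewrite -(maxH s s (lexx s)).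
  exact: (@cts_comp3 _ _ (fun t x y => F 0%N 0%N 0%N (Num.max s t) x (clamp y)) (fun=> s) fst snd cS
    (@cts_cst _ _ s) (cts_fst (@cts_id _)) (cts_snd (@cts_id _))).
have fH (s x y : R) : 0 < s -> 0 <= y <= 1 -> f s x y = H s x y.
  by move=> s0 y01; rewrite /H (clamp_id y01) (F0 _ _ _ s0 (clo _ y01)).
have finh (x y : R) : 0 <= y <= 1 -> fin x y = h0 x y.
  by move=> y01; rewrite /h0 (clamp_id y01) (G0 _ _ (clo _ y01)).
pose En s := itg 0 1 (fun x => itg 0 1 (fun y => H s x y ^+ 2)).
pose Ed s := itg 0 1 (fun x => itg 0 1 (fun y => (H s x y - h0 x y) ^+ 2)).
pose E0 := itg 0 1 (fun x => itg 0 1 (fun y => h0 x y ^+ 2)).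
have normE s : 0 < s -> L2norm (f s) = (Num.sqrt (En s))%:E.
  by move=> s0; apply: L2norm_cts; [exact: cH|move=> x y _ y01; exact: fH].
have norm0 : L2norm fin = (Num.sqrt E0)%:E.
  by apply: L2norm_cts => // x y _ y01; exact: finh.
have normd s : 0 < s -> L2norm (fun x y => f s x y - f 0 x y) = (Num.sqrt (Ed s))%:E.
  move=> s0; have cHs := cH s s0.
  apply: (L2norm_cts (h := fun x y => H s x y - h0 x y)); first by cts.
  by move=> x y _ y01; rewrite fH// (f0 _ _ (clo _ y01)) finh.
have small e T : 0 < e -> 0 < T -> exists2 a, 0 < a < T & Ed a < e.
  move=> e0 T0; have se0 : 0 < Num.sqrt e by rewrite sqrtr_gt0.
  have [a /andP[a0 aT]] := small_L2norm (fcont 0 (lexx _)) se0 T0.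
  by rewrite normd// lte_fin ltr_sqrt// => Ea; exists a; rewrite ?a0.
have flow s (s0 : 0 < s) := solution_shear_flow hb hF hbc hpde s0.
have perH (s x y : R) : 0 < s -> 0 < y < 1 -> H s (x + 1) y = H s x y.
  move=> s0 y01; rewrite -!fH ?u01//.
  by apply: perx => //; apply: clo; exact: u01.
have mean_h0 y : 0 < y < 1 -> itg 0 1 (h0^~ y) = 0.
  move=> y01; rewrite itg_fine.
  have -> : (fun x => (h0 x y)%:E) = (fun x => (fin x y)%:E).
    by apply/funext => x; rewrite finh// u01.
  by rewrite hmean//; apply: clo; exact: u01.
(* The squared mean at s is at most that at an earlier time a, which is at most [Ed a] because [h0]
   has zero x-mean; and [Ed a] can be made arbitrarily small. *)
have mean_sq s : 0 < s -> itg 0 1 (fun y => itg 0 1 ((H s)^~ y) ^+ 2) = 0.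
  move=> s0; apply/eqP; rewrite eq_le; apply/andP; split; last first.
    by have cHs := cH s s0; apply: itg_ge0; [cts|move=> y _; exact: sqr_ge0].
  apply/ler_addgt0Pr => e e0; rewrite add0r.
  have [a /andP[a0 as_] /ltW Ea] := small e s e0 s0.
  apply: le_trans Ea.
  have Hd := mean_square_diff (cH a a0) ch0 mean_h0.
  apply: le_trans Hd.
  have := mean_decay (flow a a0) (ltW nu0) (lexx a) (ltW as_).
  rewrite (maxH a s (ltW as_)) (maxH a a (lexx a)).
  by rewrite !mean_square_pairing//; [exact: cH|move=> x y; exact: perH|exact: cH|move=> x y; exact: perH].
have mean_zero (s y : R) : 0 < s -> 0 < y < 1 -> itg 0 1 (fun x => H s x y) = 0.
  move=> s0 y01; have cHs := cH s s0; apply/eqP; rewrite -sqrf_eq0; apply/eqP.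
  apply: (itg_eq0 (u := fun y => itg 0 1 ((H s)^~ y) ^+ 2) ler01 _ _ (mean_sq s s0) y01); first by cts.
  by move=> z _; exact: sqr_ge0.
pose X := d * r ^+ N.+1.
have X0 : 0 < X by rewrite mulr_gt0// exprn_gt0.
pose Kt := expR 1 * expR 1 * expR (- (X * t)).
have Kt0 : 0 < Kt by rewrite !mulr_gt0 ?expR_gt0.
have key : En t <= 2 * Kt * E0.
  apply/ler_addgt0Pr => e e0.
  have e'0 : 0 < e / (2 * Kt) by rewrite divr_gt0// mulr_gt0.
  (* With a < 1 / X, starting at time a costs at most the factor e, as used in [D3]. *)
  have T0 : 0 < Num.min t X^-1 by rewrite lt_min t0 invr_gt0.
  have [a /andP[a0]] := small _ _ e'0 T0.
  rewrite lt_min => /andP[/ltW at_ aX] Ea.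
  (* The flow starts at a / 2, so that a is strictly later, as [decay] requires. *)
  have a20 : 0 < a / 2 by rewrite divr_gt0.
  have a2a : a / 2 < a by lra.
  have m0 (t' y : R) : a / 2 < t' -> 0 < y < 1 ->
      itg 0 1 (fun x => F 0%N 0%N 0%N (Num.max (a / 2) t') x (clamp y)) = 0.
    move=> at' y01; rewrite (max_idPr (ltW at')).
    by apply: (mean_zero t' y _ y01); exact: lt_trans at'.
  have := decay r nu (a / 2) _ _ _ _ _ r0 rr1 nuE (flow _ a20) m0 a t a2a at_.
  rewrite (max_idPr (le_trans (ltW a2a) at_)) (max_idPr (ltW a2a)) -/(En t) -/(En a) -/X => D1.
  have D2 : En a <= 2 * E0 + 2 * Ed a := square_integral_double (cH a a0) ch0.
  have D3 : expR 1 * expR (- (X * (t - a))) <= Kt.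
    rewrite /Kt -mulrA ler_pM2l ?expR_gt0// -expRD ler_expR.
    have : X * a <= 1 by rewrite -(mulfV (lt0r_neq0 X0)) ler_pM2l// ltW.
    by rewrite mulrBr; lra.
  have En0 : 0 <= En a.
    have cHa := cH a a0; apply: itg_ge0; first by cts.
    by move=> x _; apply: itg_ge0; [cts|move=> y _; exact: sqr_ge0].
  apply: (le_trans D1); apply: (le_trans (ler_wpM2r En0 D3)).
  apply: (le_trans (ler_wpM2l (ltW Kt0) D2)).
  exact: absorb_initial Kt0 Ea.
rewrite (normE t t0) norm0 rateE -!EFinM lee_fin.
have E00 : 0 <= E0.
  apply: itg_ge0; first by cts.
  by move=> x _; apply: itg_ge0; [cts|move=> y _; exact: sqr_ge0].
have xE : expR (- (d / 2) * r ^+ N.+1 * t) ^+ 2 = expR (- (X * t)).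
  by rewrite expr2 -expRD; congr expR; rewrite /X; field.
have Y0 : 0 <= 2 * expR 1 * expR (- (d / 2) * r ^+ N.+1 * t) by rewrite !mulr_ge0// expR_ge0.
rewrite mulrAC -(ger0_norm Y0) -sqrtr_sqr -sqrtrM ?sqr_ge0//.
apply: ler_wsqrtr; apply: (le_trans key); apply: ler_wpM2r => //.
exact: square_double xE.
Qed.
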